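(* Let $N\geq1$ be an integer and $\mathcal{E}=\{X_1,W_1,\dots,W_{N-1}\}$. For any $d\geq 1$ and any smooth vector fields $f_0,f_1$ on a neighborhood of $0$ in $\mathbb{R}^d$ such that $f_0(0)=0$ and $\mathcal{L}_{2N}(f)(0)=\mathbb{R}^d$, the control system $$\dot x(t)=f_0(x(t))+\sum_{b\in\mathcal{E}}u_b(t)f_b(x(t))$$ with real-valued controls $(u_b)_{b\in\mathcal{E}}$ is small-state small-time locally controllable at $0$.
   Context: Let $\mathrm{Br}(X)$ be the free magma over $X=\{X_0,X_1\}$ (formal brackets); $|b|$ is the total number of occurrences of $X_0$ and $X_1$ in $b$. Set $M_0=X_1$ and, for $j\geq1$, $M_j=(M_{j-1},X_0)$ and $W_j=(M_{j-1},M_j)$. The Lie bracket of vector fields is $[f,g](x)=Dg(x)f(x)-Df(x)g(x)$; $f_b$ is obtained by replacing $X_i$ by $f_i$ in $b$ ($f_{X_i}=f_i$, $f_{(a,b)}=[f_a,f_b]$). $\mathcal{L}_{n}(f)(0)$ denotes the linear span of $\{f_b(0): b\in\mathrm{Br}(X),\ |b|\leq n\}$. The system is small-state small-time locally controllable (small-state STLC) at $0$ when: for every $T>0$ and every $\delta>0$ there exists $r>0$ such that, for every $x^*\in B(0,r)$, there exists $u\in L^1((0,T);\mathbb{R}^{|\mathcal{E}|})$ such that the solution with $x(0)=0$ associated with $u$ satisfies $x(T)=x^*$ and $x([0,T])\subset B(0,\delta)$. *)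

(* Defs.v *)
From HB Require Import structures.
From mathcomp Require Import all_boot all_order all_algebra.
From mathcomp Require Import all_classical all_reals all_analysis.

Set Implicit Arguments.
Unset Strict Implicit.
Unset Printing Implicit Defensive.

Import Order.TTheory GRing.Theory Num.Theory.
Import numFieldNormedType.Exports.

Local Open Scope classical_set_scope.
Local Open Scope ring_scope.

Inductive Br : Type := X0 | X1 | Brk of Br & Br.

Fixpoint Br_tree (b : Br) : GenTree.tree bool :=
  match b with
  | X0 => GenTree.Leaf false
  | X1 => GenTree.Leaf true
  | Brk a c => GenTree.Node 0 [:: Br_tree a; Br_tree c]
  end.

Fixpoint tree_Br (t : GenTree.tree bool) : option Br :=
  match t with
  | GenTree.Leaf i => Some (if i then X1 else X0)
  | GenTree.Node _ [:: s; t] =>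
      if tree_Br s is Some a then omap (Brk a) (tree_Br t) else None
  | _ => None
  end.

Lemma Br_treeK : pcancel Br_tree tree_Br.
Proof. by elim=> //= a -> c ->. Qed.

HB.instance Definition _ := Countable.copy Br (pcan_type Br_treeK).

Fixpoint Br_length (b : Br) : nat :=
  if b is Brk a c then (Br_length a + Br_length c)%N else 1%N.

Fixpoint M_ (j : nat) : Br := if j is i.+1 then Brk (M_ i) X0 else X1.

(* Only meant for j >= 1. *)
Definition W_ (j : nat) : Br := Brk (M_ j.-1) (M_ j).

(* {X_1, W_1, ..., W_{N-1}}, for N >= 1. *)
Definition ctrl_brackets (N : nat) : seq Br :=
  X1 :: [seq W_ j | j <- iota 1 N.-1].

Section VectorFields.
Context {R : realType} {d : nat}.
Local Notation V := ('rV[R]_d).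

(* F is of class C^k on the open set U: for k >= 1, F is differentiable at every
   point of U and all the maps x |-> DF(x) v are of class C^(k-1) on U. *)
Fixpoint class_C (k : nat) (U : set V) (F : V -> V) : Prop :=
  if k is k'.+1 then
    (forall x, U x -> differentiable F x) /\
    (forall v : V, class_C k' U (fun x => 'd F x v))
  else forall x, U x -> {for x, continuous F}.

Definition smooth_on (U : set V) (F : V -> V) : Prop :=
  forall k, class_C k U F.

Definition lie_bracket (f g : V -> V) : V -> V :=
  fun x => 'd g x (f x) - 'd f x (g x).

Fixpoint eval_Br (f0 f1 : V -> V) (b : Br) : V -> V :=
  match b with
  | X0 => f0
  | X1 => f1
  | Brk a c => lie_bracket (eval_Br f0 f1 a) (eval_Br f0 f1 c)
  end.

Definition linear_span (A : set V) : set V :=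
  [set v | exists (k : nat) (c : 'I_k -> R) (w : 'I_k -> V),
     (forall i, A (w i)) /\ v = \sum_(i < k) c i *: w i].

Definition L_at0 (n : nat) (f0 f1 : V -> V) : set V :=
  linear_span [set eval_Br f0 f1 b 0 | b in [set b | (Br_length b <= n)%N]].

Definition control_L1 (I : finType) (T : R) (u : I -> R -> R) : Prop :=
  forall i, (@lebesgue_measure R).-integrable `]0, T[ (EFin \o u i).

(* Caratheodory solution on [0, T] of x' = g0 x + \sum_i u_i (g i x), x(0) = 0,
   staying in the domain U of the vector fields.  Since x is continuous and the
   fields are continuous on U, the integrands below are integrable for L^1
   controls, and this is the unique such solution when they are smooth. *)
Definition is_solution (U : set V) (I : finType) (g0 : V -> V) (g : I -> V -> V)
    (T : R) (u : I -> R -> R) (x : R -> V) : Prop :=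
  [/\ {within `[0, T], continuous x},
      (forall t, 0 <= t <= T -> U (x t)) &
      forall t, 0 <= t <= T -> forall j : 'I_d,
        x t ord0 j =
        (\int[lebesgue_measure]_(s in `]0, t[)
           (g0 (x s) + \sum_i u i s *: g i (x s)) ord0 j)%R].

Definition small_state_STLC (U : set V) (I : finType)
    (g0 : V -> V) (g : I -> V -> V) : Prop :=
  forall T delta : R, 0 < T -> 0 < delta ->
  exists2 r : R, 0 < r &
  forall xs : V, ball (0 : V) r xs ->
  exists (u : I -> R -> R) (x : R -> V),
    [/\ control_L1 T u,
        is_solution U g0 g T u x,
        x T = xs &
        forall t, 0 <= t <= T -> ball (0 : V) delta (x t)].

End VectorFields.

(* Main.v *)
Require Import Defs.
From mathcomp Require Import all_boot all_order all_algebra.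
From mathcomp Require Import all_classical all_reals all_analysis.
From mathcomp Require Import measurable_realfun.
From mathcomp Require Import ring lra zify.
Set Implicit Arguments.
Unset Strict Implicit.
Unset Printing Implicit Defensive.
Import Order.TTheory GRing.Theory Num.Theory.
Import numFieldNormedType.Exports.
Local Open Scope classical_set_scope.
Local Open Scope ring_scope.

(** The system is replaced by its nilpotent approximation: the free associative algebra
on X_0 and X_1, truncated above degree K = 2N.  The control problem is solved there, and
scaling transports the solution back to the vector fields.

Formal side.  Words of length at most K index square matrices, on which X_0 and X_1 act as
x0 and x1 by left concatenation; only the grading of these matrices matters.  Following the
field sum_b c_b f_b during a unit of time corresponds to the exponential of the matrix
sum_b c_b b, where the coefficient of X_0, the duration, has to be positive.  A matrix Z is
two-sided if e^(tZ) is a limit of products of such exponentials for every real t.  As the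
controls are unbounded, X_1 and the W_j are two-sided, and two-sided matrices form a Lie
algebra.  The drift is only one-sided, but two_sided_drift extracts new two-sided
directions from it: if Z and [Z, [Z, x0]] are two-sided, so is [Z, x0], because conjugating
x0 by e^(sZ) gives x0 + s [Z, x0] up to a two-sided matrix, and s may be divided out as it
tends to either infinity.  For Z = M_j the second bracket is W_(j+1), which is a control
for j + 1 < N and which has degree 2j + 3 > 2N, hence vanishes, for j + 1 >= N.  So every
M_j is two-sided, and with them all brackets but X_0 (ctrl_ideal_two_sided).

Exact solutions.  Limits are turned into exact values by solvable_all: up to a factor
e^(T x0), every element close to 1 of the group attached to these brackets is the value of
a word of bounded length whose letters are bounded Lipschitz functions of the element.  The
induction is on the degree.  A word that approximates a target can be corrected exactly in
low degree, so the directions reached exactly in the next degree come within a bounded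
distance of every direction of that degree.  Such a set spans positively (positive_span),
and dilations realise the positive coefficients.

Back to the vector fields.  The iterated Lie derivatives of the coordinates form a matrix
that, along a trajectory, is multiplied on the right by the exponential of the letter, up
to terms of degree greater than K.  When the letters are dilated by e, these terms are
e^(K+1) times a bounded Lipschitz function (letter_step, word_steps).  The brackets of
length at most K span at 0, and f_0(0) = 0 makes the factor e^(T x0) harmless, so the
elements attached to a parameter q lead to the points e^K (k q + e R(e, q)) with R
Lipschitz in q.  The contraction principle shows that these points fill a ball
(local_reach).  The time that is left is spent waiting at the equilibrium 0, before the
pieces are run one after the other (traj_steers). *)

(** * Graded matrices *)

Section GradedMatrices.
Context {R : realType} {n : nat} (dg : 'I_n -> nat).
Local Notation A := 'M[R]_n.
Implicit Types (M P Z : A) (i j k : nat).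

Lemma scaleMl (a : R) M P : (a *: M) * P = a *: (M * P).
Proof. exact/esym/scalemxAl. Qed.

Lemma scaleMr (a : R) M P : M * (a *: P) = a *: (M * P).
Proof. exact/esym/scalemxAr. Qed.

Lemma scaleMX (a : R) M k : (a *: M) ^+ k = a ^+ k *: M ^+ k.
Proof.
elim: k => [|k IH]; first by rewrite !expr0 scale1r.
by rewrite !exprS IH scaleMl scaleMr scalerA.
Qed.

Lemma scale_comm (a b : R) M : GRing.comm (a *: M) (b *: M).
Proof. by rewrite /GRing.comm !(scaleMl, scaleMr) !scalerA mulrC. Qed.

(** M raises the degree of the index by at least k (low), or by exactly k (homog); column
b is mapped into the rows a with dg a >= dg b + k, respectively dg a = dg b + k. *)
Definition low k M := [forall a, forall b, (dg a < dg b + k)%N ==> (M a b == 0)].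
Definition homog k M := [forall a, forall b, (dg a != dg b + k)%N ==> (M a b == 0)].

Lemma lowP k M :
  reflect (forall a b, (dg a < dg b + k)%N -> M a b = 0) (low k M).
Proof.
apply: (iffP idP) => [/forallP h a b ab|h].
  by have /forallP/(_ b) := h a; rewrite ab => /eqP.
by apply/forallP => a; apply/forallP => b; apply/implyP => /h ->.
Qed.

Lemma homogP k M :
  reflect (forall a b, dg a != (dg b + k)%N -> M a b = 0) (homog k M).
Proof.
apply: (iffP idP) => [/forallP h a b ab|h].
  by have /forallP/(_ b) := h a; rewrite ab => /eqP.
by apply/forallP => a; apply/forallP => b; apply/implyP => /h ->.
Qed.

Lemma low0 k : low k 0. Proof. by apply/lowP => a b _; rewrite mxE. Qed.

Lemma lowD k M P : low k M -> low k P -> low k (M + P).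
Proof.
by move=> /lowP hM /lowP hP; apply/lowP => a b ab; rewrite mxE hM// hP// addr0.
Qed.

Lemma lowZ k (c : R) M : low k M -> low k (c *: M).
Proof. by move=> /lowP hM; apply/lowP => a b ab; rewrite mxE hM// mulr0. Qed.

Lemma lowN k M : low k M -> low k (- M).
Proof. by rewrite -scaleN1r; apply: lowZ. Qed.

Lemma lowB k M P : low k M -> low k P -> low k (M - P).
Proof. by move=> hM hP; apply: lowD => //; apply: lowN. Qed.

Lemma low_sum k (I : Type) (r : seq I) (Q : pred I) (F : I -> A) :
  (forall x, Q x -> low k (F x)) -> low k (\sum_(i <- r | Q i) F i).
Proof.
by move=> hF; apply: (big_ind (low k)) => //; [exact: low0 | exact: lowD].
Qed.

Lemma low_le k l M : (l <= k)%N -> low k M -> low l M.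
Proof.
move=> lk /lowP hM; apply/lowP => a b ab; apply: hM.
by rewrite (leq_trans ab)// leq_add2l.
Qed.

Lemma low1 : low 0 1.
Proof.
by apply/lowP => a b; rewrite addn0 mxE; case: eqP => // ->; rewrite ltnn.
Qed.

Lemma lowM k l M P : low k M -> low l P -> low (k + l) (M * P).
Proof.
move=> /lowP hM /lowP hP; apply/lowP => a b ab; rewrite mxE big1// => c _.
have [ac|ca] := ltnP (dg a) (dg c + k); first by rewrite hM// mul0r.
by rewrite hP ?mulr0//; lia.
Qed.

Lemma lowMl k M P : low k M -> low 0 P -> low k (M * P).
Proof. by move=> hM hP; rewrite -[k]addn0; apply: lowM. Qed.

Lemma lowMr k M P : low 0 M -> low k P -> low k (M * P).
Proof. by move=> hM hP; rewrite -[k]add0n; apply: lowM. Qed.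

Lemma lowX k M : low 1 M -> low k (M ^+ k).
Proof.
move=> hM; elim: k => [|k IH]; first exact: low1.
by rewrite exprS -add1n; apply: lowM.
Qed.

Lemma homog_low k M : homog k M -> low k M.
Proof. by move=> /homogP h; apply/lowP => a b ab; apply: h; lia. Qed.

Lemma homog0 k : homog k 0. Proof. by apply/homogP => a b _; rewrite mxE. Qed.

Lemma homogD k M P : homog k M -> homog k P -> homog k (M + P).
Proof.
move=> /homogP hM /homogP hP; apply/homogP => a b ab.
by rewrite mxE hM// hP// addr0.
Qed.

Lemma homogZ k (c : R) M : homog k M -> homog k (c *: M).
Proof. by move=> /homogP hM; apply/homogP => a b ab; rewrite mxE hM// mulr0. Qed.

Lemma homogB k M P : homog k M -> homog k P -> homog k (M - P).
Proof. by move=> hM hP; apply: homogD => //; rewrite -scaleN1r; apply: homogZ. Qed.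

Lemma homogM k l M P : homog k M -> homog l P -> homog (k + l) (M * P).
Proof.
move=> /homogP hM /homogP hP; apply/homogP => a b ab; rewrite mxE big1// => c _.
have [ac|ca] := eqVneq (dg a) (dg c + k)%N; last by rewrite hM// mul0r.
by rewrite hP ?mulr0//; apply: contraNneq ab => h; rewrite ac h; apply/eqP; lia.
Qed.

Definition commut M P : A := M * P - P * M.

Lemma homog_commut k l M P : homog k M -> homog l P -> homog (k + l) (commut M P).
Proof.
by move=> hM hP; apply: homogB; [|rewrite addnC]; apply: homogM.
Qed.

Lemma low_commut k l M P : low k M -> low l P -> low (k + l) (commut M P).
Proof. by move=> hM hP; apply: lowB; [|rewrite addnC]; apply: lowM. Qed.

(** The homogeneous component of degree k. *)
Definition compo k M : A := \matrix_(a, b) (M a b *+ (dg a == dg b + k)%N).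

Lemma homog_compo k M : homog k (compo k M).
Proof. by apply/homogP => a b /negbTE ab; rewrite mxE ab mulr0n. Qed.

Lemma compoD k M P : compo k (M + P) = compo k M + compo k P.
Proof. by apply/matrixP => a b; rewrite !mxE mulrnDl. Qed.

Lemma compoB k M P : compo k (M - P) = compo k M - compo k P.
Proof. by apply/matrixP => a b; rewrite !mxE mulrnBl. Qed.

(** Only the entries of degree at most k are kept; eqtr is equality modulo degree > k. *)
Definition trunc k M : A := \matrix_(a, b) (M a b *+ (dg a <= dg b + k)%N).
Definition eqtr k M P := trunc k M = trunc k P.

Lemma eqtrP k M P :
  eqtr k M P <-> forall a b, (dg a <= dg b + k)%N -> M a b = P a b.
Proof.
split=> [/matrixP h a b ab|h]; first by move: (h a b); rewrite !mxE ab.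
by apply/matrixP => a b; rewrite !mxE; case: leqP => [/h ->|].
Qed.

Lemma truncD k M P : trunc k (M + P) = trunc k M + trunc k P.
Proof. by apply/matrixP => a b; rewrite !mxE mulrnDl. Qed.

Lemma truncB k M P : trunc k (M - P) = trunc k M - trunc k P.
Proof. by apply/matrixP => a b; rewrite !mxE mulrnBl. Qed.

Lemma eqtr_sub k M P : eqtr k M P <-> low k.+1 (M - P).
Proof.
rewrite eqtrP; split=> [h|/lowP h a b ab].
  by apply/lowP => a b ab; rewrite !mxE h ?subrr//; lia.
by apply/eqP; rewrite -subr_eq0; move: (h a b); rewrite !mxE => ->//; lia.
Qed.

Lemma eqtr_le k l M P : (l <= k)%N -> eqtr k M P -> eqtr l M P.
Proof. by move=> lk /eqtr_sub h; apply/eqtr_sub; apply: low_le h. Qed.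

(** Two matrices that agree below degree k are made to agree in degree k as well by adding
the component of their difference. *)
Lemma eqtr_compo k M P : low k (M - P) -> eqtr k M (P + compo k (M - P)).
Proof.
move=> /lowP h; apply/eqtrP => a b ab; rewrite !mxE.
case: eqP => e; first by rewrite mulr1n addrC subrK.
rewrite mulr0n addr0; apply/eqP; rewrite -subr_eq0.
by have := h a b; rewrite !mxE => ->//; lia.
Qed.

Lemma eqtrM k M M' P P' : low 0 M -> low 0 P' -> eqtr k M M' -> eqtr k P P' ->
  eqtr k (M * P) (M' * P').
Proof.
move=> lM lP' /eqtr_sub hM /eqtr_sub hP; apply/eqtr_sub.
have -> : M * P - M' * P' = M * (P - P') + (M - M') * P'.
  by rewrite mulrBr mulrBl addrA subrK.
by apply: lowD; [apply: lowMr | apply: lowMl].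
Qed.

End GradedMatrices.

(** * Exponentials of nilpotent graded matrices *)

Section Expm.
Context {R : realType} {n : nat} (dg : 'I_n -> nat) (K : nat).
Hypothesis dgK : forall i, (dg i <= K)%N.
Local Notation A := 'M[R]_n.
Implicit Types (M P Z : A) (i j k : nat).
Local Notation low := (low dg).

Lemma low_big k M : (K < k)%N -> low k M -> M = 0.
Proof.
move=> Kk /lowP h; apply/matrixP => a b; rewrite mxE; apply: h.
by have := dgK a; lia.
Qed.

Lemma eqtr_full M P : eqtr dg K M P -> M = P.
Proof. by move/eqtrP => h; apply/matrixP => a b; apply: h; have := dgK a; lia. Qed.

(** The exponential of a matrix that is nilpotent of index at most K + 1. *)
Definition expm M : A := \sum_(k < K.+1) (k`!%:R)^-1 *: M ^+ k.

Lemma expmE M : expm M = \sum_(k < K.+1) (k`!%:R)^-1 *: M ^+ k.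
Proof. by []. Qed.

(** Beyond the line k + j = K the summands vanish, so that summing over a triangle and over
a square is the same: this is what turns the binomial formula into a product of two
truncated exponentials. *)
Lemma triangle_sum (V : zmodType) (F : nat -> nat -> V) :
  (forall k j, (K < k + j)%N -> F k j = 0) ->
  \sum_(p < K.+1) \sum_(k < p.+1) F k (p - k)%N =
  \sum_(k < K.+1) \sum_(j < K.+1) F k j.
Proof.
move=> F0.
transitivity (\sum_(p < K.+1) \sum_(k < K.+1 | (k <= p)%N) F k (p - k)%N).
  apply: eq_bigr => p _; rewrite (big_ord_widen K.+1 (fun k => F k (p - k)%N))//.
rewrite (exchange_big_dep xpredT)//=; apply: eq_bigr => k _.
rewrite -(@big_geq_mkord _ _ _ k K.+1 xpredT (fun p => F k (p - k)%N)).
rewrite -{1}[val k]add0n big_addn -(big_mkord xpredT (fun j => F k j)).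
rewrite [RHS](@big_cat_nat _ _ _ (K.+1 - k))//= ?leq_subr//.
rewrite [X in _ = _ + X]big1_seq ?addr0; last first.
  move=> j /andP[_]; rewrite mem_index_iota => /andP[kj _].
  by apply: F0; have := ltn_ord k; lia.
by apply: eq_bigr => j _; rewrite addnK.
Qed.

Lemma expm0 : expm 0 = 1.
Proof.
rewrite /expm big_ord_recl/= expr0 fact0 invr1 scale1r big1 ?addr0// => i _.
by rewrite exprS mul0r scaler0.
Qed.

Lemma low_expm M : low 1 M -> low 0 (expm M).
Proof.
move=> lM; apply: low_sum => k _; apply: lowZ.
by apply: (low_le (leq0n k)); apply: lowX.
Qed.

Lemma low_expm1 M : low 1 M -> low 1 (expm M - 1).
Proof.
move=> lM; rewrite /expm big_ord_recl/= expr0 fact0 invr1 scale1r addrC addKr.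
apply: low_sum => k _; apply: lowZ.
by apply: low_le (lowX _ lM) => //; rewrite /bump.
Qed.

Lemma factV_neq0 k : (k`!%:R : R) != 0.
Proof. by rewrite pnatr_eq0 -lt0n fact_gt0. Qed.

Lemma binV k p : (k <= p)%N ->
  (p`!%:R)^-1 * 'C(p, k)%:R = (k`!%:R)^-1 * ((p - k)`!%:R)^-1 :> R.
Proof.
move=> kp; rewrite -(bin_fact kp) !natrM.
have := factV_neq0 k; have := factV_neq0 (p - k).
have : 'C(p, k)%:R != 0 :> R by rewrite pnatr_eq0 -lt0n bin_gt0.
by move=> h1 h2 h3; field; rewrite h1 h2 h3.
Qed.

Lemma expmD M P : low 1 M -> low 1 P -> GRing.comm M P ->
  expm (M + P) = expm M * expm P.
Proof.
move=> lM lP cMP; rewrite /expm.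
transitivity (\sum_(k < K.+1) \sum_(j < K.+1)
   ((k`!%:R)^-1 * (j`!%:R)^-1) *: (P ^+ k * M ^+ j)); last first.
  rewrite exchange_big/= big_distrlr/=; apply: eq_bigr => k _; apply: eq_bigr => j _.
  rewrite scaleMl scaleMr scalerA mulrC; congr (_ *: _).
  by apply: commrX; apply/commr_sym/commrX/commr_sym.
rewrite -(@triangle_sum _ (fun k j =>
  ((k`!%:R)^-1 * (j`!%:R)^-1) *: (P ^+ k * M ^+ j))); last first.
  move=> k j kj; rewrite (@low_big _ (P ^+ k * M ^+ j) kj) ?scaler0//.
  by apply: lowM; apply: lowX.
apply: eq_bigr => p _; rewrite addrC exprDn_comm; last exact/commr_sym.
rewrite scaler_sumr.
rewrite (reindex_inj rev_ord_inj)/=; apply: eq_bigr => k _.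
rewrite subSS subKn -1?ltnS// bin_sub -1?ltnS//.
rewrite -[(_ * _) *+ _]scaler_nat scalerA.
by rewrite binV// -ltnS.
Qed.

Lemma expmDZ (a b : R) M : low 1 M ->
  expm ((a + b) *: M) = expm (a *: M) * expm (b *: M).
Proof.
by move=> lM; rewrite scalerDl expmD//; [exact: lowZ|exact: lowZ|exact: scale_comm].
Qed.

Lemma expmVr M : low 1 M -> expm M * expm (- M) = 1.
Proof.
move=> lM; rewrite -expmD ?subrr ?expm0//; first exact: lowN.
exact/commrN.
Qed.

Lemma expmVl M : low 1 M -> expm (- M) * expm M = 1.
Proof. by move=> lM; rewrite -{2}[M]opprK expmVr//; apply: lowN. Qed.

Lemma expmX M k : low 1 M -> expm M ^+ k = expm (k%:R *: M).
Proof.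
move=> lM; elim: k => [|k IH]; first by rewrite scale0r expm0.
by rewrite exprSr IH -natr1 expmDZ// scale1r.
Qed.

Lemma expm_conj M P P' : P' * P = 1 -> expm (P * M * P') = P * expm M * P'.
Proof.
move=> PP; have PP' : P * P' = 1 := mulmx1C PP.
rewrite /expm mulr_sumr mulr_suml; apply: eq_bigr => k _.
rewrite scaleMr scaleMl; congr (_ *: _).
elim: (val k) => [|j IH]; first by rewrite !expr0 mulr1 PP'.
by rewrite exprS IH exprS -!mulrA (mulrA P' P) PP mul1r.
Qed.

(** The iterated adjoint action (ad Z)^k M. *)
Definition adm Z k M : A := iter k (commut Z) M.

Lemma low_adm Z k M : low 1 Z -> low 0 M -> low k (adm Z k M).
Proof.
move=> lZ lM; elim: k => // k IH.
by rewrite /adm iterS -add1n; apply: low_commut.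
Qed.

(** Leibniz rule for moving Z^p from the left of M to its right. *)
Lemma mulX_adm Z M p :
  Z ^+ p * M = \sum_(k < p.+1) 'C(p, k)%:R *: (adm Z k M * Z ^+ (p - k)).
Proof.
elim: p => [|p IH].
  by rewrite big_ord_recl big_ord0 bin0 scale1r addr0 /= expr0 mul1r mulr1.
rewrite exprS -mulrA IH mulr_sumr.
pose F k := adm Z k M * Z ^+ (p.+1 - k).
transitivity (\sum_(k < p.+1) ('C(p, k)%:R *: F k.+1 + 'C(p, k)%:R *: F k)).
  apply: eq_bigr => k _; rewrite scaleMr -scalerDr; congr (_ *: _).
  have -> : Z * (adm Z k M * Z ^+ (p - k)) =
     adm Z k.+1 M * Z ^+ (p - k) + adm Z k M * (Z * Z ^+ (p - k)).
    by rewrite /adm iterS /commut mulrBl !mulrA subrK.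
  by rewrite -exprS /F subSS subSn// -ltnS.
rewrite big_split/= [RHS]big_ord_recl/= bin0.
under [X in _ = _ + X]eq_bigr => k _.
  rewrite /bump/= add1n binS natrD scalerDl -/(F k.+1).
  over.
rewrite big_split/= addrC [X in X + _]big_ord_recl/= bin0 -/(F 0%N) -!addrA.
congr (_ + _); congr (_ + _).
rewrite [RHS]big_ord_recr/= bin_small// scale0r addr0.
by apply: eq_bigr => k _.
Qed.

Lemma expm_mul_adm Z M : low 1 Z -> low 0 M ->
  expm Z * M = (\sum_(k < K.+1) (k`!%:R)^-1 *: adm Z k M) * expm Z.
Proof.
move=> lZ lM; rewrite big_distrlr/=.
under [RHS]eq_bigr => k _ do under eq_bigr => j _ do rewrite scaleMl scaleMr scalerA.
rewrite -(@triangle_sum _ (fun k j => ((k`!%:R)^-1 * (j`!%:R)^-1) *: (adm Z k M * Z ^+ j))).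
  rewrite /expm mulr_suml; apply: eq_bigr => p _; rewrite scaleMl mulX_adm scaler_sumr.
  by apply: eq_bigr => k _; rewrite scalerA binV// -ltnS.
move=> k j kj; rewrite (@low_big _ (adm Z k M * Z ^+ j) kj) ?scaler0//.
by apply: lowM; [apply: low_adm | apply: lowX].
Qed.

(** The classical formula e^Z M e^(-Z) = e^(ad Z) M; the series stops at degree K. *)
Lemma expm_conj_adm Z M : low 1 Z -> low 0 M ->
  expm Z * M * expm (- Z) = \sum_(k < K.+1) (k`!%:R)^-1 *: adm Z k M.
Proof. by move=> lZ lM; rewrite expm_mul_adm// -mulrA expmVr// mulr1. Qed.

End Expm.

(** * Bounded Lipschitz functions *)

Section MatrixNorm.
Context {R : realType}.

Lemma mx_entry_le m n (M : 'M[R]_(m, n)) i j : `|M i j| <= `|M|.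
Proof.
rewrite [leRHS]/Num.Def.normr/= mx_normrE.
exact: (le_bigmax _ (fun ij => `|M ij.1 ij.2|) (i, j)).
Qed.

Lemma mx_norm_le m n (M : 'M[R]_(m, n)) (c : R) : 0 <= c ->
  (forall i j, `|M i j| <= c) -> `|M| <= c.
Proof.
move=> c0 h; rewrite [leLHS]/Num.Def.normr/= mx_normrE.
by rewrite (bigmax_le _ c0).
Qed.

Lemma mx_norm_mul m n p (M : 'M[R]_(m, n)) (P : 'M[R]_(n, p)) :
  `|M *m P| <= n%:R * (`|M| * `|P|).
Proof.
apply: mx_norm_le; first by rewrite !mulr_ge0.
move=> i j; rewrite mxE (le_trans (ler_norm_sum _ _ _))//.
rewrite mulr_natl -[X in _ *+ X]card_ord -sumr_const ler_sum// => k _.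
by rewrite normrM ler_pM// mx_entry_le.
Qed.

End MatrixNorm.

(** A domain of parameters for uniform Lipschitz estimates: lrel h h' says at which pairs of
parameters the functions are compared, ldst is the distance that bounds the difference.
The relation is separate from the domain because some estimates only hold between
parameters that share a scale. *)
Record lipdom (R : realType) := LipDom {
  lpt :> Type;
  ldom : lpt -> Prop;
  lrel : lpt -> lpt -> Prop;
  ldst : lpt -> lpt -> R;
  lrel_ldom : forall h h', lrel h h' -> ldom h /\ ldom h';
  ldst_ge0 : forall h h', 0 <= ldst h h'
}.

Section BoundedLipschitz.
Context {R : realType}.
Implicit Types (X Y : lipdom R) (W : normedModType R).

Definition BL X W (f : X -> W) := exists2 C : R, 0 <= C &
  (forall h, ldom h -> `|f h| <= C) /\
  (forall h h', lrel h h' -> `|f h - f h'| <= C * ldst h h').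

Lemma BL_ext X W (f g : X -> W) : (forall h, ldom h -> f h = g h) ->
  BL f -> BL g.
Proof.
move=> fg [C C0 [h1 h2]]; exists C => //; split=> [h hd|h h' hh].
  by rewrite -fg// h1.
by have [hd hd'] := lrel_ldom hh; rewrite -!fg// h2.
Qed.

Lemma BL_cst X W (c : W) : @BL X W (fun=> c).
Proof.
exists `|c| => //; split=> // h h' _.
by rewrite subrr normr0 mulr_ge0// ldst_ge0.
Qed.

Lemma BLD X W (f g : X -> W) : BL f -> BL g -> BL (fun h => f h + g h).
Proof.
move=> [C C0 [h1 h2]] [C' C'0 [h1' h2']]; exists (C + C'); first exact: addr_ge0.
split=> [h hd|h h' hh]; first by rewrite (le_trans (ler_normD _ _))// lerD ?h1 ?h1'.
by rewrite opprD addrACA (le_trans (ler_normD _ _))// mulrDl lerD ?h2 ?h2'.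
Qed.

Lemma BLN X W (f : X -> W) : BL f -> BL (fun h => - f h).
Proof.
move=> [C C0 [h1 h2]]; exists C => //; split=> [h hd|h h' hh].
  by rewrite normrN h1.
by rewrite -opprD normrN h2.
Qed.

Lemma BLB X W (f g : X -> W) : BL f -> BL g -> BL (fun h => f h - g h).
Proof. by move=> hf hg; apply: BLD => //; apply: BLN. Qed.

Lemma BL_sum X W (I : Type) (r : seq I) (Q : pred I) (f : I -> X -> W) :
  (forall i, BL (f i)) -> BL (fun h => \sum_(i <- r | Q i) f i h).
Proof.
move=> hf; elim: r => [|i r IH].
  by apply: BL_ext (BL_cst X 0) => h _; rewrite big_nil.
case Qi: (Q i).
  by apply: BL_ext (BLD (hf i) IH) => h _; rewrite big_cons Qi.
by apply: BL_ext IH => h _; rewrite big_cons Qi.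
Qed.

(** Products of all kinds (of scalars, of matrices, scalar multiples) preserve bounded
Lipschitz functions for this one reason. *)
Lemma BL_bilin X W1 W2 W (op : W1 -> W2 -> W) (c : R) (f : X -> W1) (g : X -> W2) :
  0 <= c ->
  (forall x y, `|op x y| <= c * (`|x| * `|y|)) ->
  (forall x x' y, op (x - x') y = op x y - op x' y) ->
  (forall x y y', op x (y - y') = op x y - op x y') ->
  BL f -> BL g -> BL (fun h => op (f h) (g h)).
Proof.
move=> c0 hop opl opr [C C0 [h1 h2]] [C' C'0 [h1' h2']].
have CC : 0 <= c * (C * C') by rewrite !mulr_ge0.
exists (c * (C * C') + c * (C * C')); first exact: addr_ge0.
split=> [h hd|h h' hh].
  rewrite (le_trans (hop _ _))// -[leLHS]addr0 lerD//.
  by rewrite ler_wpM2l// ler_pM ?h1 ?h1'.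
have [hd hd'] := lrel_ldom hh.
have -> : op (f h) (g h) - op (f h') (g h') =
   op (f h - f h') (g h) + op (f h') (g h - g h').
  by rewrite opl opr addrA subrK.
rewrite (le_trans (ler_normD _ _))// mulrDl lerD//.
  rewrite (le_trans (hop _ _))// -mulrA ler_wpM2l//.
  by rewrite [C * C' * _]mulrAC ler_pM ?h2 ?h1'.
rewrite (le_trans (hop _ _))// -mulrA ler_wpM2l// -mulrA.
by rewrite ler_pM ?h2' ?h1.
Qed.

Lemma BLZ X W (f : X -> R) (g : X -> W) : BL f -> BL g -> BL (fun h => f h *: g h).
Proof.
apply: (@BL_bilin _ _ _ _ (fun (x : R) (y : W) => x *: y) 1) => //.
- by move=> x y; rewrite normrZ mul1r.
- by move=> x x' y; rewrite scalerBl.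
- by move=> x y y'; rewrite scalerBr.
Qed.

Lemma BLMr X (f g : X -> R) : BL f -> BL g -> BL (fun h => f h * g h).
Proof. exact: (@BLZ X R). Qed.

Lemma BLXr X (f : X -> R) k : BL f -> BL (fun h => f h ^+ k).
Proof.
move=> hf; elim: k => [|k IH]; first exact: BL_cst.
by apply: BL_ext (BLMr hf IH) => h _; rewrite exprS.
Qed.

Lemma BLM X m n p (f : X -> 'M[R]_(m, n)) (g : X -> 'M[R]_(n, p)) :
  BL f -> BL g -> BL (fun h => f h *m g h).
Proof.
apply: (@BL_bilin _ _ _ _ (fun (x : 'M[R]_(m, n)) (y : 'M[R]_(n, p)) => x *m y) n%:R) => //.
- exact: mx_norm_mul.
- by move=> x x' y; rewrite mulmxBl.
- by move=> x y y'; rewrite mulmxBr.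
Qed.

Lemma BLX X n (f : X -> 'M[R]_n) k : BL f -> BL (fun h => f h ^+ k).
Proof.
move=> hf; elim: k => [|k IH]; first exact: BL_cst.
by apply: BL_ext (BLM hf IH) => h _; rewrite exprS.
Qed.

Lemma BL_expm X n K (f : X -> 'M[R]_n) : BL f -> BL (fun h => expm K (f h)).
Proof.
move=> hf; apply: BL_sum => k; apply: BLZ; [exact: BL_cst | exact: BLX].
Qed.

Lemma BL_entry X m n (f : X -> 'M[R]_(m, n)) i j : BL f -> BL (fun h => f h i j).
Proof.
move=> [C C0 [h1 h2]]; exists C => //; split=> [h hd|h h' hh].
  by rewrite (le_trans (mx_entry_le _ _ _))// h1.
apply: le_trans (h2 _ _ hh).
have -> : f h i j - f h' i j = (f h - f h') i j by rewrite !mxE.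
exact: mx_entry_le.
Qed.

Lemma BL_comp X Y W (g : X -> Y) (f : Y -> W) (c : R) : 0 <= c ->
  (forall h, ldom h -> ldom (g h)) ->
  (forall h h', lrel h h' -> lrel (g h) (g h') /\ ldst (g h) (g h') <= c * ldst h h') ->
  BL f -> BL (fun h => f (g h)).
Proof.
move=> c0 gd gr [C C0 [h1 h2]]; exists (C + C * c); first by rewrite addr_ge0// mulr_ge0.
split=> [h hd|h h' hh].
  by rewrite (le_trans (h1 _ _))//; [exact: gd | rewrite lerDl mulr_ge0].
have [r d] := gr _ _ hh; rewrite (le_trans (h2 _ _ r))//.
rewrite mulrDl -mulrA -[leLHS]add0r lerD ?mulr_ge0 ?ldst_ge0//.
by rewrite ler_wpM2l.
Qed.

Lemma BL_unif X W (I : finType) (f : I -> X -> W) : (forall i, BL (f i)) ->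
  exists2 C : R, 0 <= C & forall i,
  (forall h, ldom h -> `|f i h| <= C) /\
  (forall h h', lrel h h' -> `|f i h - f i h'| <= C * ldst h h').
Proof.
move=> hf; pose c i := sval (cid2 (hf i)).
have c0 i : 0 <= c i by rewrite /c; case: cid2.
have cle i : c i <= \sum_j c j.
  by rewrite (bigD1 i)//= lerDl sumr_ge0.
exists (\sum_i c i) => [|i]; first exact: sumr_ge0.
have [h1 h2] : (forall h, ldom h -> `|f i h| <= c i) /\
  (forall h h', lrel h h' -> `|f i h - f i h'| <= c i * ldst h h').
  by rewrite /c; case: cid2.
split=> [h /h1/le_trans|h h' /h2/le_trans]; apply; first exact: cle.
by rewrite ler_wpM2r ?ldst_ge0.
Qed.

Lemma BL_mx X m n (f : X -> 'M[R]_(m, n)) : (forall i j, BL (fun h => f h i j)) -> BL f.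
Proof.
move=> hf; have [C C0 hC] := @BL_unif X R ('I_m * 'I_n)%type (fun ij h => f h ij.1 ij.2)
  (fun ij => hf ij.1 ij.2).
exists C => //; split=> [h hd|h h' hh]; apply: mx_norm_le => //.
- by move=> i j; have [+ _] := hC (i, j); apply.
- by rewrite mulr_ge0// ldst_ge0.
- by move=> i j; rewrite !mxE; have [_] := hC (i, j); apply.
Qed.

End BoundedLipschitz.

(** * Limits of powers of exponentials *)

(** These three lemmas let mxring prove identities between noncommutative polynomials in
matrices: products are expanded and normalised by associativity, and what remains is a
linear identity between entries. *)
Lemma addmxE (R : realType) m n (M P : 'M[R]_(m, n)) i j : (M + P) i j = M i j + P i j.
Proof. by rewrite mxE. Qed.
Lemma oppmxE (R : realType) m n (M : 'M[R]_(m, n)) i j : (- M) i j = - M i j.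
Proof. by rewrite mxE. Qed.
Lemma scalemxE (R : realType) m n (c : R) (M : 'M[R]_(m, n)) i j : (c *: M) i j = c * M i j.
Proof. by rewrite mxE. Qed.
Ltac mxring :=
  rewrite ?(mulrDl, mulrDr, mulrBl, mulrBr, mulNr, mulrN, mul1r, mulr1,
            scaleMl, scaleMr, scalerDr, scalerN, mulrA);
  apply/matrixP => ? ?; rewrite !(addmxE, oppmxE, scalemxE); ring.

Section ExpmBounds.
Context {R : realType}.

Definition itvdom (B : R) : lipdom R := @LipDom R R (fun s => `|s| <= B)
  (fun s s' => `|s| <= B /\ `|s'| <= B) (fun s s' => `|s - s'|)
  (fun h h' H => H) (fun h h' => normr_ge0 _).

Definition mxdom n (B : R) : lipdom R := @LipDom R 'M[R]_n (fun s => `|s| <= B)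
  (fun s s' => `|s| <= B /\ `|s'| <= B) (fun s s' => `|s - s'|)
  (fun h h' H => H) (fun h h' => normr_ge0 _).

Lemma BL_itv_id B : @BL R (itvdom B) R (fun s => s).
Proof.
exists (1 + `|B|) => //; split=> [h /= hB|h h' _].
  by rewrite (le_trans hB)// (le_trans (ler_norm B))// lerDr.
by rewrite -[leLHS]mul1r ler_wpM2r// lerDl.
Qed.

Lemma BL_mx_id n B : @BL R (mxdom n B) 'M[R]_n (fun s => s).
Proof.
exists (1 + `|B|) => //; split=> [h /= hB|h h' _].
  by rewrite (le_trans hB)// (le_trans (ler_norm B))// lerDr.
by rewrite -[leLHS]mul1r ler_wpM2r// lerDl.
Qed.

Lemma expm_lip n K B : exists2 C : R, 0 <= C & forall M P : 'M[R]_n, `|M| <= B -> `|P| <= B ->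
  `|expm K M - expm K P| <= C * `|M - P|.
Proof.
have [C C0 [_ h]] := BL_expm K (BL_mx_id n B).
by exists C => // M P hM hP; apply: h.
Qed.

(** Taylor bounds of order 0, 1 and 2 along the line spanned by Z. *)
Lemma expm_bounds n K (Z : 'M[R]_n) B : (0 < K)%N ->
  exists2 C : R, 0 <= C & forall s, `|s| <= B ->
  [/\ `|expm K (s *: Z)| <= C, `|expm K (s *: Z) - 1| <= C * `|s| &
      `|expm K (s *: Z) - 1 - s *: Z| <= C * s ^+ 2].
Proof.
case: K => // K' _.
pose q (s : R) := \sum_(k < K'.+1) ((k.+1)`!%:R)^-1 *: (s ^+ k *: Z ^+ k.+1).
pose r (s : R) := \sum_(k < K') ((k.+2)`!%:R)^-1 *: (s ^+ k *: Z ^+ k.+2).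
have e1 s : expm K'.+1 (s *: Z) - 1 = s *: q s.
  rewrite /expm big_ord_recl/= expr0 fact0 invr1 scale1r addrC addKr.
  rewrite scaler_sumr; apply: eq_bigr => k _.
  by rewrite scaleMX /bump/= add1n !scalerA; congr (_ *: _); rewrite exprS; ring.
have e2 s : expm K'.+1 (s *: Z) - 1 - s *: Z = s ^+ 2 *: r s.
  rewrite e1 /q big_ord_recl/= expr0 scale1r expr1 invr1 scale1r scalerDr addrC addKr.
  rewrite !scaler_sumr; apply: eq_bigr => k _.
  by rewrite /bump/= add1n !scalerA; congr (_ *: _); rewrite exprS; ring.
have BLq : @BL R (itvdom B) 'M[R]_n q.
  apply: BL_sum => k; apply: BLZ; first exact: BL_cst.
  by apply: BLZ (BLXr _ (BL_itv_id B)) (BL_cst _ _).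
have BLr : @BL R (itvdom B) 'M[R]_n r.
  apply: BL_sum => k; apply: BLZ; first exact: BL_cst.
  by apply: BLZ (BLXr _ (BL_itv_id B)) (BL_cst _ _).
have BLe : @BL R (itvdom B) 'M[R]_n (fun s => expm K'.+1 (s *: Z)).
  by apply/BL_expm/BLZ; [exact: BL_itv_id | exact: BL_cst].
have [C1 C10 [h1 _]] := BLq; have [C2 C20 [h2 _]] := BLr.
have [C3 C30 [h3 _]] := BLe.
exists (C1 + C2 + C3); first by rewrite !addr_ge0.
move=> s sB; split.
- by rewrite (le_trans (h3 _ sB))// lerDr addr_ge0.
- rewrite e1 normrZ mulrC ler_wpM2r// (le_trans (h1 _ sB))//.
  by rewrite -addrA lerDl addr_ge0.
- rewrite e2 normrZ normrX real_normK ?num_real// mulrC ler_wpM2r ?sqr_ge0//.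
  by rewrite (le_trans (h2 _ sB))// addrAC lerDr addr_ge0.
Qed.

End ExpmBounds.

#[global] Opaque expm.

Section Closure.
Context {R : realType} {n : nat} (dg : 'I_n -> nat) (K : nat).
Hypothesis dgK : forall i, (dg i <= K)%N.
Hypothesis K_gt0 : (0 < K)%N.
Local Notation A := 'M[R]_n.
Implicit Types (M P Z : A) (i j k : nat).
Local Notation low := (low dg).
Local Notation expm := (expm K).

Lemma mx_norm_mulC M P (a b : R) : `|M| <= a -> `|P| <= b ->
  `|M * P| <= n%:R * (a * b).
Proof.
move=> ha hb; rewrite (le_trans (mx_norm_mul _ _))// ler_wpM2l//.
by rewrite ler_pM.
Qed.

(** If f(s) = 1 + sZ + O(s^2) then f(t/m)^m tends to e^(tZ).  Both f(s) and e^(sZ) are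
within O(s^2) of each other, and the error of the m-th powers accumulates to at most
m O(s^2) e^(at), with s = t/m. *)
Lemma pow_cvg (f : R -> A) Z (C t0 t : R) : low 1 Z -> 0 <= C -> 0 < t0 ->
  (forall s, 0 < s <= t0 -> `|f s - (1 + s *: Z)| <= C * s ^+ 2) ->
  0 < t -> forall e, 0 < e -> exists m : nat,
    [/\ (0 < m)%N, 0 < t / m%:R <= t0 & `|f (t / m%:R) ^+ m - expm (t *: Z)| <= e].
Proof.
move=> lZ C0 t00 hf tp e e0.
have [C1 C10 hC1] := expm_bounds Z (t + 1) K_gt0.
pose a : R := n%:R * (`|Z| + C); pose c : R := n%:R * ((C + C1) * C1).
have a0 : 0 <= a by rewrite mulr_ge0// addr_ge0.
have c0 : 0 <= c by rewrite !mulr_ge0// addr_ge0.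
pose big : R := t / t0 + t + t ^+ 2 * c * expR (a * t) / e.
have b1 : 0 <= t / t0 by rewrite divr_ge0// ltW.
have b3 : 0 <= t ^+ 2 * c * expR (a * t) / e.
  by rewrite divr_ge0 ?(ltW e0)// mulr_ge0 ?expR_ge0// mulr_ge0 ?exprn_ge0// ltW.
have [m m_gt0 mbig] : exists2 m : nat, (0 < m)%N & big < m%:R.
  by exists (Num.truncn big).+1; rewrite ?truncnS_gt.
have m0 : 0 < m%:R :> R by rewrite ltr0n.
exists m; split=> //.
  rewrite divr_gt0//= ler_pdivrMr// mulrC -ler_pdivrMr// (le_trans _ (ltW mbig))//.
  by rewrite /big; lra.
pose s := t / m%:R; rewrite -/s.
have s0 : 0 < s by rewrite divr_gt0.
have st0 : s <= t0.
  rewrite ler_pdivrMr// mulrC -ler_pdivrMr// (le_trans _ (ltW mbig))//.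
  by rewrite /big; lra.
have s1 : s <= 1.
  rewrite ler_pdivrMr// mul1r (le_trans _ (ltW mbig))//.
  by rewrite /big; lra.
have sm : m%:R * s = t by rewrite /s mulrC divfK// gt_eqF.
clearbody s.
have hs := hf s; rewrite s0 st0 in hs; have {}hs := hs isT.
have fs1 : `|f s - 1| <= (`|Z| + C) * s.
  have -> : f s - 1 = (f s - (1 + s *: Z)) + s *: Z by rewrite opprD addrA subrK.
  rewrite (le_trans (ler_normD _ _))// addrC mulrDl lerD//.
    by rewrite normrZ gtr0_norm// mulrC.
  by rewrite (le_trans hs)// ler_wpM2l// expr2 ger_pMl.
have sB : `|s| <= t + 1 by rewrite gtr0_norm// (le_trans s1)// lerDr ltW.
have [_ _ hes] := hC1 s sB.
have d1 : `|f s - expm (s *: Z)| <= (C + C1) * s ^+ 2.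
  have -> : f s - expm (s *: Z) = (f s - (1 + s *: Z)) - (expm (s *: Z) - 1 - s *: Z).
    by mxring.
  by rewrite (le_trans (ler_normB _ _))// mulrDl lerD.
have main k : (k <= m)%N -> `|f s ^+ k - expm (s *: Z) ^+ k| <=
    k%:R * (c * s ^+ 2) * (1 + a * s) ^+ k.
  elim: k => [|k IH] km; first by rewrite !expr0 subrr normr0 !mul0r.
  have {IH} hk := IH (ltnW km).
  have -> : f s ^+ k.+1 - expm (s *: Z) ^+ k.+1 =
     (f s ^+ k - expm (s *: Z) ^+ k) + (f s - 1) * (f s ^+ k - expm (s *: Z) ^+ k)
     + (f s - expm (s *: Z)) * expm (s *: Z) ^+ k.
    by rewrite !exprS; move: (f s) (expm _) (f s ^+ k) (expm _ ^+ k) => x y u v; mxring.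
  have hB : `|expm (s *: Z) ^+ k| <= C1.
    rewrite (expmX dgK)//; last exact: lowZ.
    have kst : `|k%:R * s| <= t + 1.
      have kt : k%:R * s <= t by rewrite -sm ler_wpM2r ?(ltW s0)// ler_nat ltnW.
      have k0 : 0 <= k%:R * s by rewrite mulr_ge0// ltW.
      by rewrite ger0_norm//; lra.
    by rewrite scalerA; have [] := hC1 _ kst.
  have h1 := mx_norm_mulC fs1 hk.
  have h2 := mx_norm_mulC d1 hB.
  rewrite (le_trans (ler_normD _ _))//.
  rewrite (le_trans (lerD (ler_normD _ _) (lexx _)))//.
  rewrite (le_trans (lerD (lerD hk h1) h2))//.
  set u := (1 + a * s) ^+ k.
  have u1 : 1 <= u by rewrite exprn_ege1// lerDl mulr_ge0// ltW.
  have -> : k%:R * (c * s ^+ 2) * u +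
    n%:R * ((`|Z| + C) * s * (k%:R * (c * s ^+ 2) * u)) =
    k%:R * (c * s ^+ 2) * (u * (1 + a * s)) by rewrite /a; ring.
  have -> : n%:R * ((C + C1) * s ^+ 2 * C1) = c * s ^+ 2 by rewrite /c; ring.
  rewrite [(1 + a * s) ^+ k.+1]exprSr -/u -[k.+1%:R]natr1 !mulrDl lerD2l mul1r.
  rewrite ler_peMr ?(mulr_ge0 c0 (sqr_ge0 s))//.
  by rewrite mulr_ege1// lerDl mulr_ge0// ltW.
have := main m (leqnn m).
rewrite (expmX dgK); last exact: lowZ.
rewrite scalerA sm => /le_trans; apply.
have -> : m%:R * (c * s ^+ 2) * (1 + a * s) ^+ m =
  t ^+ 2 * c * (1 + a * s) ^+ m / m%:R.
  by rewrite -sm; field; rewrite gt_eqF.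
rewrite ler_pdivrMr// (le_trans _ (ler_wpM2l (ltW e0) (ltW mbig)))//.
rewrite (@le_trans _ _ (t ^+ 2 * c * expR (a * t)))//.
  rewrite ler_wpM2l ?(mulr_ge0 (sqr_ge0 t) c0)//.
  have -> : a * t = a * s * m%:R by rewrite -sm; ring.
  rewrite expRM_natr ler_pXn2r ?nnegrE ?expR_ge0 ?expR_ge1Dx//.
  by rewrite addr_ge0// mulr_ge0// ltW.
rewrite /big !mulrDr mulrC [e * (_ / e)]mulrC divfK ?gt_eqF//.
by rewrite lerDr addr_ge0// mulr_ge0// ltW.
Qed.

End Closure.

(** * Directions that are reached in the limit *)

Section Saturate.
Context {R : realType} {n : nat} (dg : 'I_n -> nat) (K : nat).
Hypothesis dgK : forall i, (dg i <= K)%N.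
Hypothesis K_gt0 : (0 < K)%N.
Local Notation A := 'M[R]_n.
Implicit Types (M P Z Y : A) (i j k : nat).
Local Notation low := (low dg).
Local Notation expm := (expm K).

(** Trotter's product formula: pow_cvg for f(s) = e^(sZ) e^(sY). *)
Lemma trotter Z Y t e : low 1 Z -> low 1 Y -> 0 < t -> 0 < e ->
  exists2 m : nat, (0 < m)%N &
  `|(expm ((t / m%:R) *: Z) * expm ((t / m%:R) *: Y)) ^+ m - expm (t *: (Z + Y))| <= e.
Proof.
move=> lZ lY t0 e0; have lZY := lowD lZ lY.
have [C C0 hC] := expm_bounds Z 1 K_gt0.
have [C' C'0 hC'] := expm_bounds Y 1 K_gt0.
pose D : R := n%:R * (C * C') + n%:R * (`|Z| * C') + C'.
have D0 : 0 <= D by rewrite !addr_ge0// !mulr_ge0.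
have [||m [m0 /andP[s0 s1] hm]] :=
  @pow_cvg R n dg K dgK K_gt0 (fun s => expm (s *: Z) * expm (s *: Y)) _ D 1 t lZY D0 _ _ t0 e e0.
- by [].
- move=> s /andP[s0 s1]; have ns : `|s| <= 1 by rewrite gtr0_norm.
  have [_ _ h1] := hC s ns; have [h2 h3 h4] := hC' s ns.
  have -> : expm (s *: Z) * expm (s *: Y) - (1 + s *: (Z + Y)) =
    (expm (s *: Z) - 1 - s *: Z) * expm (s *: Y) +
    s *: (Z * (expm (s *: Y) - 1)) + (expm (s *: Y) - 1 - s *: Y).
    by move: (expm (s *: Z)) (expm _) => x y; mxring.
  have h5 := mx_norm_mulC h1 h2.
  have h6 := mx_norm_mulC (lexx `|Z|) h3.
  have -> : D * s ^+ 2 = n%:R * (C * s ^+ 2 * C') +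
      s * (n%:R * (`|Z| * (C' * s))) + C' * s ^+ 2 by rewrite /D; ring.
  rewrite (le_trans (ler_normD _ _))// lerD//.
  rewrite (le_trans (ler_normD _ _))// lerD//.
  by rewrite normrZ gtr0_norm// ler_wpM2l ?(ltW s0)// -{2}(gtr0_norm s0).
- by exists m.
Qed.

Definition adherent (S : A -> Prop) M := forall e : R, 0 < e -> exists2 s, S s & `|s - M| <= e.

Lemma adherent_incl (S : A -> Prop) M : S M -> adherent S M.
Proof. by move=> SM e e0; exists M => //; rewrite subrr normr0 ltW. Qed.

Lemma adherent_adherent (S : A -> Prop) M : adherent (adherent S) M -> adherent S M.
Proof.
move=> h e e0; have e20 : 0 < e / 2 by rewrite divr_gt0.
have [s hs sM] := h _ e20; have [s' S's s's] := hs _ e20.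
exists s' => //; have -> : s' - M = (s' - s) + (s - M) by rewrite addrA subrK.
by rewrite (le_trans (ler_normD _ _))// [leRHS]splitr lerD.
Qed.

Variable S : A -> Prop.
Hypothesis S1 : S 1.
Hypothesis SM : forall a b, S a -> S b -> S (a * b).

Lemma adherentM a b : adherent S a -> adherent S b -> adherent S (a * b).
Proof.
move=> ha hb e e0.
pose c : R := n%:R * (`|a| + `|b| + 1) + 1.
have c1 : 1 <= c by rewrite lerDr mulr_ge0// !addr_ge0.
have c0 : 0 < c by rewrite (lt_le_trans ltr01).
pose d : R := Num.min 1 (e / c).
have d0 : 0 < d by rewrite lt_min ltr01 divr_gt0.
have d1 : d <= 1 by rewrite ge_min lexx.
have de : d * c <= e by rewrite -ler_pdivlMr// ge_min lexx orbT.
have [x Sx xa] := ha _ d0; have [y Sy yb] := hb _ d0.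
exists (x * y); first exact: SM.
have -> : x * y - a * b = (x - a) * y + a * (y - b).
  by rewrite mulrBl mulrBr addrA subrK.
have yb1 : `|y| <= `|b| + 1.
  by rewrite -[y](subrK b) (le_trans (ler_normD _ _))// addrC lerD2l (le_trans yb).
have h1 := mx_norm_mulC xa yb1.
have h2 := mx_norm_mulC (lexx `|a|) yb.
rewrite (le_trans (ler_normD _ _))// (le_trans (lerD h1 h2))// (le_trans _ de)//.
have -> : n%:R * (d * (`|b| + 1)) + n%:R * (`|a| * d) = d * (n%:R * (`|a| + `|b| + 1)).
  by ring.
by rewrite ler_wpM2l// ?lerDl// ltW.
Qed.

Lemma adherentX a k : adherent S a -> adherent S (a ^+ k).
Proof.
move=> ha; elim: k => [|k IH]; first by rewrite expr0; apply: adherent_incl.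
by rewrite exprS; apply: adherentM.
Qed.

(** The tangent cone of the closure of S at 1: the directions Z along which the closure
contains the whole half-line e^(tZ), t >= 0. *)
Record one_sided Z : Prop := OneSided {
  one_sided_low : low 1 Z;
  one_sided_adherent : forall t, 0 <= t -> adherent S (expm (t *: Z)) }.

Lemma one_sidedI Z : low 1 Z -> (forall t, 0 < t -> adherent S (expm (t *: Z))) -> one_sided Z.
Proof.
move=> lZ h; split=> // t; rewrite le_eqVlt => /predU1P[<-|]; last exact: h.
by rewrite scale0r expm0; apply: adherent_incl.
Qed.

Lemma one_sided0 : one_sided 0.
Proof. by apply: one_sidedI => [|t _]; [exact: low0 | rewrite scaler0 expm0;
  apply: adherent_incl]. Qed.

Lemma one_sidedZ (c : R) Z : 0 <= c -> one_sided Z -> one_sided (c *: Z).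
Proof.
move=> c0 [lZ h]; split=> [|t t0]; first exact: lowZ.
by rewrite scalerA; apply: h; rewrite mulr_ge0.
Qed.

(** By Trotter's formula the directions form a convex cone. *)
Lemma one_sidedD Z Y : one_sided Z -> one_sided Y -> one_sided (Z + Y).
Proof.
move=> [lZ hZ] [lY hY]; have lZY := lowD lZ lY.
apply: one_sidedI => // t t0; apply: adherent_adherent => e e0.
have [m m0 hm] := trotter lZ lY t0 e0.
exists ((expm ((t / m%:R) *: Z) * expm ((t / m%:R) *: Y)) ^+ m) => //.
by apply/adherentX/adherentM; [apply: hZ | apply: hY]; rewrite divr_ge0// ltW.
Qed.

Lemma one_sided_closed Z : low 1 Z -> adherent one_sided Z -> one_sided Z.
Proof.
move=> lZ hZ; apply: one_sidedI => // t t0; apply: adherent_adherent => e e0.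
have [C C0 hC] := @expm_lip R n K (t * (`|Z| + 1)).
pose d : R := Num.min 1 (e / (C * t + 1)).
have ct : 0 < C * t + 1 by rewrite ltr_wpDl// mulr_ge0// ltW.
have d0 : 0 < d by rewrite lt_min ltr01 divr_gt0.
have d1 : d <= 1 by rewrite ge_min lexx.
have de : d * (C * t + 1) <= e by rewrite -ler_pdivlMr// ge_min lexx orbT.
have [Y [lY hY] YZ] := hZ d d0.
exists (expm (t *: Y)); first exact/hY/ltW.
have Yn : `|Y| <= `|Z| + 1.
  by rewrite -[Y](subrK Z) (le_trans (ler_normD _ _))// addrC lerD2l (le_trans YZ).
apply: le_trans (hC _ _ _ _) _.
- by rewrite normrZ gtr0_norm// ler_pM2l.
- by rewrite normrZ gtr0_norm// ler_pM2l// lerDl.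
rewrite -scalerBr normrZ gtr0_norm// (le_trans _ de)// mulrA.
rewrite (@le_trans _ _ (C * t * d)) ?ler_wpM2l ?mulr_ge0 ?(ltW t0)//.
by rewrite mulrC ler_wpM2l ?(ltW d0)// lerDl.
Qed.

(** Conjugating by an element that is invertible in the closure maps half-lines of the
closure to half-lines of the closure. *)
Lemma one_sided_conj Z Y : low 1 Z -> adherent S (expm Z) -> adherent S (expm (- Z)) ->
  one_sided Y ->
  one_sided (expm Z * Y * expm (- Z)).
Proof.
move=> lZ h1 h2 [lY hY]; have lE := low_expm K lZ; have lE' := low_expm K (lowN lZ).
split=> [|t t0]; first by apply: lowMl => //; apply: lowMr.
rewrite -scaleMl -scaleMr expm_conj ?(expmVl dgK)//.
by apply: adherentM => //; apply: adherentM => //; apply: hY.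
Qed.

(** The edge of the cone of one-sided directions, that is, its largest linear subspace. *)
Record two_sided Z : Prop := TwoSided { two_sidedL : one_sided Z; two_sidedR : one_sided (- Z) }.

Lemma two_sided_low Z : two_sided Z -> low 1 Z. Proof. by case=> /one_sided_low. Qed.

Lemma two_sidedN Z : two_sided Z -> two_sided (- Z).
Proof. by case=> h1 h2; split=> //; rewrite opprK. Qed.

Lemma two_sided0 : two_sided 0. Proof. by split; rewrite ?oppr0; exact: one_sided0. Qed.

Lemma two_sidedD Z Y : two_sided Z -> two_sided Y -> two_sided (Z + Y).
Proof. by case=> h1 h2 [h3 h4]; split; rewrite ?opprD; apply: one_sidedD. Qed.

Lemma two_sidedZ (c : R) Z : two_sided Z -> two_sided (c *: Z).
Proof.
move=> hZ; wlog c0 : c / 0 <= c => [hw|].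
  have [/hw//|/ltW c0] := leP 0 c; rewrite -[c]opprK scaleNr.
  by apply/two_sidedN/hw; rewrite oppr_ge0.
by case: hZ => h1 h2; split; rewrite -?scalerN; apply: one_sidedZ.
Qed.

Lemma two_sided_sum (I : Type) (r : seq I) (Q : pred I) (F : I -> A) :
  (forall x, Q x -> two_sided (F x)) -> two_sided (\sum_(i <- r | Q i) F i).
Proof.
by move=> hF; apply: (big_ind two_sided) => //; [exact: two_sided0 | exact: two_sidedD].
Qed.

Lemma two_sided_expm Z : two_sided Z -> adherent S (expm Z).
Proof. by case=> -[_ h] _; rewrite -[Z]scale1r; apply: h. Qed.

Lemma two_sided_conjLS Z Y : two_sided Z -> one_sided Y -> one_sided (expm Z * Y * expm (- Z)).
Proof.
move=> hZ hY; apply: one_sided_conj => //; first exact: two_sided_low.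
  exact: two_sided_expm.
exact/two_sided_expm/two_sidedN.
Qed.

Lemma two_sided_conj Z Y : two_sided Z -> two_sided Y -> two_sided (expm Z * Y * expm (- Z)).
Proof.
move=> hZ [h1 h2]; split; first exact: two_sided_conjLS.
by rewrite -mulNr -mulrN; apply: two_sided_conjLS.
Qed.

Lemma two_sided_closed Z : low 1 Z -> adherent two_sided Z -> two_sided Z.
Proof.
move=> lZ hZ; split; apply: one_sided_closed => //; last 2 first.
- exact: lowN.
- move=> e e0; have [Y [_ h2] YZ] := hZ _ e0; exists (- Y) => //.
  by rewrite -opprD normrN.
- by move=> e e0; have [Y [h1 _] YZ] := hZ _ e0; exists Y.
Qed.

(** The bracket [Z, Y] is the limit of (e^(sZ) Y e^(-sZ) - Y) / s, a combination of two-sided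
directions. *)
Lemma two_sided_commut Z Y : two_sided Z -> two_sided Y -> two_sided (commut Z Y).
Proof.
move=> hZ hY; have lZ := two_sided_low hZ; have lY := two_sided_low hY.
apply: two_sided_closed.
  by apply: low_le (low_commut lZ lY).
move=> e e0.
have [C C0 hC] := expm_bounds Z 1 K_gt0.
pose D : R := n%:R * (n%:R * (C * `|Y|) * C) + n%:R * (n%:R * (`|Z| * `|Y|) * C) + n%:R *
  (`|Y| * C).
have D0 : 0 <= D by rewrite !addr_ge0// !mulr_ge0.
(* the difference quotient is within D s of the commutator *)
pose s : R := Num.min 1 (e / (D + 1)).
have D1 : 0 < D + 1 by rewrite ltr_wpDl.
have s0 : 0 < s by rewrite lt_min ltr01 divr_gt0.
have s1 : s <= 1 by rewrite ge_min lexx.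
have se : s * (D + 1) <= e by rewrite -ler_pdivlMr// ge_min lexx orbT.
exists (s^-1 *: (expm (s *: Z) * Y * expm (- (s *: Z)) - Y)).
  by apply/two_sidedZ/two_sidedD; [apply: two_sided_conj => //;
    apply: two_sidedZ | apply: two_sidedN].
have -> : s^-1 *: (expm (s *: Z) * Y * expm (- (s *: Z)) - Y) - commut Z Y =
  s^-1 *: (expm (s *: Z) * Y * expm (- (s *: Z)) - Y - s *: commut Z Y).
  by rewrite [in RHS]scalerBr scalerA mulVf ?gt_eqF// scale1r.
rewrite normrZ normfV gtr0_norm// ler_pdivrMl//.
have ns : `|s| <= 1 by rewrite gtr0_norm.
have [h1 h2 h3] := hC s ns.
have nns : `|- s| <= 1 by rewrite normrN.
have [h1' h2' h3'] := hC (- s) nns.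
rewrite -[- (s *: Z)]scaleNr.
have -> : expm (s *: Z) * Y * expm (- s *: Z) - Y - s *: commut Z Y =
  (expm (s *: Z) - 1 - s *: Z) * Y * expm (- s *: Z) +
  s *: (Z * Y * (expm (- s *: Z) - 1)) + Y * (expm (- s *: Z) - 1 - - s *: Z).
  by rewrite /commut; move: (expm (s *: Z)) (expm _) => x y; rewrite scaleNr; mxring.
have h4 := mx_norm_mulC (mx_norm_mulC h3 (lexx `|Y|)) h1'.
have h5 := mx_norm_mulC (mx_norm_mulC (lexx `|Z|) (lexx `|Y|)) h2'.
have h6 := mx_norm_mulC (lexx `|Y|) h3'.
rewrite (@le_trans _ _ (s ^+ 2 * D))//; last first.
  rewrite expr2 -mulrA ler_wpM2l ?(ltW s0)// (le_trans _ se)//.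
  by rewrite ler_wpM2l ?(ltW s0)// lerDl.
have -> : s ^+ 2 * D = n%:R * (n%:R * (C * s ^+ 2 * `|Y|) * C) +
  s * (n%:R * (n%:R * (`|Z| * `|Y|) * (C * s))) + n%:R * (`|Y| * (C * s ^+ 2)).
  by rewrite /D; ring.
rewrite (le_trans (ler_normD _ _))// lerD//; last by rewrite -[s ^+ 2]sqrrN.
rewrite (le_trans (ler_normD _ _))// lerD//.
rewrite normrZ gtr0_norm// ler_wpM2l ?(ltW s0)//.
by rewrite -{2}(gtr0_norm s0) -[`|s|]normrN.
Qed.

Lemma two_sided_adm Z Y k : two_sided Z -> two_sided Y -> two_sided (adm Z k Y).
Proof. by move=> hZ hY; elim: k => // k IH; rewrite /adm iterS; apply: two_sided_commut. Qed.

(** X is only one-sided, but the conjugates of X by e^(sZ) are one-sided for both signs of s.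
They are X + s [Z, X] plus a two-sided matrix, since all brackets of order at least 2 are
two-sided.  Dividing by |s| and letting s tend to infinity leaves [Z, X] or its opposite. *)
Lemma two_sided_drift Z X : two_sided Z -> one_sided X -> two_sided (commut Z (commut Z X)) ->
  two_sided (commut Z X).
Proof.
move=> hZ hX hQ; have lZ := two_sided_low hZ; have lX := one_sided_low hX.
have lZX : low 1 (commut Z X) by apply: low_le (low_commut lZ lX).
have key s : one_sided (X + s *: commut Z X).
  have hsZ := two_sidedZ s hZ.
  have := two_sided_conjLS hsZ hX.
  rewrite (expm_conj_adm dgK) ?(two_sided_low hsZ)//; last exact: low_le lX.
  have [r hr] : exists2 r, two_sided r & \sum_(k < K.+1) (k`!%:R)^-1 *: adm (s *: Z) k X =
      X + s *: commut Z X + r.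
    case: K K_gt0 => // K' _.
    exists (\sum_(k < K') (k.+2`!%:R)^-1 *: adm (s *: Z) k.+2 X).
      apply: two_sided_sum => k _; apply: two_sidedZ.
      rewrite /adm -addn2 iterD/=; apply: two_sided_adm => //.
      have -> : commut (s *: Z) (commut (s *: Z) X) = s ^+ 2 *: commut Z (commut Z X).
        by rewrite /commut; mxring.
      exact: two_sidedZ.
    rewrite !big_ord_recl/= /bump/= !invr1 !scale1r addrA; congr (_ + _ + _).
    by rewrite /commut; mxring.
  move=> -> /one_sidedD/(_ (two_sidedR hr)); by rewrite addrK.
have app (c : R) : `|c| = 1 -> one_sided (c *: commut Z X).
  move=> c1; apply: one_sided_closed; first exact: lowZ.
  move=> e e0; pose s : R := (`|X| + 1) / e.
  have s0 : 0 < s by rewrite divr_gt0// ltr_wpDl.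
  (* c is the sign of s; the term X / s tends to 0 *)
  exists (s^-1 *: (X + (c * s) *: commut Z X)).
    by apply: one_sidedZ => //; rewrite invr_ge0 ltW.
  rewrite scalerDr scalerA mulrCA mulVf ?gt_eqF// mulr1 addrK normrZ normfV gtr0_norm//.
  rewrite ler_pdivrMl// /s divfK ?gt_eqF//.
  by rewrite lerDl.
split; first by rewrite -[commut _ _]scale1r; apply: app; rewrite normr1.
by rewrite -scaleN1r; apply: app; rewrite normrN1.
Qed.

End Saturate.

(** * Brackets, letters and words *)

Section FreeLie.
Context {R : realType} {n : nat} (dg : 'I_n -> nat) (N : nat).
Local Notation K := (2 * N)%N.
Hypothesis dgK : forall i, (dg i <= K)%N.
Hypothesis N_gt0 : (0 < N)%N.
Local Notation A := 'M[R]_n.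
Implicit Types (M P Z Y z g : A) (i j k : nat).
Local Notation low := (low dg).
Local Notation homog := (homog dg).
Local Notation expm := (expm K).
Variables x0 x1 : A.
Hypothesis hx0 : homog 1 x0.
Hypothesis hx1 : homog 1 x1.

(** The matrix of a formal bracket, once x0 and x1 stand for X_0 and X_1. *)
Fixpoint bracket_mx (b : Br) : A :=
  match b with
  | X0 => x0
  | X1 => x1
  | Brk a c => commut (bracket_mx a) (bracket_mx c)
  end.

Lemma Br_length_gt0 b : (0 < Br_length b)%N.
Proof. by elim: b => //= a ha c _; rewrite addn_gt0 ha. Qed.

Lemma bracket_mx_homog b : homog (Br_length b) (bracket_mx b).
Proof. by elim: b => //= a ha c hc; apply: homog_commut. Qed.

Lemma bracket_mx_low b : low 1 (bracket_mx b).
Proof. by apply: (low_le (Br_length_gt0 b)); apply/homog_low/bracket_mx_homog. Qed.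

Let lx0 : low 1 x0 := bracket_mx_low X0.
Let K_gt0 : (0 < K)%N. Proof. by rewrite muln_gt0. Qed.

(** The brackets that drive the system, the drift included: a letter has one coordinate for
each, and coordinate 0 is the time spent. *)
Definition bracket (i : nat) : Br :=
  match i with 0 => X0 | 1 => X1 | j.+2 => W_ j.+1 end.

Definition letter := 'rV[R]_N.+1.
Implicit Types (th : letter) (w : seq letter).

Definition letter_mx th : A := \sum_(i < N.+1) th 0 i *: bracket_mx (bracket i).
(** The value of a word: the pieces of trajectory are composed from left to right. *)
Definition word_mx w : A := \prod_(th <- w) expm (letter_mx th).
Definition duration w : R := \sum_(th <- w) th 0 0.
Definition positive_word w := all (fun th => 0 < th 0 0) w.
Definition word_values M := exists2 w, positive_word w & M = word_mx w.

Lemma letter_mx_low th : low 1 (letter_mx th).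
Proof. by apply: low_sum => i _; apply/lowZ/bracket_mx_low. Qed.

Lemma word_mx_cat w w' : word_mx (w ++ w') = word_mx w * word_mx w'.
Proof. by rewrite /word_mx big_cat. Qed.

Lemma duration_cat w w' : duration (w ++ w') = duration w + duration w'.
Proof. by rewrite /duration big_cat. Qed.

Lemma word_mx_low w : low 1 (word_mx w - 1).
Proof.
rewrite /word_mx; elim: w => [|th w IH]; first by rewrite big_nil subrr low0.
rewrite big_cons; have h := low_expm1 K (letter_mx_low th).
have -> : expm (letter_mx th) * \prod_(j <- w) expm (letter_mx j) - 1 =
  expm (letter_mx th) * (\prod_(j <- w) expm (letter_mx j) - 1) + (expm (letter_mx th) - 1).
  by rewrite mulrBr mulr1 addrA subrK.
by apply: lowD => //; apply: lowMr => //; apply/low_expm/letter_mx_low.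
Qed.

Lemma word_values1 : word_values 1.
Proof. by exists [::]; rewrite // /word_mx big_nil. Qed.

Lemma word_valuesM M P : word_values M -> word_values P -> word_values (M * P).
Proof.
move=> [w pw ->] [w' pw' ->]; exists (w ++ w'); last by rewrite word_mx_cat.
by rewrite /positive_word all_cat -!/(positive_word _) pw.
Qed.

Local Notation one_sided := (one_sided dg K word_values).
Local Notation two_sided := (two_sided dg K word_values).

Lemma one_sided_x0 : one_sided x0.
Proof.
apply: (one_sidedI word_values1 lx0) => t t0; apply: adherent_incl.
exists [:: \row_i (if i == 0 then t else 0)].
  by rewrite /positive_word /= mxE eqxx t0.
rewrite /word_mx big_seq1 /letter_mx big_ord_recl big1 ?addr0 ?mxE ?eqxx// => i _.
by rewrite mxE -val_eqE/= scale0r.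
Qed.

(** A pure control direction is the limit of letters whose duration tends to 0: the controls
may be arbitrarily large on a short time. *)
Lemma adherent_ctrl th : th 0 0 = 0 -> adherent word_values (expm (letter_mx th)).
Proof.
move=> th0 e e0; pose B := `|letter_mx th| + `|x0|.
have [C C0 hC] := @expm_lip R n K B.
pose d : R := Num.min 1 (e / (C * `|x0| + 1)).
have D1 : 0 < C * `|x0| + 1 by rewrite ltr_wpDl// mulr_ge0.
have d0 : 0 < d by rewrite lt_min ltr01 divr_gt0.
have d1 : d <= 1 by rewrite ge_min lexx.
have de : d * (C * `|x0| + 1) <= e by rewrite -ler_pdivlMr// ge_min lexx orbT.
(* the same controls, with a short duration d *)
pose th' : letter := \row_i (if i == 0 then d else th 0 i).
have e1 : letter_mx th' = letter_mx th + d *: x0.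
  rewrite /letter_mx !big_ord_recl !mxE eqxx/= th0 scale0r add0r addrC; congr (_ + _).
  by apply: eq_bigr => i _; rewrite mxE.
exists (word_mx [:: th']).
  by exists [:: th'] => //; rewrite /positive_word/= mxE eqxx d0.
rewrite /word_mx big_seq1 e1 (le_trans (hC _ _ _ _))//.
- rewrite (le_trans (ler_normD _ _))// lerD2l normrZ gtr0_norm//.
  by rewrite ler_piMl.
- by rewrite lerDl.
rewrite addrC addKr normrZ gtr0_norm// (le_trans _ de)// mulrCA ler_wpM2l ?(ltW d0)//.
by rewrite lerDl.
Qed.

Lemma two_sided_ctrl (i : 'I_N.+1) : i != 0 -> two_sided (bracket_mx (bracket i)).
Proof.
move=> i0.
have cle (c : R) : adherent word_values (expm (c *: bracket_mx (bracket i))).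
  have -> : c *: bracket_mx (bracket i) = letter_mx (\row_j (if j == i then c else 0)).
    rewrite /letter_mx (bigD1 i)//= mxE eqxx big1 ?addr0// => j ji.
    by rewrite mxE (negbTE ji) scale0r.
  by apply: adherent_ctrl; rewrite mxE eq_sym (negbTE i0).
split; apply: (one_sidedI word_values1).
- exact: bracket_mx_low.
- by move=> t _; apply: cle.
- exact/lowN/bracket_mx_low.
- by move=> t _; rewrite scalerN -scaleNr; apply: cle.
Qed.

Lemma M_length j : Br_length (M_ j) = j.+1.
Proof. by elim: j => //= j ->; rewrite addn1. Qed.

(** The bracket [M_j, [M_j, x0]] is the matrix of W_(j+1).  It is a control when j + 1 < N, and
otherwise it vanishes since its degree 2j + 3 exceeds 2N; in both cases two_sided_drift
applies. *)
Lemma two_sided_M j : two_sided (bracket_mx (M_ j)).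
Proof.
elim: j => [|j IH].
  have N1 : (1 < N.+1)%N by rewrite ltnS.
  exact: (@two_sided_ctrl (Ordinal N1)).
rewrite [bracket_mx _]/=; apply: (two_sided_drift dgK K_gt0 word_values1 word_valuesM) => //;
  first exact: one_sided_x0.
have -> : commut (bracket_mx (M_ j)) (commut (bracket_mx (M_ j)) x0) = bracket_mx (bracket
  j.+2) by [].
have [jN|Nj] := ltnP j.+2 N.+1; first exact: (@two_sided_ctrl (Ordinal jN)).
have -> : bracket_mx (bracket j.+2) = 0; last exact: (two_sided0 _ _ word_values1).
apply: (low_big dgK (k := Br_length (bracket j.+2))); last exact/homog_low/bracket_mx_homog.
by rewrite /= M_length; lia.
Qed.

(** The Lie ideal generated by x1.  The M_j are the iterated brackets of x1 with x0, hence the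
Lie algebra that they generate is stable under ad x0 (ctrl_ideal_ad) and contains the
matrix of every bracket other than X_0 (ctrl_ideal_bracket_mx). *)
Inductive ctrl_ideal : A -> Prop :=
| ctrl_ideal_M j : ctrl_ideal (bracket_mx (M_ j))
| ctrl_idealD Z Y : ctrl_ideal Z -> ctrl_ideal Y -> ctrl_ideal (Z + Y)
| ctrl_idealZ (c : R) Z : ctrl_ideal Z -> ctrl_ideal (c *: Z)
| ctrl_ideal_commut Z Y : ctrl_ideal Z -> ctrl_ideal Y -> ctrl_ideal (commut Z Y).

Lemma ctrl_ideal0 : ctrl_ideal 0.
Proof. by rewrite -(scale0r (bracket_mx (M_ 0))); apply/ctrl_idealZ/ctrl_ideal_M. Qed.

Lemma ctrl_idealN Z : ctrl_ideal Z -> ctrl_ideal (- Z).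
Proof. by rewrite -scaleN1r; apply: ctrl_idealZ. Qed.

Lemma ctrl_ideal_sum (I : Type) (r : seq I) (Q : pred I) (F : I -> A) :
  (forall x, Q x -> ctrl_ideal (F x)) -> ctrl_ideal (\sum_(i <- r | Q i) F i).
Proof.
by move=> hF; apply: (big_ind ctrl_ideal) => //; [exact: ctrl_ideal0 | exact: ctrl_idealD].
Qed.

Lemma ctrl_ideal_low Z : ctrl_ideal Z -> low 1 Z.
Proof.
elim=> [j|Y Y' _ h _ h'|c Y _ h|Y Y' _ h _ h'].
- exact: bracket_mx_low.
- exact: lowD.
- exact: lowZ.
- by apply: low_le (low_commut h h').
Qed.

Lemma ctrl_ideal_two_sided Z : ctrl_ideal Z -> two_sided Z.
Proof.
elim=> [j|Y Y' _ h _ h'|c Y _ h|Y Y' _ h _ h'].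
- exact: two_sided_M.
- exact: (two_sidedD dgK K_gt0 word_values1 word_valuesM).
- exact: two_sidedZ.
- exact: (two_sided_commut dgK K_gt0 word_values1 word_valuesM).
Qed.

Lemma ctrl_ideal_ad Z : ctrl_ideal Z -> ctrl_ideal (commut x0 Z).
Proof.
elim=> [j|Y Y' _ h _ h'|c Y _ h|Y Y' hY h hY' h'].
- have -> : commut x0 (bracket_mx (M_ j)) = - bracket_mx (M_ j.+1) by rewrite /= /commut opprB.
  exact/ctrl_idealN/ctrl_ideal_M.
- have -> : commut x0 (Y + Y') = commut x0 Y + commut x0 Y' by rewrite /commut; mxring.
  exact: ctrl_idealD.
- have -> : commut x0 (c *: Y) = c *: commut x0 Y by rewrite /commut; mxring.
  exact: ctrl_idealZ.
- have -> : commut x0 (commut Y Y') = commut (commut x0 Y) Y' + commut Y (commut x0 Y').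
    by rewrite /commut; mxring.
  by apply: ctrl_idealD; apply: ctrl_ideal_commut.
Qed.

Lemma ctrl_ideal_bracket_mx b : b <> X0 -> ctrl_ideal (bracket_mx b).
Proof.
suff: b = X0 \/ ctrl_ideal (bracket_mx b) by case.
elim: b => [||a [->|ha] c [->|hc]]; [by left|right..].
- exact: (ctrl_ideal_M 0).
- by rewrite /= /commut subrr; apply: ctrl_ideal0.
- exact: ctrl_ideal_ad.
- have -> : bracket_mx (Brk a X0) = - commut x0 (bracket_mx a) by rewrite /= /commut opprB.
  exact/ctrl_idealN/ctrl_ideal_ad.
- exact: ctrl_ideal_commut.
Qed.

(** Conjugation by the drift, under which the ideal and the group below are invariant. *)
Definition drift_conj (t : R) M := expm (t *: x0) * M * expm (- (t *: x0)).

Lemma expm_driftVr t : expm (t *: x0) * expm (- (t *: x0)) = 1.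
Proof. by apply: (expmVr dgK); apply: lowZ. Qed.

Lemma expm_driftVl t : expm (- (t *: x0)) * expm (t *: x0) = 1.
Proof. by apply: (expmVl dgK); apply: lowZ. Qed.

Lemma drift_conj_M t M P : drift_conj t (M * P) = drift_conj t M * drift_conj t P.
Proof.
rewrite /drift_conj -!mulrA; congr (_ * (_ * _)).
by rewrite [in RHS]mulrA expm_driftVl mul1r.
Qed.

Lemma drift_conj_expm t M : drift_conj t (expm M) = expm (drift_conj t M).
Proof. by rewrite /drift_conj expm_conj// expm_driftVl. Qed.

Lemma drift_conj_D t M P : drift_conj t (M + P) = drift_conj t M + drift_conj t P.
Proof. by rewrite /drift_conj mulrDr mulrDl. Qed.

Lemma drift_conj_Z t c M : drift_conj t (c *: M) = c *: drift_conj t M.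
Proof. by rewrite /drift_conj scaleMr scaleMl. Qed.

Lemma drift_conj_1 t : drift_conj t 1 = 1.
Proof. by rewrite /drift_conj mulr1 expm_driftVr. Qed.

Lemma drift_conj_comm t M : GRing.comm M x0 -> drift_conj t M = M.
Proof.
move=> h; have -> : drift_conj t M = M * expm (t *: x0) * expm (- (t *: x0)).
  rewrite /drift_conj; congr (_ * _); rewrite expmE mulr_suml mulr_sumr.
  apply: eq_bigr => k _; rewrite scaleMl scaleMr; congr (_ *: _).
  by apply/commr_sym/commrX; rewrite /GRing.comm scaleMl scaleMr h.
by rewrite -mulrA expm_driftVr mulr1.
Qed.

Lemma drift_conj_x0 t : drift_conj t x0 = x0.
Proof. exact: drift_conj_comm. Qed.

Lemma drift_conj_N t M : drift_conj t (- M) = - drift_conj t M.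
Proof. by rewrite -[- M]scaleN1r drift_conj_Z scaleN1r. Qed.

Lemma ctrl_ideal_drift_conj t z : ctrl_ideal z -> ctrl_ideal (drift_conj t z).
Proof.
move=> hz; rewrite /drift_conj (expm_conj_adm dgK).
- apply: ctrl_ideal_sum => k _; apply: ctrl_idealZ.
  elim: (nat_of_ord k) => // j IH; rewrite /adm iterS -/(adm _ _ _).
  have -> : commut (t *: x0) (adm (t *: x0) j z) = t *: commut x0 (adm (t *: x0) j z).
    by rewrite /commut; mxring.
  exact/ctrl_idealZ/ctrl_ideal_ad.
- exact: lowZ.
- by apply: low_le (ctrl_ideal_low hz).
Qed.

(** What remains of e^(t x0 + z) when the drift is factored out on the left. *)
Definition drift_quotient (t : R) z := expm (- (t *: x0)) * expm (t *: x0 + z).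

(** The group generated by the drift quotients of the elements of the ideal.  It plays the role
of the exponential of the ideal, but this description makes the next properties immediate:
it is a group, it is invariant under the drift and under dilations, and every word is
the product of a power e^(T x0) and of one of its elements. *)
Inductive fiber_group : A -> Prop :=
| fiber_group1 : fiber_group 1
| fiber_group_cons t z g : ctrl_ideal z -> fiber_group g -> fiber_group (drift_quotient t z * g).

Lemma fiber_group_drift_quotient t z : ctrl_ideal z -> fiber_group (drift_quotient t z).
Proof. by move=> hz; rewrite -[drift_quotient t z]mulr1; apply/fiber_group_cons/fiber_group1. Qed.

Lemma fiber_groupM g g' : fiber_group g -> fiber_group g' -> fiber_group (g * g').
Proof.
elim=> [|t z h hz _ IH] hg'; first by rewrite mul1r.
by rewrite -mulrA; apply: fiber_group_cons => //; apply: IH.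
Qed.

Lemma fiber_group_expm z : ctrl_ideal z -> fiber_group (expm z).
Proof.
move=> hz; have -> : expm z = drift_quotient 0 z by rewrite /drift_quotient scale0r oppr0
  expm0 mul1r add0r.
exact: fiber_group_drift_quotient.
Qed.

Lemma drift_conj_drift_quotient s t z : drift_conj s (drift_quotient t z) = drift_quotient t
  (drift_conj s z).
Proof.
rewrite /drift_quotient drift_conj_M !drift_conj_expm drift_conj_N drift_conj_Z drift_conj_D
  drift_conj_Z drift_conj_x0 //.
Qed.

Lemma fiber_group_drift_conj s g : fiber_group g -> fiber_group (drift_conj s g).
Proof.
elim=> [|t z h hz _ IH]; first by rewrite drift_conj_1; apply: fiber_group1.
by rewrite drift_conj_M drift_conj_drift_quotient; apply: fiber_group_cons => //;
  apply: ctrl_ideal_drift_conj.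
Qed.

(** The inverse of e^(-t x0) e^(t x0 + z) is again a drift quotient, at time -t, for the
conjugate of -z by the drift. *)
Lemma fiber_group_inv g : fiber_group g -> exists g', [/\ fiber_group g', g * g' = 1 &
  g' * g = 1].
Proof.
elim=> [|t z h hz _ [h' [hh' e1 e2]]]; first by exists 1; split; rewrite ?mulr1//;
  exact: fiber_group1.
have lz := ctrl_ideal_low hz; have lt := lowZ t lx0; have ltz := lowD lt lz.
pose z' := - drift_conj (- t) z.
have e3 : drift_quotient (- t) z' = expm (- (t *: x0 + z)) * expm (t *: x0).
  rewrite /drift_quotient scaleNr opprK.
  have -> : - (t *: x0) + z' = drift_conj (- t) (- (t *: x0 + z)).
    by rewrite drift_conj_N drift_conj_D drift_conj_Z drift_conj_x0 opprD.
  rewrite -drift_conj_expm /drift_conj scaleNr opprK !mulrA expm_driftVr mul1r//.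
have e4 : drift_quotient t z * drift_quotient (- t) z' = 1.
  rewrite e3 /drift_quotient -mulrA [X in _ * X]mulrA (expmVr dgK)// mul1r expm_driftVl//.
have e5 : drift_quotient (- t) z' * drift_quotient t z = 1 by exact: mulmx1C.
exists (h' * drift_quotient (- t) z'); split.
- by apply: fiber_groupM => //; apply/fiber_group_drift_quotient/ctrl_idealN/ctrl_ideal_drift_conj.
- by rewrite -mulrA [h * _]mulrA e1 mul1r.
- by rewrite -mulrA [_ * (drift_quotient t z * h)]mulrA e5 mul1r.
Qed.

Lemma low1M M P : low 1 (M - 1) -> low 1 (P - 1) -> low 1 (M * P - 1).
Proof.
move=> hM hP; have -> : M * P - 1 = (M - 1) * (P - 1) + (M - 1) + (P - 1) by mxring.
by do 2!apply: lowD => //; apply: low_le (lowM hM hP).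
Qed.

Lemma fiber_group_low g : fiber_group g -> low 1 (g - 1).
Proof.
elim=> [|t z h hz _ IH]; first by rewrite subrr low0.
have lz := ctrl_ideal_low hz; have lt := lowZ t lx0.
by apply: low1M => //; apply: low1M; apply: low_expm1; [apply: lowN|apply: lowD].
Qed.

Let Q g := forall s, adherent word_values (drift_conj s g).

Let QM g g' : Q g -> Q g' -> Q (g * g').
Proof. by move=> h h' s; rewrite drift_conj_M; apply: (adherentM word_valuesM). Qed.

Let drift_conj_A s t M : drift_conj s (drift_conj t M) = drift_conj (s + t) M.
Proof.
rewrite /drift_conj (expmDZ dgK)// -!scaleNr opprD (expmDZ dgK) ?scaleNr// ?mulrA//.
rewrite -!mulrA; do 3!congr (_ * _).
by rewrite -!scaleNr -!(expmDZ dgK)// addrC.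
Qed.

Let QJ t g : Q g -> Q (drift_conj t g).
Proof. by move=> h s; rewrite drift_conj_A. Qed.

Let Q_expm z : ctrl_ideal z -> Q (expm z).
Proof. by move=> hz s; rewrite drift_conj_expm;
  apply/two_sided_expm/ctrl_ideal_two_sided/ctrl_ideal_drift_conj. Qed.

(** By Trotter, e^(t x0 + z) is a limit of products of e^(t x0 / m) and e^(z / m).  Pushing all
the powers of the drift to the left conjugates the factors e^(z / m) by the drift; they
stay exponentials of elements of the ideal, which are two-sided, and the drift cancels.
The induction therefore carries all conjugates by the drift along. *)
Lemma fiber_group_adherent g : fiber_group g -> adherent word_values g.
Proof.
elim=> [|t z h hz _ IH]; first exact/adherent_incl/word_values1.
apply: (adherentM word_valuesM) => //; have lz := ctrl_ideal_low hz; have lt := lowZ t lx0.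
apply: adherent_adherent => e e0.
pose c : R := n%:R * `|expm (- (t *: x0))| + 1.
have c0 : 0 < c by rewrite ltr_wpDl// mulr_ge0.
have [m m0 hm] := trotter dgK K_gt0 lt lz ltr01 (divr_gt0 e0 c0).
rewrite !scale1r in hm; set a := expm _ * expm _ in hm.
exists (expm (- (t *: x0)) * a ^+ m); last first.
  rewrite /drift_quotient -mulrBr (le_trans (mx_norm_mulC (lexx _) hm))//.
  rewrite !mulrA ler_pdivrMr// mulrC ler_wpM2l ?(ltW e0)//.
  by rewrite /c lerDl.
have mE : m%:R * (1 / m%:R) = 1 :> R by rewrite mul1r mulfV// pnatr_eq0 -lt0n.
suff hQ k : Q (expm (- ((k%:R * (1 / m%:R) * t) *: x0)) * a ^+ k).
  have := hQ m 0; rewrite /drift_conj scale0r oppr0 expm0 mul1r mulr1.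
  by rewrite mE mul1r.
elim: k => [|k IHk].
  rewrite !mul0r scale0r oppr0 expm0 expr0 mul1r => s; rewrite drift_conj_1.
  exact/adherent_incl/word_values1.
have -> : expm (- ((k.+1%:R * (1 / m%:R) * t) *: x0)) * a ^+ k.+1 =
   drift_conj (- (1 / m%:R * t)) (expm (- ((k%:R * (1 / m%:R) * t) *: x0)) * a ^+ k) *
   expm ((1 / m%:R) *: z).
  have aE : a = expm ((1 / m%:R * t) *: x0) * expm ((1 / m%:R) *: z) by rewrite /a scalerA.
  rewrite /drift_conj exprSr [X in _ * (_ * X)]aE.
  have -> : - ((k.+1%:R * (1 / m%:R) * t) *: x0) =
    (- (1 / m%:R * t) + - (k%:R * (1 / m%:R) * t)) *: x0.
    by rewrite -![- (_ *: x0)]scaleNr; congr (_ *: x0); rewrite -[k.+1%:R]natr1; ring.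
  rewrite (expmDZ dgK)// -[- (- (1 / m%:R * t) *: x0)]scaleNr opprK.
  by rewrite -[- ((k%:R * _ * _) *: x0)]scaleNr !mulrA.
apply: QM; first exact: QJ.
exact/Q_expm/ctrl_idealZ.
Qed.

Lemma letter_mx_split th : exists2 z, ctrl_ideal z & letter_mx th = th 0 0 *: x0 + z.
Proof.
rewrite /letter_mx big_ord_recl; eexists; last by [].
apply: ctrl_ideal_sum => i _; apply/ctrl_idealZ/ctrl_ideal_bracket_mx.
by rewrite /= /bump/=; case: i => -[].
Qed.

(** Every word is, up to the drift during its total duration, an element of the group. *)
Lemma word_mx_fiber_group w : exists2 g, fiber_group g & word_mx w = expm (duration w *: x0) * g.
Proof.
rewrite /word_mx /duration; elim: w => [|th w [g hg IH]].
  by exists 1; rewrite ?big_nil ?scale0r ?expm0 ?mulr1//; exact: fiber_group1.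
rewrite !big_cons IH; have [z hz ->] := letter_mx_split th.
set T := \sum_(_ <- _) _; set t := th 0 0.
exists (drift_conj (- T) (drift_quotient t z) * g); first by apply: fiber_groupM => //;
  apply/fiber_group_drift_conj/fiber_group_drift_quotient.
rewrite /drift_conj /drift_quotient scaleNr opprK (expmDZ dgK)//.
have -> : expm (t *: x0) * expm (T *: x0) *
   (expm (- (T *: x0)) * (expm (- (t *: x0)) * expm (t *: x0 + z)) * expm (T *: x0) * g) =
   expm (t *: x0) * (expm (T *: x0) * expm (- (T *: x0))) * expm (- (t *: x0)) *
   expm (t *: x0 + z) * expm (T *: x0) * g by rewrite !mulrA.
by rewrite expm_driftVr mulr1 expm_driftVr mul1r mulrA.
Qed.

End FreeLie.

(** * Positive spanning *)

Section PositiveSpan.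
Context {R : realType} {n : nat}.
Local Notation A := 'M[R]_n.

Lemma linear_bounded (W : normedModType R) (f : {linear A -> W}) :
  exists2 C : R, 0 <= C & forall x, `|f x| <= C * `|x|.
Proof.
exists (\sum_i \sum_j `|f (delta_mx i j)|) => [|x].
  by apply: sumr_ge0 => i _; apply: sumr_ge0.
rewrite {1}[x]matrix_sum_delta linear_sum mulr_suml (le_trans (ler_norm_sum _ _ _))//.
apply: ler_sum => i _; rewrite linear_sum mulr_suml (le_trans (ler_norm_sum _ _ _))//.
apply: ler_sum => j _; rewrite linearZ normrZ mulrC ler_wpM2l//.
exact: mx_entry_le.
Qed.

(** A maximal free family taken from D generates the span of D. *)
Lemma max_free (D : A -> Prop) : exists r, exists2 X : r.-tuple A,
  free X /\ (forall i, D (tnth X i)) & forall d, D d -> d \in <<X>>%VS.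
Proof.
pose P r := `[< exists X : r.-tuple A, free X /\ forall i, D (tnth X i) >].
have P0 : exists r, P r.
  by exists 0%N; apply/asboolP; exists [tuple]; split=> [|[]//]; exact: nil_free.
have Pb r : P r -> (r <= \dim {: A})%N.
  move/asboolP => [X [/eqP fX _]]; rewrite -(size_tuple X) -fX.
  exact/dimvS/subvf.
case: (ex_maxnP P0 Pb) => r /asboolP[X [fX DX]] maxr.
exists r, X => // d Dd; apply: contrapT => /negP dX.
suff /maxr : P r.+1 by rewrite ltnn.
apply/asboolP; exists [tuple of d :: X]; split.
  by rewrite free_cons dX fX.
move=> i; case: (unliftP ord0 i) => [j ->|->]; first by rewrite tnthS.
by rewrite tnth0.
Qed.

(** A maximal free family X of D spans N, since a linear map that vanishes on D is bounded on
the space N, hence zero there.  As D is dense up to a distance W, it also has a vector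
dm close to a large negative multiple of the sum of X, whose coordinates are all at most
-1.  Adding a large multiple of dm and compensating along X makes all coefficients at least
1 on a given ball, and they depend on u in an affine way. *)
Lemma positive_span (N D : A -> Prop) (W B : R) :
  N 0 -> (forall u v, N u -> N v -> N (u + v)) -> (forall (c : R) u, N u -> N (c *: u)) ->
  (forall d, D d -> N d) -> 0 <= B ->
  (forall v, N v -> exists2 d, D d & `|d - v| <= W) ->
  exists r (ds : 'I_r -> A) (al : 'I_r -> A -> R) (C : R),
  [/\ forall i, D (ds i), 0 <= C,
      forall i u u', `|al i u - al i u'| <= C * `|u - u'|,
      forall i u, `|u| <= B -> 1 <= al i u &
      forall u, N u -> u = \sum_i al i u *: ds i].
Proof.
move=> N0 ND NZ DN B0 dens.
have [r [X [fX DX] maxX]] := max_free D.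
have W0 : 0 <= W by have [d _] := dens _ N0; apply: le_trans.
have spanN v : N v -> v \in <<X>>%VS.
  move=> Nv; apply: contrapT => /negP vX.
  pose f0 : 'End(A) := \1%VF - projv <<X>>; pose f : {linear A -> A} := f0.
  have fE x : f x = x - projv <<X>> x by rewrite -[f x]/(f0 x) add_lfunE opp_lfunE id_lfunE.
  have [C C0 hC] := linear_bounded f.
  have fv : 0 < `|f v|.
    rewrite normr_gt0 fE subr_eq0; apply: contraNneq vX => ->.
    exact: memv_proj.
  pose k := (Num.truncn (C * W / `|f v|)).+1.
  have kb : C * W / `|f v| < k%:R by rewrite truncnS_gt.
  clearbody k.
  have [d Dd dk] := dens _ (NZ k%:R _ Nv).
  have fd : f d = 0 by rewrite fE projv_id ?maxX// subrr.
  have : k%:R * `|f v| <= C * W.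
    have -> : k%:R * `|f v| = `|f (k%:R *: v - d)|.
      by rewrite linearB linearZ fd subr0 normrZ normr_nat.
    by rewrite (le_trans (hC _))// ler_wpM2l// distrC.
  by rewrite leNgt -ltr_pdivrMr// kb.
have hcoord i : exists2 C : R, 0 <= C & forall x, `|coord X i x| <= C * `|x|.
  exact: (linear_bounded (coord X i : {linear A -> R^o})).
pose c i := sval (cid2 (hcoord i)).
have c0 i : 0 <= c i by rewrite /c; case: cid2.
pose c1 : R := \sum_i c i.
have c10 : 0 <= c1 by apply: sumr_ge0.
have hc1 i x : `|coord X i x| <= c1 * `|x|.
  have : `|coord X i x| <= c i * `|x| by rewrite /c; case: cid2.
  move/le_trans; apply; rewrite ler_wpM2r//.
  by rewrite /c1 (bigD1 i)//= lerDl sumr_ge0.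
clearbody c1.
pose M : R := c1 * W + 1.
have NX i : N (tnth X i) by apply: DN.
(* the distance W changes a coordinate by at most c1 W = M - 1 *)
pose vm := - M *: \sum_i tnth X i.
have Nvm : N vm by apply: NZ; apply: big_ind.
have [dm Ddm dmW] := dens _ Nvm.
have cdm i : coord X i dm <= - 1.
  have -> : dm = vm + (dm - vm) by rewrite addrC subrK.
  rewrite linearD /= linearZ /= linear_sum /=.
  have -> : \sum_j coord X i (tnth X j) = 1.
    rewrite (bigD1 i)//= big1 ?addr0; last first.
      by move=> j ji; rewrite (tnth_nth 0) coord_free// [j == i](negbTE ji).
    by rewrite (tnth_nth 0) coord_free// eqxx.
  have := hc1 i (dm - vm); rewrite /M /GRing.scale/= mulr1 => h.
  have {}h : coord X i (dm - vm) <= c1 * W.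
    by rewrite (le_trans (ler_norm _))// (le_trans h)// ler_wpM2l.
  lra.
pose a : R := c1 * B + 1.
have a1 : 1 <= a by rewrite lerDr mulr_ge0.
(* u = sum_j (u_j - a dm_j) X_j + a dm *)
exists r.+1, (fun i => if unlift ord0 i is Some j then tnth X j else dm),
  (fun i u => if unlift ord0 i is Some j then coord X j u - a * coord X j dm else a), c1.
split=> //.
- by move=> i; case: unliftP.
- move=> i u u'; case: unliftP => [j _|_]; last by rewrite subrr normr0 mulr_ge0.
  have e : coord X j (u - u') = coord X j u - coord X j u' by rewrite linearB.
  by rewrite opprB addrA subrK -e.
- move=> i u uB; case: unliftP => // j _.
  have h1 : - coord X j u <= c1 * B.
    by rewrite (le_trans (ler_norm _))// normrN (le_trans (hc1 _ _))// ler_wpM2l.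
  have h2 : a <= - (a * coord X j dm).
    by rewrite -mulrN ler_peMr ?(le_trans ler01 a1)// lerNr.
  rewrite -[X in X <= _](addrK (c1 * B)) addrC lerD// 1?lerNl//.
  by rewrite (le_trans _ h2)// addrC.
- move=> u Nu; rewrite big_ord_recl unlift_none.
  under eq_bigr => i _ do rewrite liftK scalerBl -scalerA (tnth_nth 0).
  rewrite sumrB -scaler_sumr.
  rewrite -(coord_span (spanN _ Nu)) -(coord_span (maxX _ Ddm)).
  by rewrite addrC subrK.
Qed.

End PositiveSpan.

(** * Dilations and the layers of the group *)

Section Dilation.
Context {R : realType} {n : nat} (dg : 'I_n -> nat) (N : nat).
Local Notation K := (2 * N)%N.
Hypothesis dgK : forall i, (dg i <= K)%N.
Hypothesis N_gt0 : (0 < N)%N.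
Local Notation A := 'M[R]_n.
Implicit Types (M P Z Y z g v : A) (i j k : nat).
Local Notation low := (low dg).
Local Notation homog := (homog dg).
Local Notation eqtr := (eqtr dg).
Local Notation expm := (expm K).
Variables x0 x1 : A.
Hypothesis hx0 : homog 1 x0.
Hypothesis hx1 : homog 1 x1.
Local Notation ctrl_ideal := (ctrl_ideal x0 x1).
Local Notation fiber_group := (fiber_group N x0 x1).
Local Notation letter := (@letter R N).
Local Notation letter_mx := (@letter_mx R n N x0 x1).
Local Notation word_mx := (@word_mx R n N x0 x1).
Implicit Types (th : letter) (w : seq letter).

(** The automorphism that multiplies matrices of degree k by s^k; it is the conjugation by the
diagonal matrix with entries s^(dg a). *)
Definition dilate (s : R) M : A := \matrix_(a, b) (s ^+ dg a * M a b * s^-1 ^+ dg b).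

Lemma dilate_D s M P : dilate s (M + P) = dilate s M + dilate s P.
Proof. by apply/matrixP => a b; rewrite !mxE; ring. Qed.

Lemma dilate_Z s c M : dilate s (c *: M) = c *: dilate s M.
Proof. by apply/matrixP => a b; rewrite !mxE; ring. Qed.

Lemma dilate_sum s (I : Type) (r : seq I) (F : I -> A) :
  dilate s (\sum_(i <- r) F i) = \sum_(i <- r) dilate s (F i).
Proof.
elim: r => [|i r IH]; last by rewrite !big_cons dilate_D IH.
by rewrite !big_nil -[0 in LHS](scale0r 0) dilate_Z scale0r.
Qed.

Lemma dilate_1 s : s != 0 -> dilate s 1 = 1.
Proof.
move=> s0; apply/matrixP => a b; rewrite !mxE; case: eqP => [->|_].
  by rewrite mulr1 -exprMn mulfV// expr1n.
by rewrite mulr0 mul0r.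
Qed.

Lemma dilate_M s M P : s != 0 -> dilate s (M * P) = dilate s M * dilate s P.
Proof.
move=> s0; apply/matrixP => a b; rewrite !mxE mulr_sumr mulr_suml.
apply: eq_bigr => c _; rewrite !mxE.
have e : s^-1 ^+ dg c * s ^+ dg c = 1 by rewrite -exprMn mulVf// expr1n.
rewrite [RHS](_ : _ = s ^+ dg a * (M a c * P c b) * s^-1 ^+ dg b *
  (s^-1 ^+ dg c * s ^+ dg c)); last by ring.
by rewrite e mulr1.
Qed.

Lemma dilate_X s M k : s != 0 -> dilate s (M ^+ k) = dilate s M ^+ k.
Proof.
by move=> s0; elim: k => [|k IH]; rewrite ?expr0 ?dilate_1// !exprS dilate_M// IH.
Qed.

Lemma dilate_expm s M : s != 0 -> dilate s (expm M) = expm (dilate s M).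
Proof.
by move=> s0; rewrite !expmE dilate_sum; apply: eq_bigr => k _; rewrite dilate_Z dilate_X.
Qed.

Lemma dilate_homog s k M : s != 0 -> homog k M -> dilate s M = s ^+ k *: M.
Proof.
move=> s0 /homogP h; apply/matrixP => a b; rewrite !mxE.
have [ab|ab] := eqVneq (dg a) (dg b + k)%N; last by rewrite h// !(mulr0, mul0r).
have e : s ^+ dg b * s^-1 ^+ dg b = 1 by rewrite -exprMn mulfV// expr1n.
rewrite ab exprD [LHS](_ : _ = s ^+ k * M a b * (s ^+ dg b * s^-1 ^+ dg b)); last by ring.
by rewrite e mulr1.
Qed.

Lemma dilate_eqtr s k M P : eqtr k M P -> eqtr k (dilate s M) (dilate s P).
Proof. by move/eqtrP => h; apply/eqtrP => a b /h; rewrite !mxE => ->. Qed.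

Lemma dilate_ctrl_ideal s z : s != 0 -> ctrl_ideal z -> ctrl_ideal (dilate s z).
Proof.
move=> s0; elim=> [j|Y Y' _ h _ h'|c Y _ h|Y Y' _ h _ h'].
- rewrite (dilate_homog s0 (bracket_mx_homog hx0 hx1 (M_ j))); exact/ctrl_idealZ/ctrl_ideal_M.
- by rewrite dilate_D; apply: ctrl_idealD.
- by rewrite dilate_Z; apply: ctrl_idealZ.
- rewrite /commut dilate_D -scaleN1r dilate_Z !dilate_M// scaleN1r; exact: ctrl_ideal_commut.
Qed.

Lemma dilate_x0 s t : s != 0 -> dilate s (t *: x0) = (s * t) *: x0.
Proof. by move=> s0; rewrite dilate_Z (dilate_homog s0 hx0) expr1 scalerA mulrC. Qed.

Lemma dilate_fiber_group s g : s != 0 -> fiber_group g -> fiber_group (dilate s g).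
Proof.
move=> s0; elim=> [|t z h hz _ IH]; first by rewrite dilate_1//; exact: fiber_group1.
rewrite dilate_M// /drift_quotient dilate_M// !dilate_expm// -scaleNr dilate_x0// mulrN
  scaleNr dilate_D dilate_x0//.
by apply: fiber_group_cons => //; apply: dilate_ctrl_ideal.
Qed.

(** Dilating the value of a word amounts to dilating its letters, so that dilated words are
again words; durations are multiplied by s since X_0 has degree 1. *)
Definition dilate_letter (s : R) th : letter := \row_i (s ^+ Br_length (bracket i) * th 0 i).

Lemma letter_mx_dilate s th : s != 0 -> letter_mx (dilate_letter s th) = dilate s (letter_mx th).
Proof.
move=> s0; rewrite /letter_mx dilate_sum; apply: eq_bigr => i _.
by rewrite mxE dilate_Z (dilate_homog s0 (bracket_mx_homog hx0 hx1 (bracket i))) scalerA mulrC.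
Qed.

Lemma word_mx_dilate s w : s != 0 -> word_mx (map (dilate_letter s) w) = dilate s (word_mx w).
Proof.
move=> s0; rewrite /word_mx; elim: w => [|th w IH]; first by rewrite !big_nil dilate_1.
by rewrite /= !big_cons IH letter_mx_dilate// dilate_M// dilate_expm.
Qed.

Lemma duration_dilate s w : duration (map (dilate_letter s) w) = s * duration w.
Proof.
by rewrite /duration big_map mulr_sumr; apply: eq_bigr => th _; rewrite mxE expr1.
Qed.

Lemma root_exists k (c : R) : (0 < k)%N -> 0 < c -> exists2 s, 0 < s & s ^+ k = c.
Proof.
move=> k0 c0; exists (c `^ (k%:R^-1)); first by rewrite powR_gt0.
rewrite -powR_mulrn ?powR_ge0// -powRrM mulVf ?powRr1 ?(ltW c0)//.
by rewrite pnatr_eq0 -lt0n.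
Qed.

(** The vectors v such that 1 + v is, modulo degree > k, an element of the group.  They form a
linear space: products give sums, inverses give opposites, dilations give multiples. *)
Definition group_layer k v := homog k v /\ exists2 g, fiber_group g & eqtr k g (1 + v).

Lemma eqtr_low k M P : low k.+1 (M - P) -> eqtr k M P.
Proof. by move=> h; apply/eqtr_sub. Qed.

Lemma low_p1 k v : homog k v -> low 0 (1 + v).
Proof.
by move=> h; apply: lowD; [exact: low1 | apply: (low_le (leq0n k)); apply: homog_low].
Qed.

Lemma eqtr_p1M k u v : (0 < k)%N -> homog k u -> homog k v ->
  eqtr k ((1 + u) * (1 + v)) (1 + (u + v)).
Proof.
move=> k0 hu hv; apply: eqtr_low.
have -> : (1 + u) * (1 + v) - (1 + (u + v)) = u * v by mxring.
by apply: low_le (lowM (homog_low hu) (homog_low hv)); lia.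
Qed.

Lemma fiber_group_low0 g : fiber_group g -> low 0 g.
Proof.
move=> hg; rewrite -[g](subrK 1); apply: lowD; last exact: low1.
exact: low_le (fiber_group_low hx0 hx1 hg).
Qed.

Lemma group_layer0 k : group_layer k 0.
Proof. by split; [exact: homog0 | exists 1; [exact: fiber_group1 | rewrite addr0]]. Qed.

Lemma group_layerD k u v : (0 < k)%N -> group_layer k u -> group_layer k v ->
  group_layer k (u + v).
Proof.
move=> k0 [hu [g hg gu]] [hv [g' hg' gv]]; split; first exact: homogD.
exists (g * g'); first exact: fiber_groupM.
have h := eqtrM (fiber_group_low0 hg) (low_p1 hv) gu gv.
exact: etrans h (eqtr_p1M k0 hu hv).
Qed.

Lemma group_layer_inv k g g' v : (0 < k)%N -> homog k v -> fiber_group g -> fiber_group g' ->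
  g * g' = 1 ->
  eqtr k g (1 + v) -> eqtr k g' (1 - v).
Proof.
move=> k0 hv hg hg' e gv.
have hNv : homog k (- v) by rewrite -scaleN1r; apply: homogZ.
have h1 : eqtr k ((1 - v) * g) 1.
  apply: (etrans (eqtrM (low_p1 hNv) (low_p1 hv) (erefl : eqtr k (1 - v) (1 - v)) gv)).
  by have := eqtr_p1M k0 hNv hv; rewrite addNr addr0.
have h2 : eqtr k ((1 - v) * g * g') (1 * g').
  apply: eqtrM => //; last exact: fiber_group_low0.
  by apply: lowMr (fiber_group_low0 hg); exact: low_p1 hNv.
by move: h2; rewrite -mulrA e mulr1 mul1r => /esym.
Qed.

Lemma group_layerN k v : (0 < k)%N -> group_layer k v -> group_layer k (- v).
Proof.
move=> k0 [hv [g hg gv]]; split; first by rewrite -scaleN1r; apply: homogZ.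
have [g' [hg' e _]] := fiber_group_inv dgK hx0 hx1 hg.
by exists g' => //; apply: group_layer_inv e gv.
Qed.

Lemma group_layerZ k c v : (0 < k)%N -> group_layer k v -> group_layer k (c *: v).
Proof.
move=> k0 hv; have [->|c0] := eqVneq c 0; first by rewrite scale0r; apply: group_layer0.
wlog cp : c c0 / 0 < c => [hw|].
  have [cp|cn|/eqP] := ltgtP 0 c; [exact: hw| |by rewrite eq_sym (negbTE c0)].
  by rewrite -[c]opprK scaleNr; apply: group_layerN => //; apply: hw; rewrite ?oppr_eq0 ?oppr_gt0.
case: hv => hv [g hg gv]; split; first exact: homogZ.
have [s s0 sk] := root_exists k0 cp; have s1 : s != 0 by rewrite gt_eqF.
exists (dilate s g); first exact: dilate_fiber_group.
by have := dilate_eqtr s gv; rewrite dilate_D dilate_1// (dilate_homog s1 hv) sk.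
Qed.

(** The factor e^(T x0) is left free: at the equilibrium of the drift it has no effect. *)
Definition reaches k w M := eqtr k (word_mx w) (expm (duration w *: x0) * M).

Lemma expm_drift_low t : low 0 (expm (t *: x0)).
Proof. by apply/low_expm/lowZ/homog_low. Qed.

Lemma expm_drift_low1 t : low 1 (expm (t *: x0) - 1).
Proof. by apply/low_expm1/lowZ/homog_low. Qed.

Lemma word_mx_low0 w : low 0 (word_mx w).
Proof.
rewrite -[word_mx w](subrK 1); apply: lowD; last exact: low1.
by apply: low_le (word_mx_low hx0 hx1 w).
Qed.

(** In the top degree k the contributions of two words add up, since moving a term of degree k
across a factor 1 + (degree at least 1) changes it only beyond degree k. *)
Lemma reaches_cat k w w' d M : (0 < k)%N -> homog k d -> low 1 (M - 1) ->
  reaches k w (1 + d) -> reaches k w' M -> reaches k (w ++ w') (M + d).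
Proof.
move=> k0 hd hM h1 h2; rewrite /reaches word_mx_cat duration_cat (expmDZ dgK);
  last exact: homog_low.
set a := expm (duration w *: x0) in h1 *; set b := expm (duration w' *: x0) in h2 *.
have la : low 0 a by apply: expm_drift_low.
have lb : low 0 b by apply: expm_drift_low.
have lb1 : low 1 (b - 1) by apply: expm_drift_low1.
have lM : low 0 M.
  by rewrite -[M](subrK 1); apply: lowD; [exact: low_le hM | exact: low1].
have h3 := eqtrM (word_mx_low0 w) (lowMr lb lM) h1 h2.
apply: (etrans h3); rewrite -[a * b * _]mulrA -mulrA.
apply: eqtr_low; rewrite -mulrBr; apply: lowMr => //.
have -> : (1 + d) * (b * M) - b * (M + d) =
  d * (b - 1) * M + d * (M - 1) - (b - 1) * d by mxring.
have ld := homog_low hd.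
apply: lowB; last by apply: low_le (lowM lb1 ld); lia.
apply: lowD; last by apply: low_le (lowM ld hM); lia.
by apply: lowMl => //; apply: low_le (lowM ld lb1); lia.
Qed.

Lemma reaches_dilate k s w d : 0 < s -> homog k d -> reaches k w (1 + d) ->
  reaches k (map (dilate_letter s) w) (1 + s ^+ k *: d).
Proof.
move=> s0 hd h; have s1 : s != 0 by rewrite gt_eqF.
rewrite /reaches word_mx_dilate// duration_dilate; have := dilate_eqtr s h.
by rewrite dilate_M// dilate_expm// dilate_x0// dilate_D dilate_1// (dilate_homog s1 hd).
Qed.

Lemma positive_word_dilate s w : 0 < s -> positive_word w ->
  positive_word (map (dilate_letter s) w).
Proof.
move=> s0 /allP h; apply/allP => _ /mapP[th /h tw ->].
by rewrite mxE expr1 mulr_gt0.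
Qed.

End Dilation.

(** * Families of words, and words that approximate a layer *)

Section Families.
Context {R : realType} {n : nat} (dg : 'I_n -> nat) (N : nat).
Local Notation K := (2 * N)%N.
Hypothesis dgK : forall i, (dg i <= K)%N.
Hypothesis N_gt0 : (0 < N)%N.
Local Notation A := 'M[R]_n.
Implicit Types (M P z g v : A) (i j k : nat).
Local Notation low := (low dg).
Local Notation homog := (homog dg).
Local Notation eqtr := (eqtr dg).
Local Notation trunc := (trunc dg).
Local Notation compo := (compo dg).
Local Notation expm := (expm K).
Variables x0 x1 : A.
Hypothesis hx0 : homog 1 x0.
Hypothesis hx1 : homog 1 x1.
Variables r1 r0 : 'I_n.
Hypothesis dg_r1 : dg r1 = (dg r0).+1.
Hypothesis x0_r : x0 r1 r0 = 1.
Hypothesis x1_r : x1 r1 r0 = 0.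
Local Notation ctrl_ideal := (ctrl_ideal x0 x1).
Local Notation fiber_group := (fiber_group N x0 x1).
Local Notation letter := (@letter R N).
Local Notation letter_mx := (@letter_mx R n N x0 x1).
Local Notation word_mx := (@word_mx R n N x0 x1).
Local Notation reaches := (@reaches R n dg N x0 x1).
Local Notation group_layer := (@group_layer R n dg N x0 x1).
Implicit Types (w : seq letter) (X : lipdom R).

(** On matrices 1 + (degree at least 1), an entry that links two consecutive degrees is
additive.  The entry of index (r1, r0) reads the coefficient of x0, hence the duration of a
word (word_mx_entry): words that approximate an element of the group have a small
duration. *)
Lemma entry_mul M P : low 1 (M - 1) -> low 1 (P - 1) ->
  (M * P) r1 r0 = M r1 r0 + P r1 r0.
Proof.
move=> hM hP; have neq : r1 != r0 by apply/eqP => e; move: dg_r1; rewrite e; lia.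
have : ((M - 1) * (P - 1)) r1 r0 = 0.
  by have /lowP := lowM hM hP; apply; rewrite dg_r1; lia.
have -> : M * P = (M - 1) * (P - 1) + M + P - 1 by mxring.
rewrite !(addmxE, oppmxE) => ->; rewrite [(1 : A) r1 r0]mxE (negbTE neq).
by rewrite add0r subr0.
Qed.

Lemma ctrl_ideal_entry z : ctrl_ideal z -> z r1 r0 = 0.
Proof.
elim=> [[|j]|Y Y' _ h _ h'|c Y _ h|Y Y' hY _ hY' _].
- exact: x1_r.
- have /homogP := bracket_mx_homog hx0 hx1 (M_ j.+1); apply; rewrite M_length dg_r1; lia.
- by rewrite mxE h h' addr0.
- by rewrite mxE h mulr0.
- have /lowP := low_commut (ctrl_ideal_low hx0 hx1 hY) (ctrl_ideal_low hx0 hx1 hY'); apply.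
  by rewrite dg_r1; lia.
Qed.

Lemma expm_entry M : low 1 M -> (expm M) r1 r0 = M r1 r0.
Proof.
move=> lM; have neq : r1 != r0 by apply/eqP => e; move: dg_r1; rewrite e; lia.
rewrite expmE summxE; case: N N_gt0 => // N' _.
rewrite mulnS 2!big_ord_recl/= big1 ?addr0.
  by rewrite !scalemxE expr0 expr1 [(1 : A) _ _]mxE (negbTE neq) mulr0 add0r invr1 mul1r.
move=> i _; rewrite scalemxE; have /lowP -> := lowX (bump 0 (bump 0 i)) lM;
  first by rewrite mulr0.
by rewrite dg_r1 /bump; lia.
Qed.

Lemma low1_fiber_group g : fiber_group g -> low 1 (g - 1). Proof. exact: (fiber_group_low hx0
  hx1). Qed.

Lemma fiber_group_entry g : fiber_group g -> g r1 r0 = 0.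
Proof.
have neq : r1 != r0 by apply/eqP => e; move: dg_r1; rewrite e; lia.
elim=> [|t z h hz hh IH]; first by rewrite mxE (negbTE neq).
have lz := ctrl_ideal_low hx0 hx1 hz; have lx0 := homog_low hx0.
have lt := lowZ t lx0; have ltz := lowD lt lz.
rewrite entry_mul ?low1_fiber_group ?IH ?addr0//; last exact: fiber_group_drift_quotient.
rewrite /drift_quotient entry_mul; [|by apply/low_expm1/lowN|exact: low_expm1].
rewrite !expm_entry//; last exact: lowN.
by rewrite !(addmxE, oppmxE) (ctrl_ideal_entry hz) addr0 addNr.
Qed.

Lemma word_mx_entry w : (word_mx w) r1 r0 = duration w.
Proof.
have [g hg ->] := word_mx_fiber_group dgK hx0 hx1 w.
have lx0 := homog_low hx0; have lt := lowZ (duration w) lx0.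
rewrite (entry_mul (low_expm1 K lt) (low1_fiber_group hg)).
by rewrite expm_entry// (fiber_group_entry hg) scalemxE x0_r addr0 mulr1.
Qed.

Fixpoint good_family X (S : seq (X -> letter)) : Prop :=
  if S is th :: S' then
    (BL th /\ forall h : X, ldom h -> 0 < th h 0 0) /\ good_family S'
  else True.

Definition family_at X (S : seq (X -> letter)) (h : X) : seq letter := [seq th h | th <- S].

Lemma good_family_cat X (S S' : seq (X -> letter)) : good_family S -> good_family S' ->
  good_family (S ++ S').
Proof. by elim: S => //= th S IH [h1 h2] h3; split=> //; apply: IH. Qed.

Lemma family_at_cat X (S S' : seq (X -> letter)) h :
  family_at (S ++ S') h = family_at S h ++ family_at S' h.
Proof. by rewrite /family_at map_cat. Qed.

Lemma BL_letter_mx X (th : X -> letter) : BL th -> BL (fun h => letter_mx (th h)).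
Proof. by move=> h; apply: BL_sum => i; apply: BLZ (BL_entry _ _ h) (BL_cst _ _). Qed.

Lemma BL_word_mx X (S : seq (X -> letter)) : good_family S ->
  BL (fun h => word_mx (family_at S h)).
Proof.
rewrite /word_mx /family_at; elim: S => [_|th S IH /= [[h1 _] h2]].
  by apply: BL_ext (BL_cst X (1 : A)) => h _; rewrite big_nil.
by apply: BL_ext (BLM (BL_expm K (BL_letter_mx h1)) (IH h2)) => h _; rewrite big_cons.
Qed.

Lemma BL_duration X (S : seq (X -> letter)) : good_family S ->
  BL (fun h => duration (family_at S h)).
Proof.
rewrite /duration /family_at; elim: S => [_|th S IH /= [[h1 _] h2]].
  by apply: BL_ext (BL_cst X (0 : R)) => h _; rewrite big_nil.
by apply: BL_ext (BLD (BL_entry 0 0 h1) (IH h2)) => h _; rewrite big_cons.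
Qed.

Lemma positive_word_family_at X (S : seq (X -> letter)) h : good_family S -> ldom h ->
  positive_word (family_at S h).
Proof.
by move=> + hd; elim: S => //= th S IH [[_ h1] h2]; rewrite /positive_word/= h1//; apply: IH.
Qed.

Lemma good_family_comp X (Y : lipdom R) (g : X -> Y) (c : R) (S : seq (Y -> letter)) : 0 <= c ->
  (forall h, ldom h -> ldom (g h)) ->
  (forall h h', lrel h h' -> lrel (g h) (g h') /\ ldst (g h) (g h') <= c * ldst h h') ->
  good_family S -> good_family [seq (fun h => th (g h)) | th <- S].
Proof.
move=> c0 gd gr; elim: S => //= th S IH [[h1 h2] h3]; split; last exact: IH.
by split=> [|h /gd]; [exact: (BL_comp c0 gd gr h1)|exact: h2].
Qed.

Lemma family_at_comp X (Y : lipdom R) (g : X -> Y) (S : seq (Y -> letter)) h :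
  family_at [seq (fun h => th (g h)) | th <- S] h = family_at S (g h).
Proof. by rewrite /family_at -map_comp. Qed.

Lemma good_family_dilate X (s : X -> R) w : BL s -> (forall h, ldom h -> 0 < s h) ->
  positive_word w ->
  good_family [seq (fun h => dilate_letter (s h) th) | th <- w].
Proof.
move=> bs ps; elim: w => //= th w IH /andP[t0 hw]; split; last exact: IH.
split=> [|h hd]; last by rewrite mxE expr1 mulr_gt0// ps.
apply: BL_mx => i j; apply: BL_ext (BLMr (BLXr (Br_length (bracket j)) bs) (BL_cst X (th 0
  j))) => h _.
by rewrite mxE.
Qed.

Lemma family_at_dilate X (s : X -> R) w h :
  family_at [seq (fun h => dilate_letter (s h) th) | th <- w] h = map (dilate_letter (s h)) w.
Proof. by rewrite /family_at -map_comp. Qed.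

(** The elements of the group that are close to 1 modulo degree > k, with a distance that does
not see the degrees > k. *)
Definition groupdom k (rho : R) : lipdom R := @LipDom R A
  (fun g => fiber_group g /\ `|trunc k (g - 1)| <= rho)
  (fun g g' => (fiber_group g /\ `|trunc k (g - 1)| <= rho) /\ (fiber_group g' /\ `|trunc k
    (g' - 1)| <= rho))
  (fun g g' => `|trunc k (g - g')|)
  (fun h h' H => H) (fun h h' => normr_ge0 _).

Definition solvable k := exists2 rho : R, 0 < rho &
  exists2 S : seq (groupdom k rho -> letter), good_family S &
  forall g, @ldom R (groupdom k rho) g -> reaches k (family_at S g) g.

Lemma trunc_norm k M : `|trunc k M| <= `|M|.
Proof.
apply: mx_norm_le => // i j; rewrite mxE; case: leqP => _; last by rewrite normr0.
exact: mx_entry_le.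
Qed.

Lemma trunc_norm_le k l M : (k <= l)%N -> `|trunc k M| <= `|trunc l M|.
Proof.
move=> kl; apply: mx_norm_le => // i j; rewrite mxE; case: leqP => h; last by rewrite normr0.
by apply: le_trans (mx_entry_le _ i j); rewrite mxE (leq_trans h)// leq_add2l.
Qed.

Lemma compo_trunc k M : `|compo k M| <= `|trunc k M|.
Proof.
apply: mx_norm_le => // i j; rewrite mxE; case: eqP => h; last by rewrite normr0.
by apply: le_trans (mx_entry_le _ i j); rewrite mxE h leqnn.
Qed.

Lemma solvable0 : solvable 0.
Proof.
exists 1 => //; exists [::] => // g [hg _]; rewrite /reaches /= /word_mx /duration !big_nil.
rewrite scale0r expm0 mul1r; apply: eqtr_low; rewrite -opprB.
exact/lowN/low1_fiber_group.
Qed.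

Definition word_layer k d := homog k d /\ exists2 w, positive_word w & reaches k w (1 + d).

Definition drift_free_part X (S : seq (X -> letter)) (h : X) : A :=
  expm (- (duration (family_at S h) *: x0)) * word_mx (family_at S h).

Lemma BL_drift_free_part X (S : seq (X -> letter)) : good_family S -> BL (drift_free_part S).
Proof.
move=> hS; apply: BLM; last exact: BL_word_mx.
by apply/BL_expm/BLN/BLZ; [exact: BL_duration | exact: BL_cst].
Qed.

Lemma drift_free_part_fiber_group X (S : seq (X -> letter)) h :
  fiber_group (drift_free_part S h) /\ word_mx (family_at S h) = expm (duration (family_at S
    h) *: x0) * drift_free_part S h.
Proof.
have lx0 := homog_low hx0.
rewrite /drift_free_part; have [g hg ->] := word_mx_fiber_group dgK hx0 hx1 (family_at S h).
rewrite [expm (- _) * _]mulrA (expmVl dgK) ?mul1r//; exact: lowZ.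
Qed.

Lemma expm_drift_cancel k t M P :
  eqtr k (expm (t *: x0) * M) (expm (t *: x0) * P) -> eqtr k M P.
Proof.
move=> /eqtr_sub; rewrite -mulrBr => h; apply/eqtr_sub.
have lx0 := homog_low hx0; have lt := lowZ t lx0.
have := lowMr (low_expm K (lowN lt)) h.
by rewrite mulrA (expmVl dgK)// mul1r.
Qed.

Lemma word_layer_group_layer k d : word_layer k d -> group_layer k d.
Proof.
move=> [hd [w _ hw]]; split=> //; have [g hg e] := word_mx_fiber_group dgK hx0 hx1 w.
by exists g => //; apply: (@expm_drift_cancel _ (duration w)); rewrite -e.
Qed.

Section Step.
Variables (k : nat) (rho : R).
Hypothesis rho0 : 0 < rho.
Variable S : seq (groupdom k rho -> letter).
Hypothesis hS : good_family S.
Hypothesis sol : forall g, @ldom R (groupdom k rho) g -> reaches k (family_at S g) g.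

Let lx0 : low 1 x0 := homog_low hx0.

Let drift_free_part_eqtr g : @ldom R (groupdom k rho) g -> eqtr k (drift_free_part S g) g.
Proof.
move=> gd; apply: (@expm_drift_cancel _ (duration (family_at S g))).
by have [_ <-] := drift_free_part_fiber_group S g; apply: sol.
Qed.

(** Take g in the group with g = 1 + v in degree k+1, and a word w that approximates g.  Then
the group element g2 for which g2 times w is a power of the drift is close to the inverse
of g, hence to 1 in degree at most k, and the given family S realises it exactly up to
degree k.  The word S(g2) followed by w is a power of the drift up to degree k; what it adds
in degree k+1 differs from v by a bounded amount, because S takes bounded values. *)
Lemma word_layer_dense : exists W : R, forall v, group_layer k.+1 v ->
  exists2 d, word_layer k.+1 d & `|d - v| <= W.
Proof.
have [W0 W00 [hW0 _]] := BL_drift_free_part hS.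
exists (W0 + 1) => v /(group_layerN dgK N_gt0 hx0 hx1 (ltn0Sn k)) [hv [g0 hg0 gv0]].
have [g [hg e1 e2]] := fiber_group_inv dgK hx0 hx1 hg0.
(* the layer is applied to - v, so that g0 = 1 - v and g = 1 + v *)
have gv : eqtr k.+1 g (1 + v).
  by have := group_layer_inv N_gt0 hx0 hx1 (ltn0Sn k) hv hg0 hg e1 gv0; rewrite opprK.
pose q := `|g0| + 1.
have [C C0 hC] := expm_bounds x0 1 (ltac:(by rewrite muln_gt0) : (0 < K)%N).
pose c : R := 2 * (n%:R * (n%:R * q ^+ 2) + n%:R * (C * q)) + 2 * (n%:R * (n%:R * q)) + 1.
have q0 : 0 < q by rewrite ltr_wpDl.
have t1 : 0 <= n%:R * (n%:R * q ^+ 2) by rewrite !mulr_ge0// ltW.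
have t2 : 0 <= n%:R * (C * q) by rewrite !mulr_ge0// ltW.
have t3 : 0 <= n%:R * (n%:R * q) by rewrite !mulr_ge0// ltW.
have c1 : 1 <= c by rewrite /c; lra.
have c0 : 0 < c by rewrite (lt_le_trans ltr01).
pose m : R := Num.min rho 1.
have m0 : 0 < m by rewrite lt_min rho0 ltr01.
have m1 : m <= 1 by rewrite ge_min lexx orbT.
(* small enough for the bound on g2 - g0 below, which is eta times a part of c *)
pose eta := m / c.
have eta0 : 0 < eta by rewrite divr_gt0.
have etac : eta * c = m by rewrite /eta divfK// gt_eqF.
have [s [w pw ->] wg] := fiber_group_adherent dgK N_gt0 hx0 hx1 hg eta0.
have [h hh wh] := word_mx_fiber_group dgK hx0 hx1 w.
have T_le : `|duration w| <= eta.
  apply: le_trans wg; rewrite -word_mx_entry -[word_mx w r1 r0]subr0 -(fiber_group_entry hg).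
  by rewrite -oppmxE -addmxE; exact: mx_entry_le.
have eta1 : eta <= 1.
  by rewrite -[eta]mulr1 (le_trans (ler_wpM2l (ltW eta0) c1))// etac.
have [h' [hh' e3 e4]] := fiber_group_inv dgK hx0 hx1 hh.
(* g2 is chosen so that g2 times w is the drift during time t *)
pose t := duration w; pose g2 := drift_conj N x0 t h'.
have hg2 : fiber_group g2 by exact: fiber_group_drift_conj.
have g2w : g2 * word_mx w = expm (t *: x0).
  rewrite wh /g2 /drift_conj -/t -mulrA [expm (- _) * _]mulrA (expm_driftVl dgK hx0 hx1) mul1r.
  by rewrite -mulrA e4 mulr1.
have g2E : g2 - g0 = g2 * (g - word_mx w) * g0 + (g2 * word_mx w - 1) * g0.
  by rewrite mulrBr mulrBl -mulrA e2 mulr1 mulrBl mul1r addrA subrK.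
have d_le : `|g2 - g0| <= eta * (2 * (n%:R * (n%:R * q ^+ 2) + n%:R * (C * q))).
  set de := `|g2 - g0|.
  have [_ hC' _] := hC t (le_trans T_le eta1).
  have hg0q : `|g0| <= q by rewrite lerDl.
  have hg2q : `|g2| <= q + de.
    by rewrite -[g2](subrK g0) (le_trans (ler_normD _ _))// addrC lerD.
  have wg' : `|g - word_mx w| <= eta by rewrite distrC.
  have b1 := mx_norm_mulC (mx_norm_mulC hg2q wg') hg0q.
  have b2 := mx_norm_mulC hC' hg0q.
  rewrite -g2w in b2.
  have b3 : de <= n%:R * (n%:R * ((q + de) * eta) * q) + n%:R * (C * `|t| * q).
    by rewrite {1}/de g2E (le_trans (ler_normD _ _))// lerD.
  have b4 : n%:R * (C * `|t| * q) <= eta * (n%:R * (C * q)).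
    rewrite (_ : n%:R * (C * `|t| * q) = `|t| * (n%:R * (C * q))); last by ring.
    by rewrite ler_wpM2r.
  have b5 : eta * (2 * (n%:R * (n%:R * q))) <= 1.
    rewrite (le_trans _ m1)// -etac ler_wpM2l ?(ltW eta0)// /c; lra.
  have de0 : 0 <= de by rewrite /de.
  have b6 : n%:R * (n%:R * ((q + de) * eta) * q) =
    eta * (n%:R * (n%:R * q ^+ 2)) + de * (eta * (n%:R * (n%:R * q))) by ring.
  have b7 : de * (eta * (2 * (n%:R * (n%:R * q)))) <= de by rewrite ler_piMr.
  move: b3 b4 b7; rewrite b6.
  move: (n%:R * (n%:R * q)) (n%:R * (C * `|t| * q)) (n%:R * (n%:R * q ^+ 2)) (n%:R * (C * q)).
  by clearbody de => Q T P V b3 b4 b7; lra.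
have dm : `|g2 - g0| <= m.
  by rewrite (le_trans d_le)// -etac ler_wpM2l ?(ltW eta0)// /c; lra.
have tg0 : trunc k (g0 - 1) = 0.
  have h1 : trunc k g0 = trunc k (1 - v) := eqtr_le (leqnSn k) gv0.
  have h2 : trunc k (1 - v) = trunc k 1.
    by apply: eqtr_low; rewrite addrC addKr; exact: homog_low.
  by rewrite truncB h1 h2 subrr.
have dom2 : @ldom R (groupdom k rho) g2.
  split=> //; have -> : g2 - 1 = (g2 - g0) + (g0 - 1) by rewrite addrA subrK.
  have -> : trunc k ((g2 - g0) + (g0 - 1)) = trunc k (g2 - g0).
    by rewrite truncD tg0 addr0.
  by rewrite (le_trans (trunc_norm _ _))// (le_trans dm)// ge_min lexx.
have lp : low k.+1 (drift_free_part S g2 - g2) by apply/eqtr_sub/drift_free_part_eqtr.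
pose d := compo k.+1 (drift_free_part S g2 - g2).
have hd : homog k.+1 d by exact: homog_compo.
have [hp vp] := drift_free_part_fiber_group S g2.
exists d.
  split=> //; exists (family_at S g2 ++ w).
    by rewrite /positive_word all_cat -!/(positive_word _) pw positive_word_family_at.
  rewrite /reaches word_mx_cat duration_cat vp (expmDZ dgK)//.
  rewrite -[_ * drift_free_part S g2 * _]mulrA -[_ * (1 + d)]mulrA.
  apply: eqtrM.
  - exact: expm_drift_low.
  - by apply: lowMr (low_p1 hd); apply: expm_drift_low.
  - by [].
  - apply: (@eq_trans _ _ (trunc k.+1 ((g2 + d) * word_mx w))).
      apply: eqtrM.
      + exact: (fiber_group_low0 hx0 hx1 hp).
      + exact: word_mx_low0.
      + exact: eqtr_compo.
      + by [].
    rewrite mulrDl g2w; apply: eqtr_low.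
    rewrite mulrDr mulr1 opprD addrACA subrr add0r.
    have -> : d * word_mx w - expm (duration w *: x0) * d =
      d * (word_mx w - 1) - (expm (duration w *: x0) - 1) * d by mxring.
    have ld := homog_low hd.
    apply: lowB.
      by have := lowM ld (word_mx_low hx0 hx1 w); rewrite addn1.
    by have := lowM (expm_drift_low1 N hx0 (duration w)) ld; rewrite add1n.
have -> : d - v = compo k.+1 (drift_free_part S g2) - compo k.+1 (g2 - g0) .
  have -> : v = - compo k.+1 g0.
    have /eqtrP h0 := gv0; apply/matrixP => a b; rewrite oppmxE mxE.
    case: eqP => ab; last first.
      move/homogP: hv => /(_ a b); rewrite oppmxE => /(_ (introN eqP ab))/eqP.
      by rewrite oppr_eq0 => /eqP ->; rewrite mulr0n oppr0.
    have ne : a != b.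
      by apply: contraPneq ab => ->; apply/eqP; rewrite -[X in X == _]addn0 eqn_add2l.
    rewrite h0 ?ab// addmxE oppmxE [(1 : A) a b]mxE (negbTE ne) add0r mulr1n opprK.
    by [].
  by rewrite /d !compoB opprK opprB addrA addrAC.
rewrite (le_trans (ler_normB _ _))// lerD//.
  rewrite (le_trans (compo_trunc _ _))// (le_trans (trunc_norm _ _))//.
  exact: hW0.
rewrite (le_trans (compo_trunc _ _))// (le_trans (trunc_norm _ _))//.
by rewrite (le_trans dm).
Qed.

End Step.

End Families.

(** * Exact solutions in every degree *)

(** The k-th root is Lipschitz on [1, +oo[, and it is applied to the coefficients of
positive_span, which are at least 1. *)
Lemma BL_root {R : realType} (X : lipdom R) (f : X -> R) k : (0 < k)%N -> BL f ->
  (forall h, ldom h -> 1 <= f h) ->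
  exists2 s : X -> R, BL s & forall h, ldom h -> 0 < s h /\ s h ^+ k = f h.
Proof.
move=> k0 [C C0 [hf1 hf2]] f1; pose s h := f h `^ (k%:R^-1).
have sP h : ldom h -> 1 <= s h /\ s h ^+ k = f h.
  move=> hd; have fh := f1 _ hd; have e : s h ^+ k = f h.
    rewrite -powR_mulrn ?powR_ge0// -powRrM mulVf ?powRr1 ?(le_trans ler01)//.
    by rewrite pnatr_eq0 -lt0n.
  split=> //; rewrite leNgt; apply/negP => s1.
  have : s h ^+ k < 1 by rewrite exprn_ilt1 ?powR_ge0// -lt0n.
  by rewrite e ltNge fh.
exists s; last by move=> h /sP[h1 ->]; rewrite (lt_le_trans ltr01).
exists C => //; split=> [h hd|h h' hh].
  have [s1 e] := sP _ hd; rewrite ger0_norm ?(le_trans ler01)//.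
  rewrite (le_trans _ (hf1 _ hd))// -e ger0_norm ?exprn_ge0 ?(le_trans ler01)//.
  by rewrite -[leLHS]expr1 ler_weXn2l.
have [hd hd'] := lrel_ldom hh; have [s1 e] := sP _ hd; have [s1' e'] := sP _ hd'.
rewrite (le_trans _ (hf2 _ _ hh))// -e -e' subrXX normrM ler_peMr//.
move: (s h) (s h') s1 s1' => x y s1 s1'; case: k k0 {s sP e e'} => // k _.
rewrite big_ord_recl/= subn0 expr0 mulr1 (le_trans _ (ler_norm _))//.
rewrite -[leLHS]addr0 lerD ?exprn_ege1// sumr_ge0// => i _.
by rewrite mulr_ge0 ?exprn_ge0 ?(le_trans ler01).
Qed.

Section SolveStep.
Context {R : realType} {n : nat} (dg : 'I_n -> nat) (N : nat).
Local Notation K := (2 * N)%N.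
Hypothesis dgK : forall i, (dg i <= K)%N.
Hypothesis N_gt0 : (0 < N)%N.
Local Notation A := 'M[R]_n.
Implicit Types (M P z g v : A) (k : nat).
Local Notation low := (low dg).
Local Notation homog := (homog dg).
Local Notation eqtr := (eqtr dg).
Local Notation compo := (compo dg).
Local Notation expm := (expm K).
Variables x0 x1 : A.
Hypothesis hx0 : homog 1 x0.
Hypothesis hx1 : homog 1 x1.
Variables r1 r0 : 'I_n.
Hypothesis dg_r1 : dg r1 = (dg r0).+1.
Hypothesis x0_r : x0 r1 r0 = 1.
Hypothesis x1_r : x1 r1 r0 = 0.
Local Notation fiber_group := (fiber_group N x0 x1).
Local Notation letter := (@letter R N).
Local Notation word_mx := (@word_mx R n N x0 x1).
Local Notation reaches := (@reaches R n dg N x0 x1).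
Local Notation group_layer := (@group_layer R n dg N x0 x1).
Local Notation groupdom := (@groupdom R n dg N x0 x1).
Local Notation solvable := (@solvable R n dg N x0 x1).

Lemma reaches_eqtr k w M P : low 0 P -> eqtr k M P -> reaches k w M -> reaches k w P.
Proof.
move=> lP MP h; apply: (etrans h); apply: eqtrM => //.
exact: expm_drift_low.
Qed.

Lemma BL_compo_id k rho : BL (X := groupdom k rho) (fun h : A => compo k h).
Proof.
exists (1 + `|rho| + `|compo k 1|) => //; split=> [h [_ hr]|h h' _].
  rewrite -[h](subrK 1) compoD (le_trans (ler_normD _ _))// lerD//.
  rewrite (le_trans (compo_trunc _ _ _))// (le_trans hr)// (le_trans (ler_norm _))//.
  by rewrite lerDr.
rewrite -compoB (le_trans (compo_trunc _ _ _))//.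
by rewrite ler_peMl// -addrA lerDl addr_ge0.
Qed.

Lemma BL_compo k (X : lipdom R) (f : X -> A) : BL f -> BL (fun h => compo k (f h)).
Proof.
have le M : `|compo k M| <= `|M| by rewrite (le_trans (compo_trunc _ _ _))// trunc_norm.
move=> [C C0 [h1 h2]]; exists C => //; split=> [h hd|h h' hh].
  by rewrite (le_trans (le _))// h1.
by rewrite -compoB (le_trans (le _))// h2.
Qed.

(** The family S solves for h up to degree k and leaves an error u(h) in degree k+1.  By
positive_span, u(h) is a combination of vectors d_i of the word layer with coefficients at
least 1; the word of d_i, dilated by the (k+1)-st root of its coefficient, produces that
term.  All of these are concatenated with S(h). *)
Lemma solvableS k : solvable k -> solvable k.+1.
Proof.
move=> [rho rho0 [S hS sol]].
have [W hW] := word_layer_dense dgK N_gt0 hx0 hx1 dg_r1 x0_r x1_r rho0 hS sol.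
exists rho => //; set X := groupdom k.+1 rho.
have idd (h : X) : @ldom _ X h -> @ldom _ (groupdom k rho) h.
  by case=> h1 h2; split=> //; rewrite (le_trans (trunc_norm_le _ _ (leqnSn k))).
have idr (h h' : X) : @lrel _ X h h' -> @lrel _ (groupdom k rho) h h' /\
    @ldst _ (groupdom k rho) h h' <= 1 * @ldst _ X h h'.
  case=> /idd h1 /idd h2; split=> //.
  by rewrite mul1r; apply: trunc_norm_le.
pose S' : seq (X -> letter) := [seq (fun h => th h) | th <- S].
have hS' : good_family S' := good_family_comp ler01 idd idr hS.
have S'E (h : X) : family_at S' h = family_at S (h : groupdom k rho).
  exact: (@family_at_comp R N X (groupdom k rho) id S h).
pose p (h : X) : A := drift_free_part x0 x1 S h.
have pE (h : X) : word_mx (family_at S' h) = expm (duration (family_at S' h) *: x0) * p h.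
  by rewrite S'E; case: (drift_free_part_fiber_group dgK hx0 hx1 S h).
have pg (h : X) : fiber_group (p h) by case: (drift_free_part_fiber_group dgK hx0 hx1 S h).
have BLp : BL p := BL_comp ler01 idd idr (BL_drift_free_part x0 x1 hS).
have lhp (h : X) : @ldom _ X h -> low k.+1 (h - p h).
  move=> hd; rewrite -opprB; apply/lowN/eqtr_sub.
  apply: (expm_drift_cancel (t := duration (family_at S' h)) dgK hx0).
  by rewrite -pE S'E; apply: sol; apply: idd.
pose u (h : X) : A := compo k.+1 (h - p h).
have BLu : BL u.
  by apply: BL_ext (BLB (@BL_compo_id k.+1 rho) (BL_compo k.+1 BLp)) => h hd; rewrite -compoB.
have hu (h : X) : homog k.+1 (u h) by exact: homog_compo.
have hpu (h : X) : @ldom _ X h -> eqtr k.+1 h (p h + u h).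
  by move=> hd; apply/eqtr_compo/lhp.
have lp0 (h : X) : low 0 (p h) := fiber_group_low0 hx0 hx1 (pg h).
have Nu (h : X) : @ldom _ X h -> group_layer k.+1 (u h).
  move=> hd; split=> //; have [hg _] := hd.
  have [p' [hp' e1 e2]] := fiber_group_inv dgK hx0 hx1 (pg h).
  exists (p' * h); first exact: fiber_groupM.
  have l1 := fiber_group_low0 hx0 hx1 hp'.
  have ld := homog_low (hu h).
  have lpu : low 0 (p h + u h) by apply: lowD => //; apply: low_le ld.
  have h1 := eqtrM l1 lpu (erefl : eqtr k.+1 p' p') (hpu h hd).
  apply: (etrans h1); rewrite mulrDr e2; apply: eqtr_low.
  have -> : 1 + p' * u h - (1 + u h) = (p' - 1) * u h by mxring.
  by have := lowM (fiber_group_low hx0 hx1 hp') ld; rewrite add1n.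
have [B B0 [uB _]] := BLu.
have [r [ds [al [C [hdd C0 alC al1 alE]]]]] := positive_span (group_layer0 _ _ _ _ _)
  (fun u v => group_layerD N_gt0 hx0 hx1 (ltn0Sn k)) (fun c u => group_layerZ dgK N_gt0 hx0
    hx1 c (ltn0Sn k))
  (fun d => @word_layer_group_layer R n dg N dgK x0 x1 hx0 hx1 k.+1 d) B0 hW.
have BLal i : BL (fun h : X => al i (u h)).
  have [C' C'0 [u1 u2]] := BLu.
  exists (C * C' + `|al i 0|); first by rewrite addr_ge0// mulr_ge0.
  split=> [h hd|h h' hh].
    have -> : al i (u h) = (al i (u h) - al i 0) + al i 0 by rewrite subrK.
    rewrite (le_trans (ler_normD _ _))// lerD// (le_trans (alC _ _ _))//.
    by rewrite subr0 ler_wpM2l// u1.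
  rewrite (le_trans (alC _ _ _))// mulrDl -[leLHS]addr0 lerD//.
    by rewrite -mulrA ler_wpM2l// u2.
  by rewrite mulr_ge0// ldst_ge0.
have rt i : exists s : X -> R, BL s /\
    forall h, ldom h -> 0 < s h /\ s h ^+ k.+1 = al i (u h).
  have [|s h1 h2] := BL_root (ltn0Sn k) (BLal i); last by exists s.
  by move=> h hd; apply/al1/uB.
pose s i := sval (cid (rt i)); have hs i : BL (s i) by rewrite /s; case: cid => ? [].
have sP i (h : X) : ldom h -> 0 < s i h /\ s i h ^+ k.+1 = al i (u h).
  by rewrite /s; case: cid => ? [_ /=]; apply.
have ww i : exists w : seq letter, positive_word w /\ reaches k.+1 w (1 + ds i).
  by have [_ [w h1 h2]] := hdd i; exists w.
pose w i := sval (cid (ww i)).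
have wP i : positive_word (w i) /\ reaches k.+1 (w i) (1 + ds i) by rewrite /w; case: cid.
pose fam i : seq (X -> letter) := [seq (fun h => dilate_letter (s i h) th) | th <- w i].
pose F (l : seq 'I_r) := foldr (fun i acc => fam i ++ acc) S' l.
have FOK l : good_family (F l).
  elim: l => //= i l IH; apply: good_family_cat => //; apply: good_family_dilate => //.
    by move=> h /(sP i)[].
  by have [] := wP i.
have hdi i : homog k.+1 (ds i) by case: (hdd i).
have key l (h : X) : @ldom _ X h ->
    reaches k.+1 (family_at (F l) h) (p h + \sum_(i <- l) al i (u h) *: ds i).
  move=> hd; elim: l => [|i l IH].
    by rewrite big_nil addr0 /reaches pE.
  rewrite big_cons [X in p h + X]addrC addrA /F/= -/(F l) family_at_cat family_at_dilate.
  have [s0 sk] := sP i _ hd.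
  apply: (reaches_cat dgK N_gt0 hx0 hx1 (ltn0Sn k)) => //.
  - exact: homogZ.
  - rewrite addrAC; apply: lowD; first exact: (fiber_group_low hx0 hx1).
    apply: low_sum => j _; apply: lowZ; apply: (low_le _ (homog_low (hdi j))) => //.
  - by rewrite -sk; apply: reaches_dilate => //; have [] := wP i.
exists (F (enum 'I_r)) => // h hd.
apply: (reaches_eqtr _ _ (key (enum 'I_r) h hd)).
  by have [hg _] := hd; exact: (fiber_group_low0 hx0 hx1 hg).
rewrite big_enum/= -(alE _ (Nu h hd)).
exact/esym/hpu.
Qed.

Lemma solvable_all k : solvable k.
Proof. elim: k => [|k IH]; [exact: (solvable0 N hx0 hx1) | exact: solvableS]. Qed.

End SolveStep.

(** * Smooth functions and Lie derivatives *)

Section Smooth.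
Context {R : realType} {d : nat}.
Local Notation V := 'rV[R]_d.
Implicit Types (U : set V) (p q : V -> R) (F G : V -> V) (x v w : V).

Lemma near0_diff (e : V -> R) x : {near x, e =1 (fun=> 0)} ->
  differentiable e x /\ 'd e x = 0 :> (V -> R).
Proof.
move=> e0; have ex : e x = 0 by exact: nbhs_singleton e0.
have H : continuous (0 : V -> R) /\ e \o shift x = cst (e x) + \0 +o_ (0 : V) id.
  split; first exact: cst_continuous.
  apply/eqaddoP => _/posnumP[eps]; near=> h.
  have -> : (e \o shift x - (cst (e x) + \0)) h = e (h + x).
    by rewrite !fctE/= ex !addr0 subr0.
  have -> : e (h + x) = 0.
    near: h; move: e0; rewrite (near_shift 0) /= subr0; exact: filterS.
  by rewrite normr0 mulr_ge0.
have de : 'd e x = 0 :> (V -> R) by apply/diff_unique; case: H.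
by split=> //; apply/diff_locallyP; rewrite de.
Unshelve. all: by end_near. Qed.

Lemma diff_near p q x : {near x, p =1 q} -> differentiable p x ->
  differentiable q x /\ forall v, 'd q x v = 'd p x v.
Proof.
move=> pq dp; have [de e0] : differentiable (q - p) x /\ 'd (q - p) x = 0 :> (V -> R).
  apply: near0_diff; near=> y; rewrite !fctE/=.
  have -> : p y = q y by near: y.
  by rewrite subrr.
have qE : q = p + (q - p) by rewrite addrC subrK.
have dq : differentiable q x by rewrite qE; apply: differentiableD.
split=> [|v]; first exact: dq.
by rewrite [in LHS]qE (diffD dp de) /= e0 /= addr0.
Unshelve. all: by end_near. Qed.

(** The directional derivative as a scalar, kept behind a definition of its own so that the
differential is not unfolded by unification. *)
Definition dird p x v : R := 'd p x v.

Lemma dird_near p q x v : {near x, p =1 q} -> differentiable p x -> dird q x v = dird p x v.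
Proof. by move=> pq dp; have [_] := diff_near pq dp; apply. Qed.

Lemma dird_D p q x v : differentiable p x -> differentiable q x ->
  dird (p + q) x v = dird p x v + dird q x v.
Proof. by move=> dp dq; rewrite /dird (diffD dp dq). Qed.

Lemma dird_M p q x v : differentiable p x -> differentiable q x ->
  dird (p * q) x v = p x * dird q x v + q x * dird p x v.
Proof. by move=> dp dq; rewrite /dird (diffM dp dq). Qed.

Lemma dird_cst (c : R) x v : dird (cst c) x v = 0.
Proof. by rewrite /dird diff_cst. Qed.

Lemma dird_sum_coor p x v : dird p x v = \sum_k v 0 k * dird p x (delta_mx 0 k).
Proof.
by rewrite /dird {1}[v]row_sum_delta linear_sum; apply: eq_bigr => k _; rewrite linearZ.
Qed.

Lemma dird_B p x v w : dird p x (v - w) = dird p x v - dird p x w.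
Proof. by rewrite /dird linearB. Qed.

Lemma dird_sum n (f : 'I_n -> V -> R) x v : (forall i, differentiable (f i) x) ->
  dird (\sum_i f i) x v = \sum_i dird (f i) x v.
Proof.
elim: n f => [|n IH] f h.
  by rewrite !big_ord0; exact: dird_cst.
rewrite !big_ord_recl dird_D ?IH//; first exact: differentiable_sum.
Qed.

Lemma dird_Z (c : R) p x v : differentiable p x -> dird (fun y => c * p y) x v = c * dird p x v.
Proof.
move=> dp; have -> : (fun y => c * p y) = cst c * p by [].
by rewrite (dird_M v (differentiable_cst c x) dp) dird_cst mulr0 addr0.
Qed.

Definition coor (j : 'I_d) : V -> R := fun x => x 0 j.

Lemma diff_coor F x j : differentiable F x ->
  differentiable (fun y : V => F y 0 j : R) x /\
  forall v, dird (fun y => F y 0 j) x v = ('d F x v) 0 j.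
Proof.
move=> dF; have dj : differentiable (fun y : V => F y 0 j : R) x.
  exact: (differentiable_comp dF (differentiable_coord _ _ _)).
split=> [|v]; first exact: dj.
rewrite /dird -(deriveE v dj) -(deriveE v dF) derive_mx ?mxE//.
exact: diff_derivable.
Qed.

Lemma dird_coorid j x v : dird (coor j) x v = v 0 j.
Proof.
have did : differentiable (id : V -> V) x by [].
by have [_ ->] := diff_coor j did; rewrite diff_val.
Qed.

Lemma is_derive_line p y v (s : R) : differentiable p (y + s *: v) ->
  is_derive s (1 : R) (fun s : R => p (y + s *: v)) (dird p (y + s *: v) v).
Proof.
move=> dp; pose g : R -> V := cst y + (fun s : R => s *: v).
have dg : is_diff s g (0 + (fun s : R => s *: v)) by apply: is_diffD.
have dg' : differentiable g s by apply: ex_diff.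
have dpg : differentiable p (g s) by [].
have e : (fun s : R => p (y + s *: v)) = p \o g by [].
rewrite e; apply: DeriveDef; first exact/diff_derivable/differentiable_comp.
rewrite deriveE; last exact: differentiable_comp.
rewrite (diff_comp dg' dpg)/= (@diff_val _ _ _ _ _ _ _ dg).
by rewrite fctE /= add0r scale1r.
Qed.

(** The chain rule along a curve that is only known to have derivable coordinates. *)
Lemma is_derive_chain p (z : R -> V) (v : V) (s : R) : differentiable p (z s) ->
  (forall j, is_derive s (1 : R) (fun t => z t 0 j) (v 0 j)) ->
  is_derive s (1 : R) (fun t => p (z t)) (dird p (z s) v).
Proof.
move=> dp hz; have dz : derivable z s 1.
  by apply/derivable_mxP => i j; rewrite ord1; have [] := hz j.
have ez : 'D_1 z s = v.
  rewrite derive_mx//; apply/rowP => j; rewrite mxE.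
  by have [_ <-] := hz j.
have dz' : differentiable z s by apply/derivable1_diffP.
apply: DeriveDef; first exact/diff_derivable/(differentiable_comp dz' dp).
rewrite (deriveE _ (differentiable_comp dz' dp)) (diff_comp dz' dp) /=.
by rewrite -ez deriveE.
Qed.

#[global] Opaque dird.

(** Scalar counterpart of class C^k, for which products and sums are easy; class_C_coor relates
the two. *)
Fixpoint Ck (k : nat) U p : Prop :=
  if k is k'.+1 then
    (forall x, U x -> differentiable p x) /\
    (forall v, Ck k' U (fun x => dird p x v))
  else forall x, U x -> {for x, continuous p}.

Lemma open_near U p q x : open U -> U x -> (forall y, U y -> p y = q y) ->
  {near x, p =1 q}.
Proof.
move=> oU Ux pq; have : nbhs x U by apply: open_nbhs_nbhs.
by apply: filterS => y /pq.
Qed.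

Lemma Ck_ext k U p q : open U -> (forall y, U y -> p y = q y) -> Ck k U p -> Ck k U q.
Proof.
move=> oU; elim: k p q => [|k IH] p q pq /=.
  move=> h x Ux; have pqx := open_near oU Ux pq.
  rewrite /prop_for /continuous_at -(pq _ Ux); apply: cvg_trans (h x Ux).
  exact: (@near_eq_cvg _ _ (nbhs x) _ _ _ pqx).
move=> [dp cp]; split=> [x Ux|v].
  by have [] := diff_near (open_near oU Ux pq) (dp x Ux).
apply: IH (cp v) => x Ux.
by rewrite (dird_near v (open_near oU Ux pq) (dp x Ux)).
Qed.

Lemma Ck_cont k U p x : Ck k U p -> U x -> {for x, continuous p}.
Proof. by case: k => [|k] /= => [h /h//|[h _] /h /differentiable_continuous]. Qed.

Lemma Ck_le k U p : Ck k.+1 U p -> Ck k U p.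
Proof.
elim: k p => [|k IH] p h; first by move=> x; apply: Ck_cont h.
by case: h => dp cp; split=> // v; apply: IH.
Qed.

Lemma Ck_cst k U (c : R) : Ck k U (fun=> c).
Proof.
elim: k c => [|k IH] c /=; first by move=> x _; apply: cst_continuous.
split=> [x _|v]; first exact: differentiable_cst.
suff -> : (fun x : V => dird (fun=> c) x v) = (fun=> 0) by [].
by apply/funext => x; rewrite -[fun=> c]/(cst c) dird_cst.
Qed.

Lemma CkD k U p q : open U -> Ck k U p -> Ck k U q -> Ck k U (fun x => p x + q x).
Proof.
move=> oU; elim: k p q => [|k IH] p q /=.
  by move=> hp hq x Ux; apply: continuousD; [exact: hp | exact: hq].
move=> [dp cp] [dq cq]; split=> [x Ux|v].
  exact: (differentiableD (dp x Ux) (dq x Ux)).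
apply: Ck_ext (IH _ _ (cp v) (cq v)) => // x Ux.
exact/esym/(dird_D v (dp x Ux) (dq x Ux)).
Qed.

Lemma CkM k U p q : open U -> Ck k U p -> Ck k U q -> Ck k U (fun x => p x * q x).
Proof.
move=> oU; elim: k p q => [|k IH] p q.
  by move=> hp hq x Ux; apply: continuousM; [exact: hp | exact: hq].
move=> hp hq; have hp' := Ck_le hp; have hq' := Ck_le hq.
case: hp => dp cp; case: hq => dq cq; split=> [x Ux|v].
  exact: (differentiableM (dp x Ux) (dq x Ux)).
apply: Ck_ext (CkD oU (IH _ _ hp' (cq v)) (IH _ _ hq' (cp v))) => // x Ux.
exact/esym/(dird_M v (dp x Ux) (dq x Ux)).
Qed.

Lemma Ck_sum k U (I : Type) (r : seq I) (p : I -> V -> R) : open U ->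
  (forall i, Ck k U (p i)) -> Ck k U (fun x => \sum_(i <- r) p i x).
Proof.
move=> oU h; elim: r => [|i r IH].
  by apply: Ck_ext (Ck_cst k U 0) => // x _; rewrite big_nil.
by apply: Ck_ext (CkD oU (h i) IH) => // x _; rewrite big_cons.
Qed.

Lemma class_C_coor k U F : open U -> class_C k U F -> forall j, Ck k U (fun x => F x 0 j).
Proof.
move=> oU; elim: k F => [|k IH] F /=.
  move=> h j x Ux; apply: (@continuous_comp _ _ _ F (fun M : V => M 0 j)).
    exact: h.
  exact: coord_continuous.
move=> [dF cF] j; split=> [x Ux|v]; first by have [] := diff_coor j (dF x Ux).
apply: Ck_ext (IH _ (cF v) j) => // x Ux.
by have [_ ->] := diff_coor j (dF x Ux).
Qed.

Definition lie F p x : R := dird p x (F x).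

Definition smooth_fn U p := forall k, Ck k U p.
Definition smooth_vf U F := forall j, smooth_fn U (fun x => F x 0 j).

Lemma smooth_fn_diff U p x : smooth_fn U p -> U x -> differentiable p x.
Proof. by move=> h; have [+ _] := h 1%N; apply. Qed.

Lemma smooth_fn_cont U p x : smooth_fn U p -> U x -> {for x, continuous p}.
Proof. by move=> h; have := h 0%N; apply. Qed.

Lemma smooth_fn_dir U p v : smooth_fn U p -> smooth_fn U (fun x => dird p x v).
Proof. by move=> h k; have [_] := h k.+1; apply. Qed.

Lemma smooth_fn_ext U p q : open U -> (forall y, U y -> p y = q y) -> smooth_fn U p ->
  smooth_fn U q.
Proof. by move=> oU pq h k; apply: Ck_ext (h k). Qed.

Lemma smooth_fnB U p q : open U -> smooth_fn U p -> smooth_fn U q ->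
  smooth_fn U (fun x => p x - q x).
Proof.
move=> oU hp hq k; apply: (Ck_ext oU _ (CkD oU (hp k) (CkM oU (Ck_cst k U (- 1)) (hq k)))).
by move=> y _; rewrite mulN1r.
Qed.

Lemma smooth_fn_lie U F p : open U -> smooth_vf U F -> smooth_fn U p -> smooth_fn U (lie F p).
Proof.
move=> oU hF hp k; apply: (Ck_ext oU (p := fun x => \sum_k F x 0 k * dird p x (delta_mx 0 k))).
  by move=> x _; rewrite /lie dird_sum_coor.
by apply: Ck_sum => // i; apply: CkM => //; [exact: hF | exact: smooth_fn_dir].
Qed.

Lemma smooth_fn_coor U j : smooth_fn U (coor j).
Proof.
case=> [|k] /=; first by move=> x _; apply: coord_continuous.
split=> [x _|v]; first exact: differentiable_coord.
suff -> : (fun x => dird (coor j) x v) = (fun=> v 0 j) by apply: Ck_cst.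
by apply/funext => x; apply: dird_coorid.
Qed.

End Smooth.

(** * Symmetry of second derivatives and the Lie bracket *)

Section Brackets.
Context {R : realType} {d : nat}.
Local Notation V := 'rV[R]_d.
Implicit Types (U : set V) (p q : V -> R) (F G : V -> V) (x v w : V).

(** Two applications of the mean value theorem express a second difference by a second
derivative at a nearby point. *)
Lemma double_difference U p x v w (h : R) : open U -> smooth_fn U p -> 0 < h ->
  (forall s t, 0 <= s <= h -> 0 <= t <= h -> U (x + s *: v + t *: w)) ->
  exists s t, [/\ 0 <= s <= h, 0 <= t <= h &
    p (x + h *: v + h *: w) - p (x + h *: v) - p (x + h *: w) + p x =
    h ^+ 2 * dird (fun y => dird p y v) (x + s *: v + t *: w) w].
Proof.
move=> oU hp h0 hU.
have z0h : 0 <= (0 : R) <= h by rewrite lexx ltW.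
have hh : 0 <= h <= h by rewrite lexx ltW.
have Uv s : 0 <= s <= h -> U (x + s *: v).
  by move=> sh; have := hU s 0 sh z0h; rewrite scale0r addr0.
pose f (s : R) := p ((x + h *: w) + s *: v) - p (x + s *: v).
have Uvw s : 0 <= s <= h -> U (x + h *: w + s *: v).
  by move=> sh; rewrite addrAC; apply: hU.
pose df (s : R) := dird p ((x + h *: w) + s *: v) v - dird p (x + s *: v) v.
have fd (s : R) : 0 <= s <= h -> is_derive s (1 : R) f (df s).
  move=> sh; apply: is_deriveB; apply: is_derive_line.
    exact: smooth_fn_diff hp (Uvw s sh).
  exact: smooth_fn_diff hp (Uv s sh).
have [||s s1 es] := @MVT R f df 0 h h0.
- by move=> s; rewrite in_itv/= => /andP[s0 sh]; apply: fd; rewrite !ltW.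
- apply: derivable_within_continuous => s; rewrite in_itv/= => sab.
  by have [] := fd s sab.
move: s1; rewrite in_itv/= => /andP[s0 sh]; have s0h : 0 <= s <= h by rewrite !ltW.
pose g (t : R) := dird p (x + s *: v + t *: w) v.
have gd (t : R) : 0 <= t <= h ->
    is_derive t (1 : R) g (dird (fun y => dird p y v) (x + s *: v + t *: w) w).
  move=> th; apply: (@is_derive_line R d (fun y => dird p y v)).
  exact: (smooth_fn_diff (smooth_fn_dir v hp) (hU s t s0h th)).
have [||t t1 et] := @MVT R g (fun t => dird (fun y => dird p y v) (x + s *: v + t *: w) w) 0 h h0.
- by move=> t; rewrite in_itv/= => /andP[t0 th]; apply: gd; rewrite !ltW.
- apply: derivable_within_continuous => t; rewrite in_itv/= => tab.
  by have [] := gd t tab.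
move: t1; rewrite in_itv/= => /andP[t0 th]; have t0h : 0 <= t <= h by rewrite !ltW.
exists s, t; split=> //.
have -> : p (x + h *: v + h *: w) - p (x + h *: v) - p (x + h *: w) + p x = f h - f 0.
  by rewrite /f scale0r !addr0 [x + h *: w + _]addrAC; ring.
rewrite es subr0 /df [x + h *: w + _]addrAC.
have -> : dird p (x + s *: v + h *: w) v - dird p (x + s *: v) v = g h - g 0.
  by rewrite /g scale0r addr0.
by rewrite et subr0; ring.
Qed.

Lemma close2 (a b c c' e : R) : c = c' -> `|a - c| <= e / 2 -> `|b - c'| <= e / 2 ->
  `|a - b| <= e.
Proof.
move=> <- h1 h2; rewrite -[a - b](subrKA c) (le_trans (ler_normD _ _))// [leRHS]splitr lerD//.
by rewrite distrC.
Qed.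

(** The second difference is symmetric in v and w; both orders of differentiation are limits of
it. *)
Lemma schwarz U p x v w : open U -> smooth_fn U p -> U x ->
  dird (fun y => dird p y v) x w = dird (fun y => dird p y w) x v.
Proof.
move=> oU hp Ux; apply/eqP; rewrite -subr_eq0 -normr_le0; apply/ler_addgt0Pl => e e0.
rewrite addr0.
have c1 := smooth_fn_cont (smooth_fn_dir w (smooth_fn_dir v hp)) Ux.
have c2 := smooth_fn_cont (smooth_fn_dir v (smooth_fn_dir w hp)) Ux.
have e20 : 0 < e / 2 by rewrite divr_gt0.
move/cvgrPdist_le : c1 => /(_ _ e20) n1.
move/cvgrPdist_le : c2 => /(_ _ e20) n2.
have nU : nbhs x U by apply: open_nbhs_nbhs.
have [r /= r0 hr] := (nbhs_ballP _ _).1 (filterI nU (filterI n1 n2)).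
pose h : R := r / 2 / (`|v| + `|w| + 1).
have D0 : 0 < `|v| + `|w| + 1 by rewrite ltr_wpDl// addr_ge0.
have h0 : 0 < h by rewrite !divr_gt0.
have hD : h * (`|v| + `|w| + 1) = r / 2 by rewrite /h divfK// gt_eqF.
have inb s t : 0 <= s <= h -> 0 <= t <= h -> ball x r (x + s *: v + t *: w).
  move=> /andP[s0 sh] /andP[t0 th]; rewrite -ball_normE /=.
  rewrite -addrA opprD addrA subrr add0r normrN (le_lt_trans (ler_normD _ _))//.
  rewrite !normrZ !ger0_norm//.
  rewrite (@le_lt_trans _ _ (h * (`|v| + `|w| + 1)))//.
    have a1 : s * `|v| <= h * `|v| by rewrite ler_wpM2r.
    have a2 : t * `|w| <= h * `|w| by rewrite ler_wpM2r.
    by move: h0 a1 a2; clearbody h => h0 a1 a2; lra.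
  by rewrite hD ltr_pdivrMr// ltr_pMr// ltrDl.
have [s [t [sh th E1]]] := double_difference oU hp h0
  (fun s t sh th => (hr _ (inb s t sh th)).1).
have [t' [s' [th' sh' E2]]] := @double_difference U p x w v h oU hp h0
  (fun s t sh th => (hr _ (eq_ind _ (ball x r) (inb t s th sh) _ (addrAC _ _ _))).1).
have B1 := (hr _ (inb s t sh th)).2.1.
have B2 := (hr _ (inb s' t' sh' th')).2.2.
rewrite [x + t' *: w + _]addrAC in E2.
have E : dird (fun y => dird p y v) (x + s *: v + t *: w) w =
  dird (fun y => dird p y w) (x + s' *: v + t' *: w) v.
  apply: (mulfI (x := h ^+ 2)); first by rewrite expf_neq0// gt_eqF.
  by rewrite -E1 -E2 [x + h *: w + _]addrAC; ring.
exact: close2 E B1 B2.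
Qed.

(** The bracket fields are smooth, by induction: the coordinates of a Lie bracket are Lie
derivatives of the coordinates of its two arguments. *)
Lemma smooth_fn_eval U f0 f1 b : open U -> smooth_on U f0 -> smooth_on U f1 ->
  smooth_vf U (eval_Br f0 f1 b) /\ forall x, U x -> differentiable (eval_Br f0 f1 b) x.
Proof.
move=> oU h0 h1; elim: b => [||a [sa da] c [sc dc]].
- split=> [j k|x Ux]; first exact: class_C_coor (h0 k) j.
  by have [+ _] := h0 1%N; apply.
- split=> [j k|x Ux]; first exact: class_C_coor (h1 k) j.
  by have [+ _] := h1 1%N; apply.
have sB : smooth_vf U (eval_Br f0 f1 (Brk a c)).
  move=> j; apply: (smooth_fn_ext oU _ (smooth_fnB oU (smooth_fn_lie oU sa (sc j))
    (smooth_fn_lie oU sc (sa j)))).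
  move=> x Ux; rewrite /= /lie_bracket !mxE /lie.
  have [_ ->] := diff_coor j (da x Ux).
  by have [_ ->] := diff_coor j (dc x Ux).
split; first exact: sB.
move=> x Ux; rewrite (_ : eval_Br f0 f1 (Brk a c) =
  \sum_j (fun y => (eval_Br f0 f1 (Brk a c) y 0 j) *: delta_mx 0 j)); last first.
  by apply/funext => y; rewrite fct_sumE -row_sum_delta.
apply: differentiable_sum => j; apply: differentiableZl.
exact: smooth_fn_diff (sB j) Ux.
Qed.

(** The Lie derivative along a Lie bracket is the commutator of the Lie derivatives: the second
derivatives cancel by schwarz. *)
Lemma lie_bracketE U F G p x : open U -> smooth_vf U F -> smooth_vf U G ->
  (forall x, U x -> differentiable F x) -> (forall x, U x -> differentiable G x) ->
  smooth_fn U p -> U x ->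
  lie (lie_bracket F G) p x = lie F (lie G p) x - lie G (lie F p) x.
Proof.
move=> oU sF sG dF dG hp Ux.
pose e k : V := delta_mx 0 k.
have key A B : smooth_vf U A -> smooth_vf U B -> (forall x, U x -> differentiable B x) ->
  lie A (lie B p) x = dird p x ('d B x (A x)) +
  \sum_k \sum_l B x 0 k * A x 0 l * dird (fun y => dird p y (e k)) x (e l).
  move=> sA sB dB; rewrite /lie.
  pose f k : V -> R := (fun y => B y 0 k) * (fun y => dird p y (e k)).
  have eqf y : (\sum_k f k) y = dird p y (B y).
    by rewrite fct_sumE dird_sum_coor.
  have -> : (fun y => dird p y (B y)) = \sum_k f k by apply/funext => y; rewrite eqf.
  have db k : differentiable (fun y => B y 0 k) x := smooth_fn_diff (sB k) Ux.
  have dp k : differentiable (fun y => dird p y (e k)) x :=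
    smooth_fn_diff (smooth_fn_dir _ hp) Ux.
  have dt k : differentiable (f k) x := differentiableM (db k) (dp k).
  rewrite (dird_sum _ dt) [in RHS]dird_sum_coor -big_split; apply: eq_bigr => k _.
  rewrite (dird_M _ (db k) (dp k)) /= addrC; congr (_ + _).
    rewrite dird_sum_coor mulr_sumr; apply: eq_bigr => l _.
    by rewrite mulrA.
  by have [_ ->] := diff_coor k (dB x Ux); exact: mulrC.
rewrite !key// opprD addrACA [X in _ + X](_ : _ = 0) ?addr0; last first.
  rewrite exchange_big/= -sumrB big1// => k _; rewrite -sumrB big1// => l _.
  by rewrite (schwarz (e l) (e k) oU hp Ux) [X in X * _ - _]mulrC subrr.
by rewrite /lie /lie_bracket -dird_B.
Qed.

End Brackets.

(** * Flows of globally Lipschitz fields *)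

Section Picard.
Context {R : realType}.

(** Integrating from -1 makes 0 an interior point, so that the derivative is two-sided on the
whole of [0, 1]. *)
Lemma antiderivative (f : R -> R) : continuous f ->
  exists F : R -> R, F 0 = 0 /\ forall s : R, 0 <= s <= 1 -> is_derive s (1 : R) F (f s).
Proof.
move=> cf; pose F (x : R) : R := (\int[lebesgue_measure]_(t in [set` Interval (BLeft (- 1))
  (BRight x)]) f t)%R.
have fi : (@lebesgue_measure R).-integrable
    [set` Interval (BLeft (- 1)) (BRight 2)] (EFin \o f).
  apply: continuous_compact_integrable; first exact: segment_compact.
  exact: continuous_subspaceT.
have dF (s : R) : 0 <= s <= 1 -> derivable F s 1 /\ derive1 F s = f s.
  move=> /andP[s0 s1]; apply: (continuous_FTC1 (u := 2)) => //.
  - by rewrite (le_lt_trans s1)// ltr1n.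
  - by rewrite /= lte_fin (lt_le_trans _ s0)// oppr_lt0.
  - exact: cf.
exists (F - cst (F 0)); split=> [|s hs]; first by rewrite !fctE /= subrr.
have [d1 d2] := dF s hs.
have h : is_derive s (1 : R) F (f s).
  by apply: DeriveDef; [exact: d1 | rewrite -derive1E; exact: d2].
by rewrite -[f s]subr0; apply: is_deriveB.
Qed.

Lemma mvt_bound (f df : R -> R) (C : R) :
  (forall s : R, 0 <= s <= 1 -> is_derive s (1 : R) f (df s)) ->
  (forall s : R, 0 <= s <= 1 -> `|df s| <= C) ->
  forall s t : R, 0 <= s <= 1 -> 0 <= t <= 1 -> `|f s - f t| <= C * `|s - t|.
Proof.
move=> hf hC s t; wlog st : s t / t < s => [hw hs ht|].
  have [st|st|->] := ltgtP s t; last by rewrite !subrr !normr0 mulr0.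
    by rewrite distrC [`|s - t|]distrC; apply: hw.
  exact: hw.
move=> /andP[s0 s1] /andP[t0 t1].
have sub c : t <= c <= s -> 0 <= c <= 1.
  by move=> /andP[tc cs]; rewrite (le_trans t0)//= (le_trans cs).
have [||c] := @MVT R f df t s st.
- by move=> c; rewrite in_itv/= => /andP[tc cs]; apply/hf/sub; rewrite !ltW.
- apply: derivable_within_continuous => c; rewrite in_itv/= => ct.
  by have [] := hf c (sub _ ct).
rewrite in_itv/= => /andP[tc cs] ->; rewrite normrM ler_wpM2r//.
by apply/hC/sub; rewrite !ltW.
Qed.

(** Estimates that improve by a factor 1/2 at each step hold in the limit. *)
Lemma ler_halves (x a b : R) : (forall k, x <= a + b / 2 ^+ k) -> x <= a.
Proof.
move=> h; apply/ler_addgt0Pl => e e0; rewrite addrC.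
have [b0|b0] := leP b 0.
  by have := h 0%N; rewrite expr0 divr1 => /le_trans; apply; rewrite lerD// (le_trans b0)// ltW.
pose k := (Num.truncn (b / e)).+1.
have kb : b / e < k%:R by rewrite truncnS_gt.
clearbody k; apply: (le_trans (h k)); rewrite lerD2l ler_pdivrMr ?exprn_gt0//.
rewrite mulrC -ler_pdivrMr// (le_trans (ltW kb))// -natrX ler_nat.
exact/ltnW/ltn_expl.
Qed.

(** The intervals of radius 2B / 2^k around u k are nested, and the limit is the supremum of
their left ends. *)
Lemma geometric_cvg (u : nat -> R) (B : R) :
  (forall k, `|u k.+1 - u k| <= B / 2 ^+ k) ->
  exists l, forall k, `|l - u k| <= 2 * B / 2 ^+ k.
Proof.
move=> hu; pose a k := u k - 2 * B / 2 ^+ k; pose b k := u k + 2 * B / 2 ^+ k.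
have e2 k : 2 * B / 2 ^+ k.+1 = B / 2 ^+ k.
  by rewrite exprS invfM; field; rewrite expf_neq0.
have B0 k : 0 <= B / 2 ^+ k by apply: le_trans (hu k).
have e3 k : 2 * B / 2 ^+ k = B / 2 ^+ k + B / 2 ^+ k by rewrite -mulrA mulrDl !mul1r.
have ak k : a k <= a k.+1.
  by have := hu k; rewrite ler_norml /a e2 e3 => /andP[h1 h2]; lra.
have bk k : b k.+1 <= b k.
  by have := hu k; rewrite ler_norml /b e2 e3 => /andP[h1 h2]; lra.
have ham i j : (i <= j)%N -> a i <= a j.
  by move=> ij; rewrite -(subnK ij); elim: (j - i)%N => // m; rewrite addSn => /le_trans; apply.
have hbm i j : (i <= j)%N -> b j <= b i.
  by move=> ij; rewrite -(subnK ij); elim: (j - i)%N => // m; rewrite addSn; apply: le_trans.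
have ab k : a k <= b k by rewrite /a /b e3; have := B0 k; lra.
have aib i j : a i <= b j.
  rewrite (le_trans (ham _ _ (leq_maxl i j)))// (le_trans (ab _))//.
  exact/hbm/leq_maxr.
pose S := [set a k | k in [set: nat]].
have S0 : S !=set0 by exists (a 0), 0%N.
have Sub : has_ubound S by exists (b 0) => _ [k _ <-].
exists (sup S) => k.
have h1 : a k <= sup S by apply: ub_le_sup => //; exists k.
have h2 : sup S <= b k by apply: ge_sup => // _ [i _ <-].
by rewrite ler_norml; move: h1 h2; rewrite /a /b => h1 h2; apply/andP; split; lra.
Qed.

(** Projection of the time line onto [0, 1]; it lets the Picard iterates be globally
Lipschitz curves. *)
Definition tclamp (s : R) : R := Num.max 0 (Num.min 1 s).

Lemma tclamp01 s : 0 <= tclamp s <= 1.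
Proof. by rewrite /tclamp le_max lexx /= ge_max ler01 ge_min lexx. Qed.

Lemma tclamp_id s : 0 <= s <= 1 -> tclamp s = s.
Proof. by move=> /andP[s0 s1]; rewrite /tclamp min_r// max_r. Qed.

Lemma tclamp_lip s t : `|tclamp s - tclamp t| <= `|s - t|.
Proof.
rewrite /tclamp; wlog st : s t / s <= t => [hw|].
  have [/hw//|/ltW/hw] := leP s t; by rewrite distrC [X in _ <= X]distrC.
rewrite distrC [X in _ <= X]distrC [X in _ <= X]ger0_norm ?subr_ge0//.
rewrite !maxEle !minEle ler_norml.
by repeat case: ifPn; rewrite -?ltNge => *; apply/andP; split; lra.
Qed.

Context {d : nat}.
Local Notation V := 'rV[R]_d.
Implicit Types (H : V -> V) (z : R -> V).

Lemma geometric_cvgV (Y : nat -> V) (B : R) : (forall k, `|Y k.+1 - Y k| <= B / 2 ^+ k) ->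
  exists y : V, forall k, `|y - Y k| <= 2 * B / 2 ^+ k.
Proof.
move=> hY; have B0 : 0 <= B.
  by have := le_trans (normr_ge0 _) (hY 0%N); rewrite expr0 divr1.
have hj j : exists l, forall k, `|l - Y k 0 j| <= 2 * B / 2 ^+ k.
  apply: geometric_cvg => k; rewrite (le_trans _ (hY k))//.
  by have := mx_entry_le (Y k.+1 - Y k) 0 j; rewrite !mxE.
exists (\row_j sval (cid (hj j))) => k; apply: mx_norm_le.
  by rewrite divr_ge0 ?mulr_ge0 ?exprn_ge0.
by move=> i j; rewrite ord1 !mxE; case: cid => l /=.
Qed.

Lemma contraction_ball (f : V -> V) (c : R) : 0 <= c ->
  (forall x, `|x| <= c -> `|f x| <= c) ->
  (forall x y, `|x| <= c -> `|y| <= c -> `|f x - f y| <= 2^-1 * `|x - y|) ->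
  exists2 x, `|x| <= c & x = f x.
Proof.
move=> c0 fc fl; pose Y k := iter k f 0.
have Yc k : `|Y k| <= c by elim: k => [|k /fc//]; rewrite /= normr0.
have Ygeo k : `|Y k.+1 - Y k| <= c / 2 ^+ k.
  elim: k => [|k IH]; first by rewrite expr0 divr1 /= subr0 (Yc 1).
  apply: le_trans (fl _ _ (Yc k.+1) (Yc k)) _.
  by rewrite exprS invfM mulrCA ler_wpM2l ?invr_ge0.
have [y hy] := geometric_cvgV Ygeo.
have yc : `|y| <= c.
  apply: (@ler_halves _ _ (2 * c)) => k; rewrite -[y](subrK (Y k)).
  by rewrite (le_trans (ler_normD _ _))// addrC lerD.
exists y => //; apply/eqP; rewrite -subr_eq0 -normr_le0.
apply: (@ler_halves _ _ (2 * (2 * c))) => k; rewrite add0r.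
have -> : y - f y = (y - Y k.+1) + (f (Y k) - f y) by rewrite /= addrA subrK.
have -> : 2 * (2 * c) / 2 ^+ k = 2 * c / 2 ^+ k + 2 * c / 2 ^+ k by ring.
rewrite (le_trans (ler_normD _ _))// lerD//.
  rewrite (le_trans (hy k.+1))// ler_wpM2l ?mulr_ge0// lef_pV2 ?posrE ?exprn_gt0//.
  by rewrite ler_eXn2l// ltr1n.
rewrite (le_trans (fl _ _ (Yc _) yc))// distrC (le_trans _ (hy k))// ler_piMl//.
by rewrite invf_le1// ler1n.
Qed.

(** Integral curves on the unit time interval.  Durations are carried by the fields, which are
multiples of the drift plus controls. *)
Definition flow H (x0 : V) z :=
  z 0 = x0 /\ forall s : R, 0 <= s <= 1 -> forall j,
    is_derive s (1 : R) (fun s => z s 0 j) (H (z s) 0 j).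

Lemma flow_lip H x0 z B : (forall x, `|H x| <= B) -> flow H x0 z ->
  forall s t : R, 0 <= s <= 1 -> 0 <= t <= 1 -> `|z s - z t| <= B * `|s - t|.
Proof.
move=> hB [_ hz] s t hs ht; apply: mx_norm_le.
  by rewrite mulr_ge0// (le_trans (normr_ge0 (H x0))).
move=> i j; rewrite ord1 !mxE.
apply: (mvt_bound (fun s hs => hz s hs j)) => // u hu.
by rewrite (le_trans _ (hB (z u)))// mx_entry_le.
Qed.

(** Each use of the integral equation halves the part of the bound that is not due to the data,
as the field is 1/2-Lipschitz on a unit of time; no Gronwall inequality is needed. *)
Lemma flow_dep H H' x0 x0' z z' B (b c : R) :
  (forall x, `|H x| <= B) -> (forall x, `|H' x| <= B) ->
  (forall x y, `|H x - H y| <= 2^-1 * `|x - y|) ->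
  (forall x, `|H x - H' x| <= c) -> `|x0 - x0'| <= b ->
  flow H x0 z -> flow H' x0' z' ->
  forall s : R, 0 <= s <= 1 -> `|z s - z' s| <= 2 * (b + c).
Proof.
move=> hB hB' hL hc hb fz fz'.
have h00 : 0 <= (0 : R) <= 1 by rewrite lexx ler01.
have B0 : 0 <= B by rewrite (le_trans (normr_ge0 (H x0))).
have b0 : 0 <= b by rewrite (le_trans (normr_ge0 (x0 - x0'))).
have c0 : 0 <= c by rewrite (le_trans (normr_ge0 (H x0 - H' x0))).
pose A := b + 2 * B.
have start s : 0 <= s <= 1 -> `|z s - z' s| <= A.
  move=> hs; have h1 := flow_lip hB fz hs h00; have h2 := flow_lip hB' fz' hs h00.
  case: fz fz' => z0 _ [z0' _]; rewrite z0 in h1; rewrite z0' in h2.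
  have -> : z s - z' s = (z s - x0) - (z' s - x0') + (x0 - x0').
    by apply/rowP => j; rewrite !mxE; ring.
  rewrite (le_trans (ler_normD _ _))// addrC lerD//.
  rewrite (le_trans (ler_normB _ _))// mulrDl !mul1r lerD//.
    rewrite (le_trans h1)// ler_piMr//; case/andP: hs => s0 s1.
    by rewrite subr0 ger0_norm.
  rewrite (le_trans h2)// ler_piMr//; case/andP: hs => s0 s1.
  by rewrite subr0 ger0_norm.
have step D : (forall s : R, 0 <= s <= 1 -> `|z s - z' s| <= D) ->
    forall s : R, 0 <= s <= 1 -> `|z s - z' s| <= b + c + D / 2.
  move=> hD s hs; case: fz fz' => z0 dz [z0' dz'].
  have D0 : 0 <= D by rewrite (le_trans _ (hD _ h00)).
  have cD : 0 <= c + D / 2 by rewrite addr_ge0// divr_ge0.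
  have key j : `|(z s - z' s - (x0 - x0')) 0 j| <= c + D / 2.
    have := @mvt_bound (fun s => z s 0 j - z' s 0 j)
      (fun s => H (z s) 0 j - H' (z' s) 0 j) (c + D / 2)
      (fun s hs => is_deriveB (dz s hs j) (dz' s hs j)) _ s 0 hs h00.
    rewrite subr0 !mxE z0 z0' => /(_ _)/le_trans; apply.
      move=> u hu; have -> : H (z u) 0 j - H' (z' u) 0 j =
         (H (z u) - H (z' u) + (H (z' u) - H' (z' u))) 0 j.
        by rewrite !mxE; ring.
      rewrite (le_trans (mx_entry_le _ _ _))// (le_trans (ler_normD _ _))// addrC lerD//.
      by rewrite (le_trans (hL _ _))// mulrC ler_wpM2r// hD.
    by case/andP: hs => s0 s1; rewrite ler_piMr// ger0_norm.
  have -> : z s - z' s = (x0 - x0') + (z s - z' s - (x0 - x0')) by rewrite [RHS]addrC subrK.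
  rewrite (le_trans (ler_normD _ _))// -[b + c + _]addrA lerD//.
  by apply: mx_norm_le => // i j; rewrite ord1.
have it k s : 0 <= s <= 1 -> `|z s - z' s| <= 2 * (b + c) + A / 2 ^+ k.
  elim: k s => [|k IH] s hs.
    by rewrite expr0 divr1 (le_trans (start s hs))// lerDr mulr_ge0// addr_ge0.
  rewrite (le_trans (step _ IH s hs))// exprSr invfM mulrA.
  by move: (A / 2 ^+ k) => y; lra.
by move=> s hs; apply: (@ler_halves _ _ A) => k; apply: it.
Qed.

Lemma lip_continuous (W : normedModType R) (f : R -> W) (C : R) : 0 <= C ->
  (forall s t, `|f s - f t| <= C * `|s - t|) -> continuous f.
Proof.
move=> C0 hf s; apply/cvgrPdist_le => e e0; near=> t.
rewrite (le_trans (hf _ _))// (@le_trans _ _ ((C + 1) * `|s - t|))//.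
  by rewrite ler_wpM2r// lerDl.
rewrite mulrC -ler_pdivlMr ?ltr_wpDl//; near: t.
have : 0 < e / (C + 1) by rewrite divr_gt0// ltr_wpDl.
by move=> /cvgr_dist_le; apply; exact: cvg_id.
Unshelve. all: by end_near. Qed.

(** Picard iteration: the iterates differ by at most B / 2^k. *)
Lemma flow_exists H x0 B : (forall x, `|H x| <= B) ->
  (forall x y, `|H x - H y| <= 2^-1 * `|x - y|) -> exists z, flow H x0 z.
Proof.
move=> hB hL; have B0 : 0 <= B by rewrite (le_trans (normr_ge0 (H x0))).
have h00 : 0 <= (0 : R) <= 1 by rewrite lexx ler01.
pose lip z := forall s t, `|z s - z t| <= B * `|s - t|.
have Hc z j : lip z -> continuous (fun s => H (z s) 0 j).
  move=> hz; apply: (@lip_continuous _ _ (2^-1 * B)); first by rewrite mulr_ge0// invr_ge0.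
  move=> s t; have -> : H (z s) 0 j - H (z t) 0 j = (H (z s) - H (z t)) 0 j by rewrite !mxE.
  rewrite (le_trans (mx_entry_le _ _ _))// (le_trans (hL _ _))// -mulrA.
  by rewrite ler_wpM2l ?invr_ge0.
pose prim z (F : 'I_d -> R -> R) := forall j, F j 0 = 0 /\ forall s : R, 0 <= s <= 1 ->
  is_derive s (1 : R) (F j) (H (z s) 0 j).
have primE z : exists F, lip z -> prim z F.
  have [hz|nz] := pselect (lip z); last by exists (fun _ _ => 0).
  pose F j := sval (cid (antiderivative (Hc z j hz))).
  by exists F => _ j; rewrite /F; case: cid.
pose P z := sval (cid (primE z)).
have PP z : lip z -> prim z (P z) by rewrite /P; case: cid.
pose next z (s : R) : V := x0 + \row_j P z j (tclamp s).
have Pdiff z z' D : lip z -> lip z' -> (forall s, `|z s - z' s| <= D) ->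
    forall s j, 0 <= s <= 1 -> `|P z j s - P z' j s| <= D / 2.
  move=> lz lz' hD s j hs.
  have [p0 dp] := PP z lz j; have [p0' dp'] := PP z' lz' j.
  have D0 : 0 <= D by rewrite (le_trans _ (hD 0)).
  have := @mvt_bound (fun s => P z j s - P z' j s)
      (fun s => H (z s) 0 j - H (z' s) 0 j) (D / 2)
      (fun s hs => is_deriveB (dp s hs) (dp' s hs)) _ s 0 hs h00.
  rewrite p0 p0' !subr0 => /(_ _)/le_trans; apply.
    move=> u hu; have -> : H (z u) 0 j - H (z' u) 0 j = (H (z u) - H (z' u)) 0 j by rewrite !mxE.
    rewrite (le_trans (mx_entry_le _ _ _))// (le_trans (hL _ _))// mulrC.
    by rewrite ler_wpM2r.
  by case/andP: hs => s0 s1; rewrite ler_piMr// ?divr_ge0// ger0_norm.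
have nlip z : lip z -> lip (next z).
  move=> lz s t; rewrite /next opprD addrACA subrr add0r.
  apply: mx_norm_le; first by rewrite mulr_ge0.
  move=> i j; rewrite !mxE; have [p0 dp] := PP z lz j.
  rewrite (@le_trans _ _ (B * `|tclamp s - tclamp t|))//; last first.
    by rewrite ler_wpM2l// tclamp_lip.
  apply: (mvt_bound dp); try exact: tclamp01.
  by move=> u _; rewrite (le_trans (mx_entry_le _ _ _)).
pose Y k := iter k next (fun=> x0).
have Ylip k : lip (Y k).
  elim: k => [|k IH]; last exact: nlip.
  by move=> s t; rewrite /Y/= subrr normr0 mulr_ge0.
have nextdiff z z' D : lip z -> lip z' -> (forall s, `|z s - z' s| <= D) ->
    forall s, `|next z s - next z' s| <= D / 2.
  move=> lz lz' hD s; have D0 : 0 <= D by rewrite (le_trans _ (hD 0)).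
  rewrite /next opprD addrACA subrr add0r.
  apply: mx_norm_le; first by rewrite divr_ge0.
  by move=> i j; rewrite !mxE; apply: Pdiff => //; exact: tclamp01.
have Ygeo k s : `|Y k.+1 s - Y k s| <= B / 2 ^+ k.
  elim: k s => [|k IH] s.
    rewrite expr0 divr1 /Y/= /next addrAC subrr add0r.
    apply: mx_norm_le => // i j; rewrite !mxE.
    have [p0 dp] := PP _ (Ylip 0) j.
    have := @mvt_bound _ _ B dp _ (tclamp s) 0 (tclamp01 s) h00.
    rewrite p0 !subr0 => /(_ _)/le_trans; apply.
      by move=> u _; rewrite (le_trans (mx_entry_le _ _ _)).
    have /andP[s0 s1] := tclamp01 s.
    by rewrite ler_piMr// ger0_norm.
  by rewrite exprSr invfM mulrA; exact: (nextdiff _ _ _ (Ylip k.+1) (Ylip k) IH).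
have lims s := geometric_cvgV (fun k => Ygeo k s).
pose z s := sval (cid (lims s)).
have zY s k : `|z s - Y k s| <= 2 * B / 2 ^+ k by rewrite /z; case: cid.
have zlip : lip z.
  move=> s t; apply: (@ler_halves _ _ (2 * (2 * B))) => k.
  have -> : z s - z t = (Y k s - Y k t) + ((z s - Y k s) - (z t - Y k t)).
    by apply/rowP => j; rewrite !mxE; ring.
  rewrite (le_trans (ler_normD _ _))// lerD//; first exact: Ylip.
  rewrite (le_trans (ler_normB _ _))// -mulrA mulrDl !mul1r lerD//.
have zfix s : z s = next z s.
  apply/eqP; rewrite -subr_eq0 -normr_le0.
  apply: (@ler_halves _ _ (2 * (2 * B))) => k; rewrite add0r.
  have -> : z s - next z s = (z s - Y k.+1 s) + (next (Y k) s - next z s).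
    by rewrite /Y/= addrA subrK.
  have h1 := zY s k.+1.
  have h2 : `|next (Y k) s - next z s| <= 2 * B / 2 ^+ k / 2.
    by apply: nextdiff => // t; rewrite distrC.
  rewrite (le_trans (ler_normD _ _))// (le_trans (lerD h1 h2))//.
  have : 0 <= B / 2 ^+ k by rewrite divr_ge0 ?exprn_ge0.
  by rewrite exprSr invfM !mulrA -!(mulrC 2^-1) => h; move: h; rewrite -!mulrA;
    move: (B * _) => y; lra.
have zE s : 0 <= s <= 1 -> x0 + \row_j P z j s = z s.
  by move=> hs; rewrite [RHS]zfix /next tclamp_id.
exists (fun s => x0 + \row_j P z j s); split.
  by apply/rowP => j; rewrite !mxE; have [-> _] := PP z zlip j; rewrite addr0.
move=> s hs j; have [_ dp] := PP z zlip j; rewrite zE//.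
have -> : (fun s : R => (x0 + \row_j P z j s) 0 j) = cst (x0 0 j) + P z j.
  by apply/funext => t; rewrite !mxE.
rewrite -[H (z s) 0 j]add0r; apply: is_deriveD; exact: dp.
Qed.

End Picard.

(** * Left concatenation on words *)

Section Words.
Context {R : realType} (K : nat).
Hypothesis K_gt0 : (0 < K)%N.

Definition word : finType := K.-bseq bool.
Definition nwords : nat := #|word|.
Definition word_of (i : 'I_nwords) : seq bool := enum_val i : word.
Definition word_size (i : 'I_nwords) : nat := size (word_of i).
(** The matrix of s |-> c :: s on words of length at most K; longer words are dropped. *)
Definition shift_mx (c : bool) : 'M[R]_nwords := \matrix_(i, j) (word_of i == c :: word_of j)%:R.

Lemma word_size_le i : (word_size i <= K)%N.
Proof. by rewrite /word_size /word_of; apply: size_bseq. Qed.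

Lemma word_of_inj : injective word_of.
Proof. by move=> i j h; apply: enum_val_inj; apply: val_inj. Qed.

Lemma word_of_surj (s : seq bool) : (size s <= K)%N -> exists i, word_of i = s.
Proof.
by move=> sK; exists (enum_rank (Bseq sK : word)); rewrite /word_of enum_rankK.
Qed.

Lemma shift_mx_homog c : homog word_size 1 (shift_mx c).
Proof.
apply/homogP => i j ij; rewrite mxE; case: eqP => // e.
by move: ij; rewrite /word_size e /= addn1 eqxx.
Qed.

Lemma shift_mx_entry : exists r1 r0 : 'I_nwords, [/\ word_size r1 = (word_size r0).+1,
  shift_mx false r1 r0 = 1 & shift_mx true r1 r0 = 0].
Proof.
have [r0 h0] := @word_of_surj [::] (leq0n _); have [r1 h1] := @word_of_surj [:: false] K_gt0.
by exists r1, r0; rewrite /word_size !mxE h0 h1.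
Qed.

End Words.

(** * Iterated Lie derivatives of the coordinates *)

Section Gamma.
Context {R : realType} {d : nat} (K : nat).
Local Notation V := 'rV[R]_d.
Variables (U : set V) (f0 f1 : V -> V).
Hypotheses (oU : open U) (sf0 : smooth_on U f0) (sf1 : smooth_on U f1).
Local Notation field := (eval_Br f0 f1).
Local Notation n := (nwords K).
Local Notation X := (bracket_mx (shift_mx K false : 'M[R]_n) (shift_mx K true)).

(** The iterated Lie derivative of a coordinate along a word; its first letter is the field
that is applied last. *)
Definition iter_lie (s : seq bool) (j : 'I_d) : V -> R :=
  foldr (fun c p => lie (if c then f1 else f0) p) (coor j) s.

Definition taylor_mx (x : V) : 'M[R]_(d, n) := \matrix_(j, i) iter_lie (word_of i) j x.

Let sf b : smooth_vf U (field b). Proof. by have [] := smooth_fn_eval b oU sf0 sf1. Qed.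
Let df b x : U x -> differentiable (field b) x.
Proof. by have [_] := smooth_fn_eval b oU sf0 sf1; apply. Qed.

Lemma smooth_fn_iter_lie s j : smooth_fn U (iter_lie s j).
Proof.
elim: s => [|c s IH]; first exact: smooth_fn_coor.
by apply: (smooth_fn_lie oU) => //; case: c; [exact: (sf X1) | exact: (sf X0)].
Qed.

(** A Lie derivative only depends on the function near the point. *)
Lemma lie_ext F p q x : U x -> smooth_fn U p -> (forall y, U y -> p y = q y) ->
  lie F q x = lie F p x.
Proof. by move=> Ux hp pq; apply: dird_near (open_near oU Ux pq) (smooth_fn_diff hp Ux). Qed.

Lemma lie_lin F m (c : 'I_m -> R) (p : 'I_m -> V -> R) x : U x -> (forall k, smooth_fn U (p k)) ->
  lie F (fun y => \sum_k c k * p k y) x = \sum_k c k * lie F (p k) x.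
Proof.
move=> Ux hp.
have dc k : differentiable (fun y : V => c k * p k y) x.
  exact: (differentiableM (differentiable_cst _ _) (smooth_fn_diff (hp k) Ux)).
have -> : (fun y => \sum_k c k * p k y) = \sum_k (fun y => c k * p k y).
  by apply/funext => y; rewrite fct_sumE.
rewrite /lie (dird_sum _ dc); apply: eq_bigr => k _.
by rewrite dird_Z//; apply: smooth_fn_diff.
Qed.

Lemma taylor_mx_letter (c : bool) x j i : (taylor_mx x *m shift_mx K c) j i =
  if (word_size i < K)%N then lie (if c then f1 else f0) (iter_lie (word_of i) j) x else 0.
Proof.
rewrite mxE; case: ifPn => [iK|]; last first.
  rewrite -leqNgt => Ki; rewrite big1// => k _; rewrite !mxE.
  case: eqP => [e|]; last by rewrite mulr0.
  by have := word_size_le k; rewrite /word_size e /= ltnNge Ki.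
have [k0 h0] := @word_of_surj K (c :: word_of i) iK.
rewrite (bigD1 k0)//= !mxE h0 eqxx mulr1 big1 ?addr0// => k kk0.
rewrite !mxE; case: eqP => [e|]; last by rewrite mulr0.
by case/eqP: kk0; apply: word_of_inj; rewrite e h0.
Qed.

(** Right multiplication of the matrix of iterated derivatives by the matrix of a bracket is
the Lie derivative along the corresponding field, as long as the words stay within length
K.  For a bracket this is lie_bracketE, the two sides being commutators. *)
Lemma taylor_mx_bracket_mx b x j i : U x -> (taylor_mx x *m X b) j i =
  if (Br_length b + word_size i <= K)%N then lie (field b) (iter_lie (word_of i) j) x else 0.
Proof.
elim: b x i => [||a IHa c IHc] x i Ux.
- by rewrite [bracket_mx _ _ _]/= taylor_mx_letter.
- by rewrite [bracket_mx _ _ _]/= taylor_mx_letter.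
have hom b : homog (@word_size K) (Br_length b) (X b) :=
  bracket_mx_homog (shift_mx_homog _ _) (shift_mx_homog _ _) b.
have key b b' : (forall x i, U x -> (taylor_mx x *m X b) j i =
    if (Br_length b + word_size i <= K)%N then lie (field b) (iter_lie (word_of i) j) x else 0) ->
  (forall x i, U x -> (taylor_mx x *m X b') j i =
    if (Br_length b' + word_size i <= K)%N then lie (field b') (iter_lie (word_of i) j) x else
      0) ->
  (taylor_mx x *m (X b *m X b')) j i =
    if (Br_length b + Br_length b' + word_size i <= K)%N then
      lie (field b) (lie (field b') (iter_lie (word_of i) j)) x else 0.
  move=> hb hb'; rewrite mulmxA mxE; case: ifPn => [le|].
    have -> : lie (field b) (lie (field b') (iter_lie (word_of i) j)) x =
       lie (field b) (fun y => \sum_k X b' k i * iter_lie (word_of k) j y) x.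
      apply: lie_ext => //; first by move=> m; apply: Ck_sum => // k; apply: CkM => //;
        [exact: Ck_cst | exact: smooth_fn_iter_lie].
      move=> y Uy; have := hb' y i Uy; rewrite ifT; last by lia.
      by move=> <-; rewrite mxE; apply: eq_bigr => k _; rewrite mxE mulrC.
    rewrite lie_lin//; last by move=> k; apply: smooth_fn_iter_lie.
    apply: eq_bigr => k _; rewrite mulrC.
    have [e|ne] := eqVneq (word_size k) (word_size i + Br_length b')%N; last first.
      by have /homogP -> := hom b'; rewrite ?mul0r.
    by rewrite hb// ifT// e; lia.
  rewrite -ltnNge => lt; apply: big1 => k _.
  have [e|ne] := eqVneq (word_size k) (word_size i + Br_length b')%N; last first.
    by have /homogP -> := hom b'; rewrite ?mulr0.
  by rewrite hb// ifF ?mul0r// e; apply/negbTE; rewrite -ltnNge; lia.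
rewrite [bracket_mx _ _ _]/= /commut.
have -> : (taylor_mx x *m (X a * X c - X c * X a)) j i =
  (taylor_mx x *m (X a *m X c)) j i - (taylor_mx x *m (X c *m X a)) j i.
  by rewrite mulmxBr !mxE.
rewrite !key// [(Br_length c + _)%N]addnC /=; case: ifP => _; last by rewrite subrr.
rewrite (@lie_bracketE _ _ U)//; [exact: df|exact: df|exact: smooth_fn_iter_lie].
Qed.

(** On the empty word the iterated derivative is a coordinate, so that the bracket matrices
give back the bracket fields. *)
Lemma taylor_mx_bracket_mx_nil b x j i : U x -> word_of i = [::] -> (Br_length b <= K)%N ->
  (taylor_mx x *m X b) j i = field b x 0 j.
Proof.
move=> Ux wi bK; rewrite taylor_mx_bracket_mx// wi /word_size wi addn0 bK /=.
by rewrite /lie dird_coorid.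
Qed.

End Gamma.

(** * Local bounds and truncation of the fields *)

Section LocalBounds.
Context {R : realType} {d : nat}.
Local Notation V := 'rV[R]_d.
Implicit Types (U : set V) (p : V -> R) (x y : V) (r M : R).

Definition tame U p r M := forall x y, `|x| <= r -> `|y| <= r ->
  [/\ U x, `|p x| <= M & `|p x - p y| <= M * `|x - y|].

Lemma tame_le U p r M r' M' : r' <= r -> M <= M' -> tame U p r M -> tame U p r' M'.
Proof.
move=> rr MM h x y xr yr; have [||h1 h2 h3] := h x y; rewrite ?(le_trans _ rr)//.
split=> //; first exact: le_trans MM.
by rewrite (le_trans h3)// ler_wpM2r.
Qed.

(** The partial derivatives are bounded near 0, and the mean value theorem on segments does the
rest. *)
Lemma tame_exists U p : open U -> U 0 -> smooth_fn U p -> exists r M, [/\ 0 < r, 0 <= M &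
  tame U p r M].
Proof.
move=> oU U0 hp.
have nb (q : V -> R) : smooth_fn U q -> \forall x \near (0 : V), `|q x| <= `|q 0| + 1.
  move=> hq; have /cvgrPdist_le/(_ 1 ltr01) := smooth_fn_cont hq U0.
  apply: filterS => x h; rewrite -[q x](subrK (q 0)) (le_trans (ler_normD _ _))//.
  by rewrite addrC lerD2l distrC.
have nU : nbhs (0 : V) U by apply: open_nbhs_nbhs.
pose e k : V := delta_mx 0 k.
have nd : \forall x \near (0 : V), forall k, `|dird p x (e k)| <= `|dird p 0 (e k)| + 1.
  have FF : Filter (nbhs (0 : V)) by exact: nbhs_filter.
  apply: (@filter_forall V 'I_d (fun k => [set x | `|dird p x (e k)| <= `|dird p 0 (e k)| +
    1]) _ FF).
  by move=> k; exact: (nb _ (smooth_fn_dir (e k) hp)).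
have [r0 /= r00 hr] := (nbhs_ballP _ _).1 (filterI nU (filterI (nb p hp) nd)).
have in_ball x : `|x| <= r0 / 2 -> ball (0 : V) r0 x.
  move=> xr; rewrite -ball_normE /= sub0r normrN (le_lt_trans xr)//.
  by rewrite ltr_pdivrMr// ltr_pMr// ltrDl.
pose D := \sum_k (`|dird p 0 (e k)| + 1).
have D0 : 0 <= D by apply: sumr_ge0 => k _; rewrite addr_ge0.
exists (r0 / 2), (`|p 0| + 1 + D); split; rewrite ?divr_gt0 ?addr_ge0// => x y xr yr.
have [Ux [px _]] := hr _ (in_ball x xr).
split=> //; first by rewrite (le_trans px)// lerDl.
rewrite (@le_trans _ _ (D * `|x - y|))//; last by rewrite ler_wpM2r// lerDr addr_ge0.
have seg (s : R) : 0 <= s <= 1 -> `|y + s *: (x - y)| <= r0 / 2.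
  move=> /andP[s0 s1]; have -> : y + s *: (x - y) = (1 - s) *: y + s *: x.
    by apply/rowP => j; rewrite !mxE; ring.
  have t0 : 0 <= 1 - s by rewrite subr_ge0.
  rewrite (le_trans (ler_normD _ _))// !normrZ (ger0_norm s0) (ger0_norm t0).
  rewrite (@le_trans _ _ ((1 - s) * (r0 / 2) + s * (r0 / 2)))//.
    by rewrite lerD// ler_wpM2l.
  by rewrite -mulrDl subrK mul1r.
have := @mvt_bound _ (fun s => p (y + s *: (x - y))) (fun s => dird p (y + s *: (x - y)) (x - y))
  (D * `|x - y|) _ _ 1 0 _ _.
rewrite scale1r scale0r addr0 subr0 normr1 mulr1 [y + _]addrC subrK; apply.
- move=> s hs; apply: is_derive_line; apply: (smooth_fn_diff hp).
  by have [+ _] := hr _ (in_ball _ (seg s hs)).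
- move=> s hs; have [_ [_ hd]] := hr _ (in_ball _ (seg s hs)).
  rewrite dird_sum_coor (le_trans (ler_norm_sum _ _ _))// mulr_suml ler_sum// => k _.
  by rewrite normrM mulrC ler_pM// mx_entry_le.
- by rewrite ler01 lexx.
- by rewrite lexx ler01.
Qed.

Lemma tame_fin (I : finType) U (p : I -> V -> R) : open U -> U 0 ->
  (forall i, smooth_fn U (p i)) ->
  exists r M, [/\ 0 < r, 0 <= M & forall i, tame U (p i) r M].
Proof.
move=> oU U0 hp.
suff [r [M [r0 M0 h]]] : exists r M, [/\ 0 < r, 0 <= M & forall i, i \in enum I ->
  tame U (p i) r M].
  by exists r, M; split=> // i; apply: h; rewrite mem_enum.
elim: (enum I) => [|i l [r [M [r0 M0 IH]]]]; first by exists 1, 0.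
have [r' [M' [r'0 M'0 h]]] := tame_exists oU U0 (hp i).
exists (Num.min r r'), (M + M'); split; rewrite ?lt_min ?r0 ?addr_ge0// => j.
rewrite inE => /predU1P[->|/IH hj].
  by apply: (tame_le _ _ h); [rewrite ge_min lexx orbT | rewrite lerDr].
by apply: (tame_le _ _ hj); [rewrite ge_min lexx | rewrite lerDl].
Qed.

(** The retraction onto a ball of the sup norm is 1-Lipschitz; composed with it, fields that
are tame on the ball become globally bounded and Lipschitz. *)
Definition clampV r (x : V) : V := \row_j Num.max (- r) (Num.min r (x 0 j)).

Lemma clampV_le r x : 0 <= r -> `|clampV r x| <= r.
Proof.
move=> r0; apply: mx_norm_le => // i j; rewrite mxE ler_norml le_max lexx /=.
by rewrite ge_max ge_min lexx /= ge0_cp.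
Qed.

Lemma clampV_id r x : `|x| <= r -> clampV r x = x.
Proof.
move=> xr; apply/rowP => j; rewrite mxE.
have : `|x 0 j| <= r by rewrite (le_trans (mx_entry_le _ _ _)).
by rewrite ler_norml => /andP[h1 h2]; rewrite min_r// max_r.
Qed.

Lemma clampV_lip r x y : `|clampV r x - clampV r y| <= `|x - y|.
Proof.
apply: mx_norm_le => // i j; rewrite !mxE.
have := mx_entry_le (x - y) 0 j; rewrite !mxE; apply: le_trans.
move: (x 0 j) (y 0 j) => a b; wlog ab : a b / b <= a => [hw|].
  have [/hw//|/ltW/hw] := leP b a; by rewrite distrC [X in _ <= X]distrC.
rewrite [X in _ <= X]ger0_norm ?subr_ge0// !maxEle !minEle ler_norml.
by repeat case: ifPn; rewrite -?ltNge => *; apply/andP; split; lra.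
Qed.

End LocalBounds.

(** * Estimates along one letter *)

Section ExpmDerive.
Context {R : realType} {n : nat} (dg : 'I_n -> nat) (K : nat).
Hypothesis dgK : forall i, (dg i <= K)%N.

Lemma is_derive_expm (M : 'M[R]_n) (s : R) i j : low dg 1 M ->
  is_derive s (1 : R) (fun t => expm K (t *: M) i j) ((M * expm K (s *: M)) i j).
Proof.
move=> lM; pose c k : R := (k`!%:R)^-1 * (M ^+ k) i j.
have e : (fun t => expm K (t *: M) i j) = \sum_(k < K.+1) (fun t : R => c k * t ^+ k).
  apply/funext => t; rewrite expmE summxE fct_sumE; apply: eq_bigr => k _.
  by rewrite scaleMX !scalemxE /c; ring.
rewrite e; have -> : (M * expm K (s *: M)) i j = \sum_(k < K.+1) (c k * (k%:R * s ^+ k.-1)).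
  rewrite expmE mulr_sumr summxE big_ord_recr/= [RHS]big_ord_recl/= !mul0r mulr0 add0r.
  rewrite [X in _ + X](_ : _ = 0) ?addr0; last first.
    rewrite scaleMr scaleMX scaleMr -exprS.
    by rewrite (low_big dgK (ltnSn K) (lowX K.+1 lM)) !scaler0 mxE.
  apply: eq_bigr => k _; rewrite /bump/= add1n scaleMr scaleMX scaleMr -exprS !scalemxE /c.
  by rewrite factS natrM; field; rewrite !(pnatr_eq0, nat1r) -lt0n fact_gt0.
apply: is_derive_sum => k.
have -> : (fun t : R => c k * t ^+ k) = c k *: ((fun t : R => t) ^+ k).
  by apply/funext => t; rewrite fctE.
rewrite -[c k * _]/(c k *: _); apply: is_deriveZ.
by apply: is_derive_eq; rewrite scaler1.
Qed.

End ExpmDerive.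

Section TimeParameter.
Context {R : realType}.
Implicit Types (X : lipdom R).

Definition timedom X : lipdom R := @LipDom R (X * R)%type
  (fun h => ldom h.1 /\ 0 <= h.2 <= 1)
  (fun h h' => lrel h.1 h'.1 /\ h.2 = h'.2 /\ 0 <= h.2 <= 1)
  (fun h h' => ldst h.1 h'.1)
  (fun h h' H => let: conj r (conj e s) := H in
     conj (conj (lrel_ldom r).1 s) (conj (lrel_ldom r).2 (eq_ind _ (fun u => 0 <= u <= 1) s _ e)))
  (fun h h' => ldst_ge0 _ _).

Lemma BL_fst X (W : normedModType R) (f : X -> W) : BL f ->
  BL (X := timedom X) (fun h => f h.1).
Proof.
apply: (@BL_comp _ (timedom X) X W fst f 1) => // [h []//|h h' [hr _]].
by split=> //; rewrite mul1r.
Qed.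

Lemma BL_at X (W : normedModType R) (g : timedom X -> W) (s : R) : 0 <= s <= 1 -> BL g ->
  BL (fun h : X => g (h, s)).
Proof.
move=> hs; apply: (@BL_comp _ X (timedom X) W (fun h => (h, s)) g 1) => // h h' hr.
by split=> //; rewrite mul1r.
Qed.

Lemma BL_snd X : BL (X := timedom X) (fun h => h.2 : R).
Proof.
exists 1 => //; split=> [[h s] [_ /andP[s0 s1]]|[h s] [h' s'] [_ [/= -> _]]].
  by rewrite /= ger0_norm.
by rewrite subrr normr0 mul1r ldst_ge0.
Qed.

(** The mean value theorem, applied to a curve and to the difference of two curves: a bounded
Lipschitz derivative, up to the weight w, gives a bounded Lipschitz increment. *)
Lemma BL_increment X (a : X -> R -> R) (g : timedom X -> R) (w : X -> R) :
  (forall h, ldom h -> 0 < w h) -> (forall h h', lrel h h' -> w h = w h') ->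
  (forall h, ldom h -> forall s : R, 0 <= s <= 1 -> is_derive s (1 : R) (a h) (w h * g (h, s))) ->
  BL g -> BL (fun h => (w h)^-1 * (a h 1 - a h 0)).
Proof.
move=> w0 wr ha [C C0 [h1 h2]].
have h00 : 0 <= (0 : R) <= 1 by rewrite lexx ler01.
have h11 : 0 <= (1 : R) <= 1 by rewrite lexx ler01.
exists C => //; split=> [h hd|h h' hr].
  have := @mvt_bound _ (a h) (fun s => w h * g (h, s)) (w h * C) (ha h hd) _ 1 0 h11 h00.
  rewrite subr0 normr1 mulr1 normrM normfV (gtr0_norm (w0 h hd)) ler_pdivrMl ?w0//; apply.
  by move=> s hs; rewrite normrM (gtr0_norm (w0 h hd)) ler_wpM2l ?(ltW (w0 h hd))// h1.
have [hd hd'] := lrel_ldom hr.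
have D (s : R) : 0 <= s <= 1 -> is_derive s (1 :
  R) (a h - a h') (w h * g (h, s) - w h * g (h', s)).
  by move=> hs; rewrite {2}(wr _ _ hr); apply: is_deriveB; apply: ha.
have := @mvt_bound _ (a h - a h') (fun s => w h * g (h, s) - w h * g (h', s))
  (w h * (C * ldst h h')) D _ 1 0 h11 h00.
rewrite -(wr _ _ hr) -mulrBr normrM normfV (gtr0_norm (w0 h hd)) ler_pdivrMl ?w0//.
rewrite subr0 normr1 mulr1 !fctE.
have -> : a h 1 - a h 0 - (a h' 1 - a h' 0) = a h 1 - a h' 1 - (a h 0 - a h' 0) by ring.
apply=> s hs; rewrite -mulrBr normrM (gtr0_norm (w0 h hd)) ler_wpM2l ?(ltW (w0 h hd))//.
exact: (h2 (h, s) (h', s)).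
Qed.

Lemma BL_tame X d (U : set 'rV[R]_d) p r M (z : X -> 'rV[R]_d) : 0 <= M -> tame U p r M ->
  (forall h, ldom h -> `|z h| <= r) -> BL z -> BL (fun h => p (z h)).
Proof.
move=> M0 tp zr [C C0 [h1 h2]]; exists (M + M * C); first by rewrite addr_ge0// mulr_ge0.
split=> [h hd|h h' hr].
  by have [_ hp _] := tp _ _ (zr _ hd) (zr _ hd); rewrite (le_trans hp)// lerDl mulr_ge0.
have [hd hd'] := lrel_ldom hr; have [_ _ hp] := tp _ _ (zr _ hd) (zr _ hd').
rewrite (le_trans hp)// mulrDl -mulrA -[leLHS]add0r lerD ?mulr_ge0 ?ldst_ge0//.
by rewrite ler_wpM2l// h2.
Qed.

End TimeParameter.

Section LetterDerivative.
Context {R : realType} {d N : nat} (K : nat).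
Local Notation V := 'rV[R]_d.
Variables (U : set V) (f0 f1 : V -> V).
Hypotheses (oU : open U) (sf0 : smooth_on U f0) (sf1 : smooth_on U f1).
Local Notation field := (eval_Br f0 f1).
Local Notation n := (nwords K).
Local Notation x0 := (shift_mx K false : 'M[R]_n).
Local Notation x1 := (shift_mx K true : 'M[R]_n).
Local Notation len i := (Br_length (bracket i)).
Local Notation letter_mx := (letter_mx x0 x1).
Local Notation letter := (@letter R N).
Implicit Types (th : letter) (x : V) (e : R).

Definition letter_field th x : V := \sum_(i < N.+1) th 0 i *: field (bracket i) x.

(** The matrix of iterated derivatives in coordinates rescaled by e: the column of a word of
length l is multiplied by e^l. *)
Definition scaled_taylor e x : 'M[R]_(d, n) :=
  \matrix_(j, i) (e ^+ word_size i * iter_lie f0 f1 (word_of i) j x).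

(** What the derivative of scaled_taylor along a letter contains beyond degree K, divided by
e^(K+1). *)
Definition step_defect e th x : 'M[R]_(d, n) := \matrix_(j, w) \sum_(i < N.+1)
  if (len i + word_size w <= K)%N then 0
  else th 0 i * e ^+ (len i + word_size w - K.+1) * lie (field (bracket i)) (iter_lie f0 f1
    (word_of w) j) x.

Let homX b : homog (@word_size K) (Br_length b) (bracket_mx x0 x1 b) :=
  bracket_mx_homog (shift_mx_homog _ _) (shift_mx_homog _ _) b.

Lemma scaled_taylor_bracket_mx e b x j w : U x -> (scaled_taylor e x *m bracket_mx x0 x1 b) j w =
  e ^+ (Br_length b + word_size w) * (taylor_mx K f0 f1 x *m bracket_mx x0 x1 b) j w.
Proof.
move=> Ux; rewrite !mxE mulr_sumr; apply: eq_bigr => u _; rewrite !mxE.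
have [->|ne] := eqVneq (word_size u) (word_size w + Br_length b)%N; last first.
  by have /homogP -> := homX b; rewrite ?mulr0.
by rewrite addnC mulrA.
Qed.

Lemma scaled_taylor_letter_mx e th x j w : U x ->
  (scaled_taylor e x *m letter_mx th) j w = \sum_(i < N.+1)
  if (len i + word_size w <= K)%N then
    th 0 i * e ^+ (len i + word_size w) * lie (field (bracket i)) (iter_lie f0 f1 (word_of w) j) x
  else 0.
Proof.
move=> Ux; rewrite /letter_mx mulmx_sumr summxE; apply: eq_bigr => i _.
rewrite -scalemxAr scalemxE scaled_taylor_bracket_mx// (taylor_mx_bracket_mx oU sf0 sf1
  (bracket i) j w Ux).
by case: ifP => _; rewrite ?mulr0// mulrA.
Qed.

Lemma lie_letter_field th p x : lie (letter_field th) p x = \sum_(i < N.+1) th 0 i * lie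
  (field (bracket i)) p x.
Proof.
rewrite /lie dird_sum_coor /letter_field.
under eq_bigr => k _ do rewrite summxE mulr_suml.
rewrite exchange_big/=; apply: eq_bigr => i _; rewrite [in RHS]dird_sum_coor mulr_sumr.
by apply: eq_bigr => k _; rewrite mxE mulrA.
Qed.

(** The derivative along the dilated letter is the product with the letter matrix, except for
the terms that leave the words of length at most K; those carry at least e^(K+1). *)
Lemma scaled_taylor_lie e th x j w : U x -> e ^+ word_size w * lie (letter_field
  (dilate_letter e th)) (iter_lie f0 f1 (word_of w) j) x =
  (scaled_taylor e x *m letter_mx th + e ^+ K.+1 *: step_defect e th x) j w.
Proof.
move=> Ux; rewrite addmxE scalemxE scaled_taylor_letter_mx// mxE lie_letter_field !mulr_sumr
  -big_split/=.
apply: eq_bigr => i _; rewrite mxE; case: ifPn => [h|h].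
  by rewrite mulr0 addr0 exprD; ring.
rewrite add0r -[in LHS](addnK (word_size w) (len i)) -addnBA// subnn addn0.
have e1 : (len i + word_size w = K.+1 + (len i + word_size w - K.+1))%N by rewrite subnKC//
  ltnNge.
have : e ^+ (len i) * e ^+ word_size w = e ^+ K.+1 * e ^+ (len i + word_size w - K.+1).
  by rewrite -!exprD -e1.
move: (lie _ _ _) (e ^+ K.+1) (e ^+ (_ - _)) (e ^+ word_size w) (e ^+ len i) (th 0 i) => a b c
  f g t ee.
by rewrite mulrA [f * _]mulrA mulrA [f * g]mulrC ee; ring.
Qed.

Lemma scaled_taylor_derive e th x z (s : R) j w :
  flow (letter_field (dilate_letter e th)) x z -> 0 <= s <= 1 -> U (z s) ->
  is_derive s (1 : R) (fun s => scaled_taylor e (z s) j w)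
    ((scaled_taylor e (z s) *m letter_mx th + e ^+ K.+1 *: step_defect e th (z s)) j w).
Proof.
move=> [_ fz] hs Us; rewrite -scaled_taylor_lie//.
have -> : (fun s => scaled_taylor e (z s) j w) = e ^+ word_size w *: (fun s => iter_lie f0 f1
  (word_of w) j (z s)).
  by apply/funext => t; rewrite !mxE.
apply: is_deriveZ; apply: is_derive_chain;
  first exact: smooth_fn_diff (smooth_fn_iter_lie oU sf0 sf1 _ _) Us.
exact: fz.
Qed.

(** Multiplying by the inverse exponential removes the main term of the derivative (variation
of constants). *)
Lemma scaled_taylor_expm_derive e th x z (s : R) j w :
  flow (letter_field (dilate_letter e th)) x z -> 0 <= s <= 1 ->
  U (z s) ->
  is_derive s (1 : R) (fun s => (scaled_taylor e (z s) *m expm K (s *: - letter_mx th)) j w)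
    (e ^+ K.+1 * (step_defect e th (z s) *m expm K (s *: - letter_mx th)) j w).
Proof.
move=> fz hs Us; set F := letter_mx th; pose E t := expm K (t *: - F).
have lF : low (@word_size K) 1 (- F) by apply/lowN/letter_mx_low; exact: shift_mx_homog.
have -> : (fun s => (scaled_taylor e (z s) *m expm K (s *: - F)) j w) =
    \sum_u ((fun s => scaled_taylor e (z s) j u) * (fun s => E s u w)).
  by apply/funext => t; rewrite fct_sumE mxE.
have -> : e ^+ K.+1 * (step_defect e th (z s) *m expm K (s *: - F)) j w = \sum_u
   (scaled_taylor e (z s) j u *: (- F * E s) u w +
    E s u w *: (scaled_taylor e (z s) *m F + e ^+ K.+1 *: step_defect e th (z s)) j u).
  rewrite big_split/= -[X in X + _]/(\sum_u scaled_taylor e (z s) j u * (- F *m E s) u w).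
  under [X in _ + X]eq_bigr => u _ do rewrite /GRing.scale/= mulrC.
  have mulE (P : 'M[R]_(d, n)) (Q : 'M[R]_n) : \sum_u P j u * Q u w = (P *m Q) j w by rewrite mxE.
  rewrite !mulE mulmxDl addmxE -scalemxAl scalemxE mulmxA mulmxN mulNmx oppmxE.
  by rewrite addrA addNr add0r.
apply: is_derive_sum => u; apply: is_deriveM; first exact: scaled_taylor_derive fz hs Us.
exact: (is_derive_expm (@word_size_le K) s u w lF).
Qed.

End LetterDerivative.

(** * Families of trajectories at a small scale *)

Section LetterFlow.
Context {R : realType} {d N : nat} (K : nat).
Local Notation V := 'rV[R]_d.
Variables (U : set V) (f0 f1 : V -> V).
Hypotheses (oU : open U) (sf0 : smooth_on U f0) (sf1 : smooth_on U f1).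
Local Notation field := (eval_Br f0 f1).
Local Notation n := (nwords K).
Local Notation len i := (Br_length (bracket i)).
Local Notation letter := (@letter R N).
Local Notation letter_field := (@letter_field R d N f0 f1).
Variables (r M : R).
Hypotheses (r0 : 0 < r) (M0 : 0 <= M).
Hypothesis tame_field : forall (i : 'I_N.+1) j, tame U (fun x => field (bracket i) x 0 j) r M.
Hypothesis tame_lie : forall (i : 'I_N.+1) (w : 'I_n) j,
  tame U (lie (field (bracket i)) (iter_lie f0 f1 (word_of w) j)) r M.
Implicit Types (th : letter) (x : V) (e : R).

(** Differences are only estimated at a common scale, since the quantities of interest are
divided by powers of that scale. *)
Definition scaledom (e1 : R) : lipdom R := @LipDom R (R * V)%type
  (fun h => 0 < h.1 <= e1 /\ `|h.2| <= 1)
  (fun h h' => [/\ 0 < h.1 <= e1 /\ `|h.2| <= 1, 0 < h'.1 <= e1 /\ `|h'.2| <= 1 & h.1 = h'.1])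
  (fun h h' => `|h.2 - h'.2|)
  (fun h h' H => let: And3 a b _ := H in conj a b)
  (fun h h' => normr_ge0 _).
Local Notation Q := scaledom.
Local Notation BLQ e1 f := (BL (X := Q e1) f).

Lemma BLQ_le e1 e2 (W : normedModType R) (f : R * V -> W) : e2 <= e1 -> BLQ e1 f -> BLQ e2 f.
Proof.
move=> e21; apply: (@BL_comp _ (Q e2) (Q e1) W id f 1) => //= [h [/andP[a b] c]|h h'].
  by rewrite a (le_trans b).
move=> [[/andP[a b] c] [/andP[a' b'] c'] e]; rewrite mul1r; split=> //.
by split=> //; rewrite ?a ?a' (le_trans _ e21).
Qed.

Lemma BLQ_fst e1 : BLQ e1 (fun h : R * V => h.1).
Proof.
exists `|e1| => //; split=> [h [/andP[a b] _]|h h' [_ _ ->]].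
  by rewrite ger0_norm ?(ltW a)// (le_trans b)// ler_norm.
by rewrite subrr normr0; apply: mulr_ge0 => //; exact: ldst_ge0.
Qed.

Lemma letter_sum_le e th (f : 'I_N.+1 -> R) (C : R) : 0 <= e <= 1 -> 0 <= C ->
  (forall i, `|f i| <= C) ->
  `|\sum_(i < N.+1) (e ^+ len i * th 0 i) * f i| <= e * (N.+1%:R * (`|th| * C)).
Proof.
move=> /andP[e0 e1] C0 hf; rewrite (le_trans (ler_norm_sum _ _ _))// mulrCA.
rewrite mulr_natl -[X in _ *+ X]card_ord -sumr_const ler_sum// => i _.
rewrite !normrM -mulrA; apply: ler_pM; rewrite ?mulr_ge0//.
  rewrite ger0_norm ?exprn_ge0// -(prednK (Br_length_gt0 (bracket i))) exprS ler_piMr//.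
  exact: exprn_ile1.
by apply: ler_pM => //; exact: mx_entry_le.
Qed.

Lemma letter_field_le e th x : 0 <= e <= 1 -> `|x| <= r ->
  `|letter_field (dilate_letter e th) x| <= e * (N.+1%:R * (`|th| * M)).
Proof.
move=> he xr; have /andP[e0 _] := he; apply: mx_norm_le; first by rewrite !mulr_ge0.
move=> i j; rewrite ord1 summxE.
under eq_bigr => k _ do rewrite mxE mxE.
by apply: letter_sum_le => // k; have [] := tame_field k j xr xr.
Qed.

Lemma letter_field_lip e th x y : 0 <= e <= 1 -> `|x| <= r -> `|y| <= r ->
  `|letter_field (dilate_letter e th) x - letter_field (dilate_letter e th) y| <= e * (N.+1%:R
    * (`|th| * M)) * `|x - y|.
Proof.
move=> he xr yr; have /andP[e0 _] := he; apply: mx_norm_le; first by rewrite !mulr_ge0.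
move=> i j; rewrite ord1 !mxE !summxE -sumrB.
under eq_bigr => k _ do rewrite 3!mxE -mulrBr.
rewrite -!mulrA; apply: letter_sum_le; rewrite ?mulr_ge0// => k.
by have [] := tame_field k j xr yr.
Qed.

Lemma letter_field_dilate_B e th th' x :
  letter_field (dilate_letter e th) x - letter_field (dilate_letter e th') x = letter_field
    (dilate_letter e (th - th')) x.
Proof. by rewrite -sumrB; apply: eq_bigr => i _; rewrite -scalerBl !mxE mulrBr. Qed.

(** Every bracket has positive length, so the dilated field is e times a bounded Lipschitz
field.  For small e it is 1/2-Lipschitz and its trajectories stay in the ball, where the
clamped field is the actual one.  By flow_dep the trajectories divided by e are bounded
and Lipschitz in the parameter. *)
Lemma letter_flow e1 (th : R * V -> letter) (y : R * V -> V) : 0 < e1 ->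
  BLQ e1 th -> BLQ e1 y ->
  exists (e2 : R) (z : R * V -> R -> V), [/\ 0 < e2, e2 <= e1,
    BL (X := timedom (Q e2)) (fun p : R * V * R => p.1.1^-1 *: z p.1 p.2) &
    forall h, ldom (l := Q e2) h -> flow (letter_field (dilate_letter h.1 (th h))) (h.1 *: y
      h) (z h) /\
      forall s : R, 0 <= s <= 1 -> `|z h s| <= r].
Proof.
move=> e10 [C1 C10 [th1 th2]] [C2 C20 [y1 y2]].
pose B := N.+1%:R * (C1 * M); have B0 : 0 <= B by rewrite !mulr_ge0.
(* e2 B <= 1/2 makes the field 1/2-Lipschitz, e2 (C2 + B) <= r keeps the curve in the ball *)
pose e2 := Num.min (Num.min e1 1) (Num.min (2 * (B + 1))^-1 (r / (C2 + B + 1))).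
have B10 : 0 < B + 1 by rewrite ltr_wpDl.
have CB0 : 0 < C2 + B + 1 by rewrite ltr_wpDl// addr_ge0.
have e20 : 0 < e2 by rewrite !lt_min e10 ltr01 invr_gt0 mulr_gt0//= divr_gt0.
have [e21 e2_1 e22 e23] : [/\ e2 <= e1, e2 <= 1, e2 * B <= 2^-1 & e2 * (C2 + B) <= r].
  split; rewrite ?ge_min ?lexx ?orbT//.
    have : e2 <= (2 * (B + 1))^-1 by rewrite !ge_min lexx !orbT.
    rewrite -[X in _ <= X]div1r ler_pdivlMr ?mulr_gt0//; move: e20; clearbody e2; nra.
  have : e2 <= r / (C2 + B + 1) by rewrite !ge_min lexx !orbT.
  by rewrite ler_pdivlMr//; move: e20; clearbody e2; nra.
clearbody e2.
pose H h x := letter_field (dilate_letter h.1 (th h)) (clampV r x).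
have clamp_r x : `|clampV r x| <= r by apply/clampV_le/ltW.
have domQ h : ldom (l := Q e2) h -> [/\ 0 <= h.1 <= 1, 0 < h.1, h.1 <= e2 & ldom (l := Q e1) h].
  move=> [/andP[a b] c]; rewrite (ltW a) (le_trans b)//; split=> //; split=> //.
  by rewrite a (le_trans b).
have thB h : ldom (l := Q e2) h -> N.+1%:R * (`|th h| * M) <= B.
  by move=> /domQ[_ _ _ h1]; rewrite ler_wpM2l// ler_wpM2r// th1.
have HB h x : ldom (l := Q e2) h -> `|H h x| <= h.1 * B.
  move=> hd; have [h01 _ _ _] := domQ h hd;
    rewrite (le_trans (letter_field_le _ h01 (clamp_r x)))//.
  by rewrite ler_wpM2l ?thB//; case/andP: h01.
have HL h x x' : ldom (l := Q e2) h -> `|H h x - H h x'| <= h.1 * B * `|x - x'|.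
  move=> hd; have [h01 _ _ _] := domQ h hd.
  rewrite (le_trans (letter_field_lip _ h01 (clamp_r x) (clamp_r x')))// ler_pM ?clampV_lip//.
    by rewrite !mulr_ge0//; case/andP: h01.
  by rewrite ler_wpM2l ?thB//; case/andP: h01.
have HL2 h x x' : ldom (l := Q e2) h -> `|H h x - H h x'| <= 2^-1 * `|x - x'|.
  move=> hd; rewrite (le_trans (HL _ _ _ hd))// ler_wpM2r// (le_trans _ e22)// ler_wpM2r//.
  by have [] := domQ h hd.
have Hd h h' x : lrel (l := Q e2) h h' -> `|H h x - H h' x| <= h.1 * (B * `|h.2 - h'.2|).
  move=> [hd hd' e]; have [h01 _ _ q] := domQ h hd; have [_ _ _ q'] := domQ h' hd'.
  rewrite /H -e letter_field_dilate_B (le_trans (letter_field_le _ h01 (clamp_r x)))//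
    ler_wpM2l//; first by case/andP: h01.
  rewrite -mulrA ler_wpM2l// mulrAC ler_wpM2r//; exact: th2.
have [z hz] : {z : R * V -> R -> V | forall h, ldom (l := Q e2) h ->
  flow (H h) (h.1 *: y h) (z h)}.
  suff h : forall h, exists z, ldom (l := Q e2) h -> flow (H h) (h.1 *: y h) z.
    by exists (fun h' => sval (cid (h h'))) => h'; case: cid.
  move=> h; have [hd|nd] := pselect (ldom (l := Q e2) h); last by exists (fun=> 0).
  have [z hz] := flow_exists (h.1 *: y h) (fun x => HB h x hd) (fun x x' => HL2 h x x' hd).
  by exists z.
have zle h (s : R) : ldom (l := Q e2) h -> 0 <= s <= 1 -> `|z h s| <= h.1 * (C2 + B).
  move=> hd hs; have [_ h0 _ q] := domQ h hd.
  have := flow_lip (fun x => HB h x hd) (hz h hd) hs (t := 0); rewrite lexx ler01 => /(_ isT).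
  rewrite (hz h hd).1 subr0 => hl; rewrite -[z h s](subrK (h.1 *: y h)) (le_trans (ler_normD _
    _))//.
  rewrite addrC mulrDr lerD//; first by rewrite normrZ gtr0_norm// ler_wpM2l ?(ltW h0)// y1.
  rewrite (le_trans hl)// ler_piMr//; first by rewrite mulr_ge0// ltW.
  by case/andP: hs => s0 s1; rewrite ger0_norm.
have zr h (s : R) : ldom (l := Q e2) h -> 0 <= s <= 1 -> `|z h s| <= r.
  move=> hd hs; rewrite (le_trans (zle _ _ hd hs))// (le_trans _ e23)// ler_wpM2r ?addr_ge0//.
  by have [] := domQ h hd.
exists e2, z; split=> //; last first.
  move=> h hd; split; last by move=> s; apply: zr.
  have [z0 dz] := hz h hd; split=> // s hs j.
  by have := dz s hs j; rewrite /H clampV_id// zr.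
exists (2 * (C2 + B)); first by rewrite mulr_ge0// addr_ge0.
split=> [[h s] [hd hs]|[h s] [h' s'] [hr [/= <- hs]]].
  have [_ h0 _ _] := domQ h hd.
  rewrite normrZ normfV gtr0_norm//= ler_pdivrMl// (le_trans (zle _ _ hd hs))//.
  by rewrite ler_wpM2l ?(ltW h0)// ler_peMl ?addr_ge0// ler1n.
have [hd hd' e] := hr; have [_ h0 he2 q] := domQ h hd; have [_ h0' _ q'] := domQ h' hd'.
have e2B h2 : ldom (l := Q e2) h2 -> forall x, `|H h2 x| <= e2 * B.
  by move=> d2 x; rewrite (le_trans (HB _ _ d2))// ler_wpM2r//; have [] := domQ _ d2.
have b0 : `|h.1 *: y h - h'.1 *: y h'| <= h.1 * (C2 * `|h.2 - h'.2|).
  rewrite -e -scalerBr normrZ gtr0_norm// ler_wpM2l ?(ltW h0)//; apply: y2.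
  by split; [exact: q | exact: q' | exact: e].
have := flow_dep (e2B h hd) (e2B h' hd') (fun x x' => HL2 h x x' hd) (fun x => Hd h h' x hr)
  b0 (hz h hd) (hz h' hd') hs.
rewrite -e -scalerBr normrZ normfV gtr0_norm// ler_pdivrMl// => /le_trans; apply.
by rewrite -mulrDr -mulrDl mulrCA !mulrA.
Qed.

End LetterFlow.

Section Chain.
Context {R : realType} {d N : nat}.
Local Notation K := (2 * N)%N.
Local Notation V := 'rV[R]_d.
Variables (U : set V) (f0 f1 : V -> V).
Hypotheses (oU : open U) (sf0 : smooth_on U f0) (sf1 : smooth_on U f1).
Local Notation field := (eval_Br f0 f1).
Local Notation n := (nwords K).
Local Notation x0 := (shift_mx K false : 'M[R]_n).
Local Notation x1 := (shift_mx K true : 'M[R]_n).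
Local Notation len i := (Br_length (bracket i)).
Local Notation letter_mx := (letter_mx x0 x1).
Local Notation letter := (@letter R N).
Local Notation letter_field := (@letter_field R d N f0 f1).
Local Notation scaled_taylor := (scaled_taylor K f0 f1).
Local Notation step_defect := (step_defect K f0 f1).
Variables (r M : R).
Hypotheses (r0 : 0 < r) (M0 : 0 <= M).
Hypothesis tame_field : forall (i : 'I_N.+1) j, tame U (fun x => field (bracket i) x 0 j) r M.
Hypothesis tame_lie : forall (i : 'I_N.+1) (w : 'I_n) j,
  tame U (lie (field (bracket i)) (iter_lie f0 f1 (word_of w) j)) r M.
Implicit Types (th : letter) (x : V) (e : R).

Local Notation Q := (@scaledom R d).
Local Notation BLQ e1 f := (BL (X := Q e1) f).

Lemma BL_step_defect e1 (th : R * V -> letter) (z : R * V -> R -> V) : 0 < e1 ->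
  BLQ e1 th -> BL (X := timedom (Q e1)) (fun p : R * V * R => p.1.1^-1 *: z p.1 p.2) ->
  (forall h, ldom (l := Q e1) h -> forall s : R, 0 <= s <= 1 -> `|z h s| <= r) ->
  BL (X := timedom (Q e1)) (fun p : R * V * R => step_defect p.1.1 (th p.1) (z p.1 p.2)).
Proof.
move=> e10 hth hz zr; have hs := BL_fst (@BLQ_fst R d e1).
have hz' : BL (X := timedom (Q e1)) (fun p : R * V * R => z p.1 p.2).
  apply: BL_ext (BLZ hs hz) => p [[/andP[a _] _] _].
  by rewrite scalerA divff ?scale1r// gt_eqF.
apply: BL_mx => j w.
pose f (i : 'I_N.+1) (p : R * V * R) := if (len i + word_size w <= K)%N then 0 : R
  else th p.1 0 i * p.1.1 ^+ (len i + word_size w - K.+1) *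
    lie (field (bracket i)) (iter_lie f0 f1 (word_of w) j) (z p.1 p.2).
have hf i : BL (X := timedom (Q e1)) (f i).
  rewrite /f; case: (len i + word_size w <= K)%N; first exact: BL_cst.
  apply: BLMr; first by apply: BLMr; [exact: BL_entry (BL_fst hth) | exact: BLXr].
  by apply: BL_tame M0 (tame_lie i w j) _ hz' => p [hd hs']; exact: zr.
by apply: BL_ext (BL_sum (index_enum 'I_N.+1) predT hf) => p _; rewrite mxE.
Qed.

(** Along one letter, the matrix scaled_taylor is multiplied by the exponential of the letter
up to an error e^(K+1) E.  By scaled_taylor_expm_derive the product with the inverse
exponential has a derivative of order e^(K+1), and BL_increment integrates it. *)
Lemma letter_step e1 (th : R * V -> letter) (y : R * V -> V) : 0 < e1 ->
  BLQ e1 th -> BLQ e1 y ->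
  exists (e2 : R) (y' : R * V -> V) (E : R * V -> 'M[R]_(d, n)),
  [/\ 0 < e2, e2 <= e1, BLQ e2 y', BLQ e2 E &
    forall h, ldom (l := Q e2) h ->
    (exists z, [/\ flow (letter_field (dilate_letter h.1 (th h))) (h.1 *: y h) z,
       (forall s : R, 0 <= s <= 1 -> `|z s| <= r) & z 1 = h.1 *: y' h]) /\
    scaled_taylor h.1 (h.1 *: y' h) = scaled_taylor h.1 (h.1 *: y h) *m expm K (letter_mx (th
      h)) + h.1 ^+ K.+1 *: E h].
Proof.
move=> e10 hth hy.
have [e2 [z [e20 e21 hz zf]]] := letter_flow r0 M0 tame_field e10 hth hy.
have {hth} hth := BLQ_le e21 hth; have {hy} hy := BLQ_le e21 hy.
have zr h hd := (zf h hd).2.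
have h00 : 0 <= (0 : R) <= 1 by rewrite lexx ler01.
have h11 : 0 <= (1 : R) <= 1 by rewrite lexx ler01.
have hD := BL_step_defect e20 hth hz zr.
pose P h (s : R) := scaled_taylor h.1 (z h s) *m expm K (s *: - letter_mx (th h)).
pose G (p : R * V * R) := step_defect p.1.1 (th p.1) (z p.1 p.2) *m
   expm K (p.2 *: - letter_mx (th p.1)).
have hG : BL (X := timedom (Q e2)) G.
  apply: BLM hD _; apply/BL_expm/BLZ; first exact: (BL_snd (Q e2)).
  exact/BLN/BL_letter_mx/(BL_fst hth).
pose E0 h : 'M[R]_(d, n) := (h.1 ^+ K.+1)^-1 *: (P h 1 - P h 0).
have hE0 : BLQ e2 E0.
  apply: BL_mx => j w.
  have h1 := @BL_increment R (Q e2) (fun h s => P h s j w) (fun p => G p j w)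
     (fun h => h.1 ^+ K.+1).
  apply: BL_ext (h1 _ _ _ (BL_entry j w hG)).
  - by move=> h _; rewrite !mxE.
  - by move=> h [/andP[a _] _]; rewrite exprn_gt0.
  - by move=> h h' [_ _ ->].
  - move=> h hd s hs; have [fz _] := zf h hd.
    apply: (scaled_taylor_expm_derive oU sf0 sf1 j w fz hs).
    have := zr h hd s hs; set u := z h s => ur.
    by have [] := tame_field ord0 (cast_ord (erefl d) j) ur ur.
exists e2, (fun h => h.1^-1 *: z h 1), (fun h => E0 h *m expm K (letter_mx (th h))); split=> //.
- exact: (BL_at h11 hz).
- by apply: BLM hE0 _; apply/BL_expm/BL_letter_mx.
move=> h hd; have [fz hr] := zf h hd; have [/andP[a _] _] := hd.
have zE : h.1 *: (h.1^-1 *: z h 1) = z h 1 by rewrite scalerA divff ?scale1r// gt_eqF.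
split; first by exists (z h); rewrite zE.
rewrite zE scalemxAl scalerA divff ?scale1r; last by rewrite expf_neq0// gt_eqF.
have lF : low (@word_size K) 1 (letter_mx (th h)) by apply: letter_mx_low; exact: shift_mx_homog.
rewrite -mulmxDl /P scale0r expm0 mulmx1 fz.1 scale1r [_ + (_ - _)]addrC subrK -mulmxA.
by rewrite (_ : expm K (- _) *m _ = 1) ?mulmx1//; exact: (expmVl (@word_size_le K)).
Qed.

Fixpoint steers (w : seq letter) (x y : V) : Prop :=
  if w is th :: w' then
    exists z, [/\ flow (letter_field th) x z, (forall s : R, 0 <= s <= 1 -> `|z s| <= r) &
      steers w' (z 1) y]
  else x = y.

Lemma good_family_BLQ_le e1 e2 (S : seq (Q e1 -> letter)) : e2 <= e1 -> good_family S ->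
  good_family (X := Q e2) S.
Proof.
move=> e21; elim: S => //= th S IH [[h1 h2] h3]; split; last exact: IH.
split=> [|h [/andP[a b] c]]; first exact: BLQ_le h1.
by apply: h2; split=> //; rewrite a (le_trans b).
Qed.

(** The errors of the letters add up, each multiplied by the value of the letters that follow;
the scale is reduced at each letter. *)
Lemma word_steps e1 (S : seq (R * V -> letter)) (y : R * V -> V) : 0 < e1 ->
  good_family (X := Q e1) S -> BLQ e1 y ->
  exists (e2 : R) (y' : R * V -> V) (E : R * V -> 'M[R]_(d, n)),
  [/\ 0 < e2, e2 <= e1, BLQ e2 y', BLQ e2 E &
    forall h, ldom (l := Q e2) h ->
    steers (map (dilate_letter h.1) (family_at (X := Q e2) S h)) (h.1 *: y h) (h.1 *: y' h) /\
    scaled_taylor h.1 (h.1 *: y' h) = scaled_taylor h.1 (h.1 *: y h) *m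
      word_mx x0 x1 (family_at (X := Q e2) S h) + h.1 ^+ K.+1 *: E h].
Proof.
elim: S e1 y => [|th S IH] e1 y e10 hS hy.
  exists e1, y, (fun=> 0); split=> //; first exact: BL_cst.
  by move=> h _; split=> //; rewrite /word_mx big_nil scaler0 addr0 mulmx1.
have [[hth _] {}hS] := hS.
have [e2 [y2 [E2 [e20 e21 hy2 hE2 step]]]] := letter_step e10 hth hy.
have [e3 [y3 [E3 [e30 e32 hy3 hE3 steps]]]] := IH e2 y2 e20 (good_family_BLQ_le e21 hS) hy2.
have hS3 : good_family (X := Q e3) S by apply: good_family_BLQ_le hS; rewrite (le_trans e32).
exists e3, y3, (fun h => E2 h *m word_mx x0 x1 (family_at (X := Q e3) S h) + E3 h); split=> //.
- exact: le_trans e21.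
- by apply: BLD hE3; apply: BLM (BL_word_mx x0 x1 hS3); apply: BLQ_le hE2.
move=> h hd; have hd2 : ldom (l := Q e2) h.
  by case: hd => /andP[a b] c; split=> //; rewrite a (le_trans b).
have [[z [fz zr z1]] e] := step h hd2; have [st e'] := steps h hd.
split; first by exists z; rewrite z1.
rewrite e' e mulmxDl -scalemxAl scalerDr addrA -mulmxA; congr (_ *m _ + _ + _).
rewrite /word_mx /family_at [map _ (_ :: _)]/= big_cons.

by [].

Qed.

End Chain.

(** * Local surjectivity *)

Section ExpmRemainder.
Context {R : realType} {n : nat}.

(** The Taylor remainder of order 2 of e^(sM), divided by s^2; unlike expm_bounds it is used as
a function of s and M together. *)
Definition expm_rem K (s : R) (M : 'M[R]_n) : 'M[R]_n :=
  \sum_(k < K.-1) ((k.+2)`!%:R)^-1 *: (s ^+ k *: M ^+ k.+2).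

Lemma expm_remE K (s : R) (M : 'M[R]_n) : (0 < K)%N ->
  expm K (s *: M) = 1 + s *: M + s ^+ 2 *: expm_rem K s M.
Proof.
case: K => // K _; rewrite expmE big_ord_recl big_ord_recl /=.
rewrite expr0 fact0 invr1 scale1r expr1 scale1r addrA; congr (_ + _).
rewrite scaler_sumr; apply: eq_bigr => k _.
by rewrite scaleMX /bump/= !add1n !scalerA; congr (_ *: _); rewrite !exprS; ring.
Qed.

Lemma BL_expm_rem K (X : lipdom R) (s : X -> R) (M : X -> 'M[R]_n) : BL s -> BL M ->
  BL (fun h => expm_rem K (s h) (M h)).
Proof.
by move=> hs hM; apply: BL_sum => k; apply: BLZ (BL_cst _ _) (BLZ (BLXr _ hs) (BLX _ hM)).
Qed.

End ExpmRemainder.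

Section Directions.
Context {R : realType} {d N : nat}.
Hypothesis N_gt0 : (0 < N)%N.
Local Notation K := (2 * N)%N.
Local Notation V := 'rV[R]_d.
Variables (U : set V) (f0 f1 : V -> V).
Hypotheses (oU : open U) (U0 : U 0) (sf0 : smooth_on U f0) (sf1 : smooth_on U f1).
Hypothesis f00 : f0 0 = 0.
Hypothesis full : L_at0 K f0 f1 = setT.
Local Notation field := (eval_Br f0 f1).
Local Notation n := (nwords K).
Local Notation x0 := (shift_mx K false : 'M[R]_n).
Local Notation x1 := (shift_mx K true : 'M[R]_n).
Local Notation bracket_mx := (bracket_mx x0 x1).
Local Notation taylor_mx := (taylor_mx K f0 f1).
Local Notation scaled_taylor := (scaled_taylor K f0 f1).
Local Notation dilate := (dilate (@word_size K)).
Local Notation Q := (@scaledom R d).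
Local Notation BLQ e1 f := (BL (X := Q e1) f).

Let K_gt0 : (0 < K)%N. Proof. by rewrite muln_gt0. Qed.
Let hx0 : homog (@word_size K) 1 x0 := shift_mx_homog K false.
Let hx1 : homog (@word_size K) 1 x1 := shift_mx_homog K true.

(** X_0 is discarded because its field vanishes at 0; the other brackets belong to the ideal. *)
Lemma span_brackets (v : V) : exists l : seq (R * Br),
  (forall p, p \in l -> p.2 <> X0 /\ (Br_length p.2 <= K)%N) /\
  v = \sum_(p <- l) p.1 *: field p.2 0.
Proof.
have [k [c [w [hw ->]]]] : linear_span
    [set field b 0 | b in [set b | (Br_length b <= K)%N]] v.
  by have : setT v by []; rewrite -full.
pose b i := sval (cid2 (hw i)).
have bK i : (Br_length (b i) <= K)%N by rewrite /b; case: cid2.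
have bw i : field (b i) 0 = w i by rewrite /b; case: cid2.
exists [seq (c i, b i) | i <- enum 'I_k & b i != X0]; split.
  move=> p /mapP[i]; rewrite mem_filter => /andP[/eqP bi _] ->.
  by split; [exact: bi | exact: bK].
rewrite [RHS]big_map [RHS]big_filter [RHS]big_enum_cond [RHS]/=.
rewrite [LHS](bigID (fun i : 'I_k => b i != X0))/=.
rewrite [X in _ + X]big1 ?addr0; last first.
  move=> i; case: (b i =P X0) => // bi _; rewrite -bw bi.
  by rewrite [field X0]/= f00 scaler0.
by apply: eq_bigr => i _; rewrite bw.
Qed.

Definition brackets_of (j : 'I_d) := sval (cid (span_brackets (delta_mx 0 j))).

Lemma brackets_ofP j p : p \in brackets_of j -> p.2 <> X0 /\ (Br_length p.2 <= K)%N.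
Proof. by rewrite /brackets_of; case: cid => l [/= h _] /h. Qed.

Lemma brackets_ofE j : \sum_(p <- brackets_of j) p.1 *: field p.2 0 = delta_mx 0 j.
Proof. by rewrite /brackets_of; case: cid => l [/= _ h]. Qed.

(** dirs q is a combination of bracket matrices whose fields combine to q at 0.  In scaled_dirs
the powers of e are chosen so that dilating by e makes the combination homogeneous, of
weight e^K (dilate_scaled_dirs). *)
Definition dirs (q : V) : 'M[R]_n :=
  \sum_j q 0 j *: \sum_(p <- brackets_of j) p.1 *: bracket_mx p.2.

Definition scaled_dirs (e : R) (q : V) : 'M[R]_n :=
  \sum_j q 0 j *: \sum_(p <- brackets_of j) (p.1 * e ^+ (K - Br_length p.2)) *: bracket_mx p.2.

Lemma scaled_dirs_ctrl_ideal e q : ctrl_ideal x0 x1 (scaled_dirs e q).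
Proof.
apply: ctrl_ideal_sum => j _; apply: ctrl_idealZ; rewrite big_seq; apply: ctrl_ideal_sum => p hp.
by apply/ctrl_idealZ/ctrl_ideal_bracket_mx; have [] := brackets_ofP hp.
Qed.

Lemma dilate_scaled_dirs e q : e != 0 -> dilate e (scaled_dirs e q) = e ^+ K *: dirs q.
Proof.
move=> e0; rewrite /scaled_dirs dilate_sum scaler_sumr; apply: eq_bigr => j _.
rewrite dilate_Z scalerA mulrC -scalerA; congr (_ *: _).
rewrite dilate_sum scaler_sumr !big_seq; apply: eq_bigr => p hp.
have [_ pK] := brackets_ofP hp.
rewrite dilate_Z (dilate_homog e0 (bracket_mx_homog hx0 hx1 _)) !scalerA; congr (_ *: _).
by rewrite -mulrA -exprD subnK// mulrC.
Qed.

Lemma taylor_mx_dirs q j i : word_of i = [::] -> (taylor_mx 0 *m dirs q) j i = q 0 j.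
Proof.
move=> wi; rewrite mulmx_sumr summxE.
have e k : (taylor_mx 0 *m (q 0 k *: \sum_(p <- brackets_of k) p.1 *: bracket_mx p.2)) j i =
    q 0 k * (j == k)%:R.
  rewrite -scalemxAr scalemxE mulmx_sumr summxE; congr (_ * _).
  have := congr1 (fun v : V => v 0 j) (brackets_ofE k); rewrite mxE eqxx /= => <-.
  rewrite summxE !big_seq; apply: eq_bigr => p hp; have [_ pK] := brackets_ofP hp.
  by rewrite -scalemxAr !scalemxE (taylor_mx_bracket_mx_nil oU sf0 sf1 j U0 wi pK).
rewrite (bigD1 j)//= e eqxx mulr1 big1 ?addr0// => k kj.
by rewrite e eq_sym (negPf kj) mulr0.
Qed.

Lemma scaled_taylor_dilate e x (M : 'M[R]_n) j i : word_of i = [::] ->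
  (scaled_taylor e x *m M) j i = (taylor_mx x *m dilate e M) j i.
Proof.
move=> wi; rewrite !mxE; apply: eq_bigr => u _; rewrite !mxE.
by rewrite /word_size wi /= expr0 mulr1; ring.
Qed.

Lemma scaled_taylor_nil e x j i : word_of i = [::] -> scaled_taylor e x j i = x 0 j.
Proof. by move=> wi; rewrite mxE /word_size wi /= expr0 mul1r. Qed.

(** The drift vanishes at 0, so all Lie derivatives along it vanish there, and waiting has no
effect. *)
Lemma scaled_taylor0_x0 e : scaled_taylor e 0 *m x0 = 0.
Proof.
apply/matrixP => j w; rewrite (scaled_taylor_bracket_mx f0 f1 e X0 j w U0)
  (taylor_mx_bracket_mx oU sf0 sf1 X0 j w U0).
rewrite mxE /= /lie f00 dird_sum_coor big1 ?if_same ?mulr0// => k _.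
by rewrite mxE mul0r.
Qed.

Lemma scaled_taylor0_expm e t : scaled_taylor e 0 *m expm K (t *: x0) = scaled_taylor e 0.
Proof.
rewrite (expm_remE _ _ K_gt0) /expm_rem mulmxDr mulmxDr mulmx1 -scalemxAr scaled_taylor0_x0
  scaler0 addr0.
rewrite -scalemxAr mulmx_sumr big1 ?scaler0 ?addr0// => k _.
by rewrite -!scalemxAr exprS -[x0 * _]/(x0 *m _) mulmxA scaled_taylor0_x0 mul0mx !scaler0.
Qed.

Lemma BLQ_snd e1 : BLQ e1 (fun h : R * V => h.2).
Proof. by exists 1 => //; split=> [h [_ h2]|h h' _] //; rewrite mul1r. Qed.

Lemma BL_scaled_dirs e1 : BLQ e1 (fun h : R * V => scaled_dirs h.1 h.2).
Proof.
apply: BL_sum => j; apply: BLZ; first exact/BL_entry/BLQ_snd.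
apply: BL_sum => p; apply: BLZ (BL_cst _ _).
by apply: BLMr (BL_cst _ _) (BLXr _ _); exact: BLQ_fst.
Qed.

Lemma BL_dirs e1 : BLQ e1 (fun h : R * V => dirs h.2).
Proof.
by apply: BL_sum => j; apply: BLZ (BL_cst _ _); exact/BL_entry/BLQ_snd.
Qed.

End Directions.

Section LocalReach.
Context {R : realType} {d N : nat}.
Hypothesis N_gt0 : (0 < N)%N.
Local Notation K := (2 * N)%N.
Local Notation V := 'rV[R]_d.
Variables (U : set V) (f0 f1 : V -> V).
Hypotheses (oU : open U) (U0 : U 0) (sf0 : smooth_on U f0) (sf1 : smooth_on U f1).
Hypothesis f00 : f0 0 = 0.
Hypothesis full : L_at0 K f0 f1 = setT.
Local Notation field := (eval_Br f0 f1).
Local Notation n := (nwords K).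
Local Notation x0 := (shift_mx K false : 'M[R]_n).
Local Notation x1 := (shift_mx K true : 'M[R]_n).
Local Notation letter := (@letter R N).
Local Notation taylor_mx := (taylor_mx K f0 f1).
Local Notation Q := (@scaledom R d).
Local Notation BLQ e1 f := (BL (X := Q e1) f).

Let K_gt0 : (0 < K)%N. Proof. by rewrite muln_gt0. Qed.
Let hx0 : homog (@word_size K) 1 x0 := shift_mx_homog K false.
Let hx1 : homog (@word_size K) 1 x1 := shift_mx_homog K true.

Local Notation Ze := (scaled_dirs (N := N) f00 full).
Local Notation Y := (dirs (N := N) f00 full).
Local Notation value := (word_mx x0 x1).

Variable r : R.
Hypothesis r0 : 0 < r.
Variable M : R.
Hypothesis M0 : 0 <= M.
Hypothesis tame_field : forall (i : 'I_N.+1) j, tame U (fun x => field (bracket i) x 0 j) r M.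
Hypothesis tame_lie : forall (i : 'I_N.+1) (w : 'I_n) j,
  tame U (lie (field (bracket i)) (iter_lie f0 f1 (word_of w) j)) r M.

(** The factor k keeps the exponentials of the directions within the domain where solvable_all
provides words; in degree K agreement modulo higher degrees is equality. *)
Lemma small_group : exists (k : R) (e1 : R) (S : seq (R * V -> letter)),
  [/\ 0 < k, 0 < e1, e1 <= 1, good_family (X := Q e1) S &
    forall h, ldom (l := Q e1) h ->
      value (family_at (X := Q e1) S h) = expm K (duration (family_at (X := Q e1) S h) *: x0) *
        expm K (k *: Ze h.1 h.2)].
Proof.
have [i1 [i0 [hi e1 e0]]] := @shift_mx_entry R K K_gt0.
have [rho rho0 [S hS sol]] := solvable_all (@word_size_le K) N_gt0 hx0 hx1 hi e1 e0 K.
have hZ := BL_scaled_dirs f00 full (1 : R).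
have [B B0 [hB _]] := hZ.
have [C C0 hC] := expm_lip n K B.
have CB1 : 0 < C * B + 1 by rewrite ltr_wpDl// mulr_ge0.
(* the exponential of k Z is within C k B of 1 *)
pose k := Num.min 1 (rho / (C * B + 1)).
have k0 : 0 < k by rewrite lt_min ltr01 divr_gt0.
have k1 : k <= 1 by rewrite ge_min lexx.
have kr : k * (C * B) <= rho.
  have : k <= rho / (C * B + 1) by rewrite ge_min lexx orbT.
  by rewrite ler_pdivlMr// mulrDr mulr1; apply: le_trans; rewrite lerDl ltW.
clearbody k.
pose g (h : R * V) := expm K (k *: Ze h.1 h.2).
have hg : BLQ (1 : R) g by apply/BL_expm/BLZ => //; exact: BL_cst.
have [D D0 [_ hD]] := hg.
have gd h : ldom (l := Q 1) h -> ldom (l := groupdom (@word_size K) N x0 x1 K rho) (g h).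
  move=> hd; split; first by apply: fiber_group_expm; apply/ctrl_idealZ/scaled_dirs_ctrl_ideal.
  rewrite (le_trans (trunc_norm _ _ _))// (le_trans _ kr)//.
  have kB : `|k *: Ze h.1 h.2| <= k * B.
    by rewrite normrZ gtr0_norm// ler_wpM2l ?hB// ltW.
  have kB' : k * B <= B by rewrite ler_piMl.
  have := hC (k *: Ze h.1 h.2) 0 (le_trans kB kB'); rewrite normr0 expm0 subr0.
  by move=> /(_ B0)/le_trans; apply; rewrite mulrCA ler_wpM2l.
have gr h h' : lrel (l := Q 1) h h' -> lrel (l :=
  groupdom (@word_size K) N x0 x1 K rho) (g h) (g h') /\
    ldst (l := groupdom (@word_size K) N x0 x1 K rho) (g h) (g h') <= D * ldst (l := Q 1) h h'.
  move=> hr; have [hd hd'] := lrel_ldom hr; split; first by split; exact: gd.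
  by rewrite (le_trans (trunc_norm _ _ _))// hD.
exists k, 1, [seq (fun h => th (g h)) | th <- S]; split=> //.
  exact: (good_family_comp (X := Q 1) D0 gd gr hS).
move=> h hd; rewrite (family_at_comp (X := Q 1) (Y :=
  groupdom (@word_size K) N x0 x1 K rho) g S h).
by have := sol _ (gd h hd); rewrite /reaches => /(eqtr_full (@word_size_le K)).
Qed.

(** The column of the empty word gives the endpoint.  Its main term is e^K k q, by taylor_mx_dirs.
The quadratic remainder of the exponential is of order e^(2K), the error of word_steps of
order e^(K+1), and both are collected in rem. *)
Lemma scaled_endpoint : exists (k e1 : R) (S : seq (R * V -> letter)) (rem : R * V -> V),
  [/\ 0 < k, 0 < e1 <= 1, good_family (X := Q e1) S, BLQ e1 rem &
    forall h, ldom (l := Q e1) h ->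
      steers f0 f1 r (map (dilate_letter h.1) (family_at (X := Q e1) S h)) 0
        (h.1 ^+ K *: (k *: h.2 + h.1 *: rem h))].
Proof.
have [k [e1 [S [k0 e10 e1_1 hS val_S]]]] := small_group.
have [e2 [y' [E [e20 e21 _ hE step]]]] :=
  word_steps oU sf0 sf1 r0 M0 tame_field tame_lie e10 hS (BL_cst (Q e1) (0 : V)).
have [i0 hi0] := @word_of_surj K [::] (leq0n _).
pose rem (h : R * V) : V := \row_j (E h j i0 +
  h.1 ^+ K.-1 * (taylor_mx 0 *m expm_rem K (h.1 ^+ K) (k *: Y h.2)) j i0).
have hrem : BLQ e2 rem.
  apply: BL_mx => i j.
  have hF : BLQ e2 (fun h : R * V => E h j i0 +
     h.1 ^+ K.-1 * (taylor_mx 0 *m expm_rem K (h.1 ^+ K) (k *: Y h.2)) j i0).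
    apply: BLD; first exact: BL_entry.
    apply: BLMr; first by apply: BLXr; exact: BLQ_fst.
    apply: BL_entry; apply: BLM (BL_cst _ _) _; apply: BL_expm_rem.
      by apply: BLXr; exact: BLQ_fst.
    by apply: BLZ (BL_cst _ _) _; exact: BL_dirs.
  by apply: BL_ext hF => h _; rewrite [rem h _ _]mxE.
exists k, e2, S, rem; split=> //.
- by rewrite e20 (le_trans e21).
- exact: good_family_BLQ_le e21 hS.
move=> h hd; have [hst hG] := step h hd; have [/andP[h0 he2] hq] := hd.
have hd1 : ldom (l := Q e1) h by split; rewrite ?h0 ?(le_trans he2).
have h_neq0 : h.1 != 0 by rewrite gt_eqF.
have e := val_S h hd1.
suff <- : h.1 *: y' h = h.1 ^+ K *: (k *: h.2 + h.1 *: rem h) by rewrite scaler0 in hst.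
apply/rowP => j; rewrite -(scaled_taylor_nil f0 f1 h.1 _ j hi0) hG scaler0.
have -> : value (family_at (X := Q e2) S h) = expm K (duration (family_at (X :=
  Q e1) S h) *: x0) *m
     expm K (k *: Ze h.1 h.2) by [].
rewrite mulmxA (scaled_taylor0_expm N_gt0 oU U0 sf0 sf1 f00) addmxE scalemxE.
rewrite (scaled_taylor_dilate f0 f1 h.1 0 _ j hi0) dilate_expm//.
rewrite dilate_Z (dilate_scaled_dirs f00 full)// scalerA mulrC -scalerA (expm_remE _ _ K_gt0).
rewrite !mulmxDr !addmxE mulmx1 -!scalemxAr !scalemxE (taylor_mx_dirs oU U0 sf0 sf1 f00 full)//.
have -> : taylor_mx 0 j i0 = 0 by rewrite mxE hi0 /= /coor mxE.
rewrite [rem h _ _]mxE; set P := (taylor_mx 0 *m _) j i0.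
have eK : h.1 ^+ K = h.1 * h.1 ^+ K.-1 by rewrite -exprS (prednK K_gt0).
rewrite [h.1 ^+ K.+1]exprS expr2 {2}eK; move: P (E h j i0) (h.1 ^+ K) (h.1 ^+ K.-1) => P E' a b.
by ring.

Qed.

(** For a fixed small e, the endpoint is e^K (k q + e R(q)) with e R at most k/2 and
k/2-Lipschitz, so that the equation for q is a contraction on the unit ball. *)
Lemma local_reach (T : R) : 0 < T -> exists2 c : R, 0 < c & forall y : V, `|y| <= c ->
  exists w : seq letter, [/\ positive_word w, duration w <= T & steers f0 f1 r w 0 y].
Proof.
move=> T0; have [k [e1 [S [rem [k0 /andP[e10 e1_1] hS [C C0 [r1 r2]] hst]]]]] := scaled_endpoint.
have [Ct Ct0 [hCt _]] := BL_duration hS.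
have C1 : 0 < 2 * (C + 1) by rewrite mulr_gt0// ltr_wpDl.
have Ct1 : 0 < Ct + 1 by rewrite ltr_wpDl.
pose e := Num.min e1 (Num.min (k / (2 * (C + 1))) (T / (Ct + 1))).
have e0 : 0 < e by rewrite !lt_min e10 !divr_gt0.
have ee1 : e <= e1 by rewrite ge_min lexx.
have eC : e * C <= k / 2.
  have : e <= k / (2 * (C + 1)) by rewrite !ge_min lexx !orbT.
  rewrite ler_pdivlMr//; move: e0; clearbody e => e0.
  by rewrite ler_pdivlMr//; nra.
have eT : e * Ct <= T.
  have : e <= T / (Ct + 1) by rewrite !ge_min lexx !orbT.
  rewrite ler_pdivlMr//; move: e0; clearbody e => e0; nra.
clearbody e.
have dq q : `|q| <= 1 -> ldom (l := Q e1) (e, q) by move=> q1; split=> //=; rewrite e0.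
exists (e ^+ K * (k / 2)); first by rewrite mulr_gt0 ?exprn_gt0// divr_gt0.
move=> y hy; pose p := (e ^+ K)^-1 *: y.
have eK : 0 < e ^+ K by rewrite exprn_gt0.
have hp : `|p| <= k / 2 by rewrite normrZ normfV (gtr0_norm eK) ler_pdivrMl.
have ik : 0 <= k^-1 by rewrite invr_ge0 ltW.
(* the point q solves k q + e rem(e, q) = p, where y = e^K p *)
have [||q q1 qE] := @contraction_ball R d (fun q => k^-1 *: (p - e *: rem (e, q))) 1 ler01.
- move=> q q1; rewrite normrZ (ger0_norm ik) ler_pdivrMl// mulr1.
  rewrite (le_trans (ler_normB _ _))// [leRHS]splitr lerD// normrZ gtr0_norm//.
  by rewrite (le_trans _ eC)// ler_wpM2l ?(ltW e0)// r1//; exact: dq.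
- move=> q q' q1 q1'.
  rewrite -scalerBr opprB addrC addrA subrK -scalerBr !normrZ (ger0_norm ik) (gtr0_norm e0).
  rewrite ler_pdivrMl// (@le_trans _ _ (e * (C * `|q - q'|)))//.
    rewrite ler_wpM2l ?(ltW e0)// distrC; apply: (r2 (e, q) (e, q')).
    by split=> //; exact: dq.
  by rewrite mulrA [in leRHS]mulrA ler_wpM2r.
have yE : e ^+ K *: (k *: q + e *: rem (e, q)) = y.
  rewrite [in k *: q]qE scalerA divff ?gt_eqF// scale1r subrK /p scalerA divff ?gt_eqF//.
  by rewrite scale1r.
have hd := dq q q1.
exists (map (dilate_letter e) (family_at (X := Q e1) S (e, q))); split.
- by apply: positive_word_dilate => //; apply: positive_word_family_at.
- rewrite duration_dilate (le_trans _ eT)// ler_wpM2l ?(ltW e0)// (le_trans (ler_norm _))//.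
  exact: hCt.
- by rewrite -yE; exact: (hst _ hd).
Qed.

End LocalReach.

(** * Concatenation of trajectories in real time *)

Section Bounded.
Context {R : realType}.
Implicit Types (f g : R -> R).

(** A class of functions that is stable under the operations met when controls are concatenated,
and whose members are integrable on bounded intervals. *)
Definition bounded_meas f := measurable_fun [set: R] f /\ exists C : R, forall s, `|f s| <= C.

Lemma bounded_meas_cst (c : R) : bounded_meas (fun=> c).
Proof. by split; [exact: measurable_cst | exists `|c|]. Qed.

Lemma bounded_measM f g : bounded_meas f -> bounded_meas g -> bounded_meas (fun s => f s * g s).
Proof.
move=> [mf [C hf]] [mg [D hg]]; split; first exact: measurable_funM.
by exists (C * D) => s; rewrite normrM ler_pM.
Qed.

Lemma bounded_meas_sum (I : Type) (r : seq I) (f : I -> R -> R) :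
  (forall i, bounded_meas (f i)) ->
  bounded_meas (fun s => \sum_(i <- r) f i s).
Proof.
move=> hf; split; first by apply: measurable_sum => i; have [] := hf i.
elim: r => [|i r [C IH]]; first by exists 0 => s; rewrite big_nil normr0.
have [_ [D hD]] := hf i; exists (D + C) => s.
by rewrite big_cons (le_trans (ler_normD _ _))// lerD.
Qed.

Lemma bounded_meas_if (a : R) f g : bounded_meas f -> bounded_meas g ->
  bounded_meas (fun s => if s <= a then f s else g s).
Proof.
move=> [mf [C hf]] [mg [D hg]]; split.
  by apply: measurable_fun_ifT => //; apply: measurable_fun_ler => //; exact: measurable_id.
exists (C + D) => s; have C0 := le_trans (normr_ge0 _) (hf s).
have D0 := le_trans (normr_ge0 _) (hg s).
by case: ifP => _; rewrite (le_trans (hf s), le_trans (hg s)) ?lerDl ?lerDr.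
Qed.

Lemma bounded_meas_lip f (C L : R) : (forall s, `|f s| <= C) -> 0 <= L ->
  (forall s t, `|f s - f t| <= L * `|s - t|) -> bounded_meas f.
Proof.
move=> hC L0 hL; split; last by exists C.
by apply: continuous_measurable_fun; exact: (lip_continuous L0 hL).
Qed.

Lemma bounded_meas_integrable f (a b : R) (x y : bool) : bounded_meas f ->
  (@lebesgue_measure R).-integrable [set` Interval (BSide x a) (BSide y b)] (EFin \o f).
Proof.
move=> [mf [C hf]]; apply: measurable_bounded_integrable => //.
- have /compact_finite_measure : compact (`[a, b] : set R) by exact: segment_compact.
  apply: le_lt_trans; apply: le_measure; rewrite ?inE//.
  by move=> s; case: x; case: y; rewrite /= !in_itv/= => /andP[? ?]; apply/andP; split=> //;
    apply: ltW.
- exact: measurable_funTS.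
- exists C; split=> [|M CM s _]; first exact: num_real.
  by apply: le_trans (hf s) _; exact: ltW.
Qed.

End Bounded.

Section Assembly.
Context {R : realType} {d N : nat}.
Local Notation V := 'rV[R]_d.
Variables (U : set V) (f0 f1 : V -> V) (r M : R).
Local Notation field := (eval_Br f0 f1).
Local Notation letter := (@letter R N).
Local Notation letter_field := (@letter_field R d N f0 f1).
Local Notation mu := (@lebesgue_measure R).
Hypotheses (r0 : 0 < r) (M0 : 0 <= M).
Hypothesis tame_field : forall (i : 'I_N.+1) j, tame U (fun x => field (bracket i) x 0 j) r M.
Implicit Types (u : R -> letter) (x : R -> V).

Definition lip_curve x (L : R) := 0 <= L /\ forall s t, `|x s - x t| <= L * `|s - t|.

(** A trajectory on [0, a] from 0 to y, with its letter u(s) at each time.  The curve is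
globally Lipschitz and stays in the ball at all times, also outside [0, a], which makes
the integrands globally measurable and bounded.  The coordinate of the drift is 1: time is
real time here. *)
Definition traj (a : R) u x (y : V) :=
  [/\ 0 <= a /\ x a = y, (forall i, bounded_meas (fun s => u s 0 i)) /\ (forall s, u s 0 0 = 1),
      exists L, lip_curve x L, (forall s, `|x s| <= r) &
      forall t, 0 <= t <= a -> forall j,
        x t 0 j = (\int[mu]_(s in `]0%R, t]) (letter_field (u s) (x s) 0 j))%R].

Lemma field_lip x L i j : lip_curve x L -> (forall s, `|x s| <= r) ->
  forall s t, `|field (bracket (i : 'I_N.+1)) (x s) 0 j - field (bracket i) (x t) 0 j| <= M *
    L * `|s - t|.
Proof.
move=> [L0 xL] xr s t; have [_ _ h] := tame_field i j (xr s) (xr t).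
by rewrite (le_trans h)// -mulrA ler_wpM2l.
Qed.

Lemma letter_field_entry th (x : V) j : letter_field th x 0 j = \sum_(i < N.+1) th 0 i * field
  (bracket i) x 0 j.
Proof. by rewrite summxE; apply: eq_bigr => i _; rewrite mxE. Qed.

Lemma bounded_meas_letter_field u x L j : lip_curve x L -> (forall s, `|x s| <= r) ->
  (forall i, bounded_meas (fun s => u s 0 i)) ->
  bounded_meas (fun s => letter_field (u s) (x s) 0 j).
Proof.
move=> xL xr hu; have -> : (fun s => letter_field (u s) (x s) 0 j) =
    (fun s => \sum_(i < N.+1) u s 0 i * field (bracket i) (x s) 0 j).
  by apply/funext => s; rewrite letter_field_entry.
apply: bounded_meas_sum => i; apply: bounded_measM => //.
apply: (@bounded_meas_lip _ _ M (M * L)); last exact: field_lip.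
- by move=> s; have [] := tame_field i j (xr s) (xr s).
- by rewrite mulr_ge0//; case: xL.
Qed.

Lemma letter_field_continuous th x L j : lip_curve x L -> (forall s, `|x s| <= r) ->
  continuous (fun s => letter_field th (x s) 0 j).
Proof.
move=> xL xr; have [L0 _] := xL.
apply: (@lip_continuous _ _ _ (\sum_(i < N.+1) `|th 0 i| * (M * L))).
  by apply: sumr_ge0 => i _; rewrite !mulr_ge0.
move=> s t; rewrite !letter_field_entry -sumrB (le_trans (ler_norm_sum _ _ _))// mulr_suml.
apply: ler_sum => i _; rewrite -mulrBr normrM -mulrA ler_wpM2l//.
exact: (field_lip i j xL xr).
Qed.

(** The flow z, run at the speed that takes it from time a to time a + tau, solves the integral
equation of the field divided by tau. *)
Lemma rescaled_integral th y z x L (a tau t : R) j :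
  flow (letter_field th) y z -> 0 < tau -> lip_curve x L -> (forall s, `|x s| <= r) ->
  (forall s, a <= s <= a + tau -> x s = z ((s - a) / tau)) -> a <= t <= a + tau ->
  (\int[mu]_(s in `]a, t]) (letter_field (tau^-1 *: th) (x s) 0 j))%R = x t 0 j - x a 0 j.
Proof.
move=> [z0 fz] tau0 xL xr xE /andP[at_ ta].
have cf : continuous (fun s => letter_field (tau^-1 *: th) (x s) 0 j) :=
  letter_field_continuous xL xr.
move: at_; rewrite le_eqVlt => /predU1P[<-|lt_at].
  by rewrite set_itvoc0 Rintegral_set0 subrr.
rewrite Rintegral_itv_obnd_cbnd; last first.
  have [hc _] := xL.
  apply: bounded_meas_integrable; apply: (bounded_meas_letter_field (u :=
    fun=> tau^-1 *: th) j xL xr) => i.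
  exact: bounded_meas_cst.
pose F (s : R) : R := z ((s - a) / tau) 0 j.
have in01 s : a <= s <= t -> 0 <= (s - a) / tau <= 1.
  move=> /andP[as_ st]; rewrite divr_ge0 ?subr_ge0 ?(ltW tau0)//=.
  by rewrite ler_pdivrMr// mul1r lerBlDl (le_trans st).
have dF s : a <= s <= t -> is_derive s (1 : R) F (tau^-1 * letter_field th (x s) 0 j).
  move=> hs; have hz := fz _ (in01 s hs) j.
  have ha : is_derive s (1 : R) (fun s : R => (s - a) / tau) tau^-1.
    have -> : (fun s : R => (s - a) / tau) = tau^-1 *: (id - cst a).
      by apply/funext => v; rewrite !fctE /= mulrC.
    have := @is_deriveZ _ _ _ (id - cst a) tau^-1 s 1 _ (is_deriveB (is_derive_id s 1)
      (is_derive_cst a s 1)).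
    by rewrite subr0 [_ *: 1]mulr1.
  have dz : derivable (fun s => z s 0 j) ((s - a) / tau) 1 by case: hz.
  have da : derivable (fun s : R => (s - a) / tau) s 1 by case: ha.
  have -> : F = (fun s => z s 0 j) \o (fun s : R => (s - a) / tau) by [].
  apply: DeriveDef.
    by apply/derivable1_diffP; apply: differentiable_comp; exact/derivable1_diffP.
  rewrite -derive1E (derive1_comp da dz) !derive1E; case: ha => _ ->; case: hz => _ ->.
  rewrite mulrC xE//; case/andP: hs => as_ st; rewrite as_ (le_trans st)//.
have cF s : a <= s <= t -> {for s, continuous F}.
  by move=> /dF[+ _] => /derivable1_diffP/differentiable_continuous.
rewrite /Rintegral (@continuous_FTC2 _ _ F)//.
- rewrite /= /F !xE ?(ltW lt_at) ?lexx ?ta// ?lerDl ?(ltW tau0)//.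
- exact: continuous_subspaceT.
- split.
  + move=> s; rewrite in_itv/= => /andP[as_ st].
    by have [] := dF s; rewrite // !ltW.
  + by apply: cvg_at_right_filter; apply: cF; rewrite lexx ltW.
  + by apply: cvg_at_left_filter; apply: cF; rewrite lexx ltW.
- move=> s; rewrite in_itv/= => /andP[as_ st].
  have [|_ e] := dF s; first by rewrite !ltW.
  rewrite derive1E e !letter_field_entry mulr_sumr; apply: eq_bigr => i _.
  by rewrite mxE mulrA.
Qed.

End Assembly.

Section Extension.
Context {R : realType} {d N : nat}.
Local Notation V := 'rV[R]_d.
Variables (U : set V) (f0 f1 : V -> V) (r M : R).
Local Notation field := (eval_Br f0 f1).
Local Notation letter := (@letter R N).
Local Notation letter_field := (@letter_field R d N f0 f1).
Local Notation mu := (@lebesgue_measure R).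
Local Notation traj := (@traj R d N f0 f1 r).
Hypotheses (r0 : 0 < r) (M0 : 0 <= M).
Hypothesis tame_field : forall (i : 'I_N.+1) j, tame U (fun x => field (bracket i) x 0 j) r M.

Lemma traj_wait (a : R) : f0 0 = 0 -> 0 <= a ->
  traj a (fun=> delta_mx 0 0) (fun=> 0) 0.
Proof.
move=> f00 a0; split=> //.
- split=> [i|s]; last by rewrite mxE !eqxx.
  exact: bounded_meas_cst.
- by exists 0; split=> // s t; rewrite subrr normr0 mul0r.
- by move=> s; rewrite normr0 ltW.
- move=> t _ j; rewrite mxE (_ : (fun s => _) = fun=> 0).
    by rewrite Rintegral_cst// mul0r.
  apply/funext => s; rewrite letter_field_entry big_ord_recl big1 ?addr0.
    by rewrite /= f00 [in X in _ * X]mxE mulr0.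
  by move=> i _; rewrite mxE /= mul0r.
Qed.

Lemma flow_lip_in th y (z : R -> V) : flow (letter_field th) y z ->
  (forall s : R, 0 <= s <= 1 -> `|z s| <= r) ->
  exists2 C : R, 0 <= C & forall s t : R, 0 <= s <= 1 -> 0 <= t <= 1 ->
    `|z s - z t| <= C * `|s - t|.
Proof.
move=> [_ fz] zr; exists (\sum_(i < N.+1) `|th 0 i| * M).
  by apply: sumr_ge0 => i _; rewrite mulr_ge0.
move=> s t hs ht; apply: mx_norm_le.
  by rewrite mulr_ge0// sumr_ge0// => i _; rewrite mulr_ge0.
move=> i j; rewrite ord1 !mxE; apply: (mvt_bound (fun s hs => fz s hs j)) => // v hv.
rewrite letter_field_entry (le_trans (ler_norm_sum _ _ _))// ler_sum// => k _.
rewrite normrM ler_wpM2l//.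
by have [] := tame_field k j (zr v hv) (zr v hv).
Qed.

(** The letter th lasts th 0 0 in real time; its other coordinates are divided by that duration
to give the controls. *)
Lemma traj_extend (a : R) u x y (th : letter) (z : R -> V) : traj a u x y -> 0 < th 0 0 ->
  flow (letter_field th) y z -> (forall s : R, 0 <= s <= 1 -> `|z s| <= r) ->
  exists u' x', traj (a + th 0 0) u' x' (z 1).
Proof.
move=> [[a0 xa] [uMB u1] [L [L0 xL]] xr xI] tau0 fz zr; set tau := th 0 0 in tau0 *.
have [C C0 zC] := flow_lip_in fz zr.
pose q (s : R) : R := (s - a) / tau.
pose u' s := if s <= a then u s else tau^-1 *: th.
pose x' s := if s <= a then x s else z (tclamp (q s)).
have qa : q a = 0 by rewrite /q subrr mul0r.
have clampa : tclamp (q a) = 0 by rewrite qa tclamp_id// lexx ler01.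
have za : z (tclamp (q a)) = x a by rewrite clampa xa; case: fz.
have zL s t : `|z (tclamp (q s)) - z (tclamp (q t))| <= C / tau * `|s - t|.
  rewrite (le_trans (zC _ _ (tclamp01 _) (tclamp01 _)))// -mulrA ler_wpM2l//.
  rewrite (le_trans (tclamp_lip _ _))// /q -mulrBl normrM mulrC normfV (gtr0_norm tau0).
  by rewrite opprB addrA subrK.
have Ct : 0 <= C / tau by rewrite divr_ge0// ltW.
have x'L : lip_curve x' (L + C / tau).
  split; first by rewrite addr_ge0.
  move=> s t; wlog st : s t / s <= t => [hw|].
    by have [/hw//|/ltW/hw] := leP s t; rewrite distrC [`|t - s|]distrC.
  rewrite /x'; have [ta|ta] := leP t a.
    by rewrite (le_trans st ta) (le_trans (xL _ _))// ler_wpM2r// lerDl.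
  have [sa|sa] := leP s a; last by rewrite (le_trans (zL _ _))// ler_wpM2r// lerDr.
  have -> : x s - z (tclamp (q t)) = (x s - x a) + (z (tclamp (q a)) - z (tclamp (q t))).
    by rewrite za addrA subrK.
  rewrite (le_trans (ler_normD _ _))// mulrDl lerD//.
    rewrite (le_trans (xL _ _))// ler_wpM2l// distrC [`|s - t|]distrC !ger0_norm ?subr_ge0//.
    by rewrite lerD2r ltW.
  rewrite (le_trans (zL _ _))// ler_wpM2l// distrC [`|s - t|]distrC !ger0_norm ?subr_ge0//.
    by rewrite lerD2l lerN2.
  exact: ltW.
have x'r s : `|x' s| <= r by rewrite /x'; case: ifP => // _; exact/zr/tclamp01.
have x'E s : a <= s <= a + tau -> x' s = z ((s - a) / tau).
  move=> /andP[as_ st]; rewrite /x'; case: ifP => sa.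
    have -> : s = a by apply/le_anti; rewrite sa as_.
    by rewrite -/(q a) qa xa; case: fz.
  rewrite tclamp_id// divr_ge0 ?subr_ge0 ?(ltW tau0)//=.
  by rewrite ler_pdivrMr// mul1r lerBlDl.
have u'MB i : bounded_meas (fun s => u' s 0 i).
  have -> : (fun s => u' s 0 i) = (fun s => if s <= a then u s 0 i else (tau^-1 *: th) 0 i).
    by apply/funext => s; rewrite /u'; case: ifP.
  by apply: bounded_meas_if => //; exact: bounded_meas_cst.
have I'MB j : bounded_meas (fun s => letter_field (u' s) (x' s) 0 j) by exact:
  (bounded_meas_letter_field M0 tame_field j x'L x'r u'MB).
have first_part t j : 0 <= t <= a ->
    (\int[mu]_(s in `]0%R, t]) (letter_field (u' s) (x' s) 0 j))%R = x t 0 j.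
  move=> ht; rewrite (xI t ht); apply: eq_Rintegral => s.
  rewrite inE/= in_itv/= /u' /x' => /andP[_ st].
  by have -> : s <= a by apply: le_trans st _; case/andP: ht.
exists u', x'; split=> //.
- split; first by rewrite addr_ge0// ltW.
  rewrite x'E; last by rewrite lexx lerDl ltW.
  by rewrite [a + _]addrC addrK divff// gt_eqF.
- split=> // s; rewrite /u'; case: ifP => // _.
  by rewrite mxE mulVf// gt_eqF.
- by exists (L + C / tau).
- move=> t /andP[t0 ta] j; have [le_ta|lt_at] := leP t a.
    by rewrite first_part ?t0// /x' le_ta.
  have x'a : x' a = x a by rewrite /x' lexx.
  have hB := @Rintegral_itvB R (fun s => letter_field (u' s) (x' s) 0 j) (BRight 0) (BRight t) a.
  rewrite -[RHS](subrK (\int[mu]_(s in `]0%R, a]) (letter_field (u' s) (x' s) 0 j))%R).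
  rewrite hB; [|exact: bounded_meas_integrable|by rewrite bnd_simp|by rewrite bnd_simp ltW].
  rewrite first_part ?a0 ?lexx//.
  have -> : (\int[mu]_(s in `]a, t]) (letter_field (u' s) (x' s) 0 j))%R =
      (\int[mu]_(s in `]a, t]) (letter_field (tau^-1 *: th) (x' s) 0 j))%R.
    by apply: eq_Rintegral => s; rewrite inE/= in_itv/= /u' => /andP[as_ _]; rewrite leNgt as_.
  rewrite (rescaled_integral M0 tame_field j fz tau0 x'L x'r x'E) ?(ltW lt_at)//.
  by rewrite x'a subrK.
Qed.

Lemma traj_steers (w : seq letter) (a : R) u x y y' : traj a u x y -> positive_word w ->
  steers f0 f1 r w y y' -> exists u' x', traj (a + duration w) u' x' y'.
Proof.
rewrite /duration; elim: w a u x y => [|th w IH] a u x y hx /=.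
  by move=> _ <-; exists u, x; rewrite big_nil addr0.
move=> /andP[t0 hw] [z [fz zr st]]; have [u2 [x2 h2]] := traj_extend hx t0 fz zr.
by rewrite big_cons addrA; exact: IH h2 hw st.
Qed.

End Extension.

(** * The control system *)

(** The ball of the product topology on row vectors is the ball of the sup norm. *)
Lemma ball0_norm {R : realType} {d : nat} (x : 'rV[R]_d) (e : R) :
  ball (0 : 'rV[R]_d) e x <-> `|x| < e.
Proof. by rewrite -(@ball_normE R 'rV[R]_d) /= sub0r normrN. Qed.

Section Controls.
Context {R : realType} {d N : nat}.
Hypothesis N_gt0 : (0 < N)%N.
Local Notation V := 'rV[R]_d.
Local Notation E := (ctrl_brackets N).

Lemma bracket_length i : Br_length (bracket i.+1) = (2 * i).+1.
Proof.
case: i => [|i] //.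
rewrite -[Br_length _]/(Br_length (M_ i) + Br_length (M_ i.+1))%N !M_length; lia.
Qed.

Lemma ctrl_bracketsE : E = [seq bracket i | i <- iota 1 N].
Proof.
move: N_gt0; case: N => // n _; rewrite /ctrl_brackets /= (iotaDl 1 1) -map_comp.
by congr (_ :: _); apply/eq_in_map => i; rewrite mem_iota; case: i.
Qed.

(** The brackets of the system have distinct lengths. *)
Lemma ctrl_uniq : uniq E.
Proof.
rewrite ctrl_bracketsE map_inj_in_uniq ?iota_uniq// => i j.
rewrite !mem_iota; case: i => // i; case: j => // j _ _ e.
by have := bracket_length i; rewrite e bracket_length => -[] /eqP;
  rewrite eqn_pmul2l// => /eqP ->.
Qed.

Definition ctrl_index (b : seq_sub E) : 'I_N.+1 := inord (index (ssval b) E).+1.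

Lemma sum_controls (f0 f1 : V -> V) (th : 'rV[R]_N.+1) (x : V) :
  letter_field f0 f1 th x = th 0 0 *: f0 x +
    \sum_(b : seq_sub E) th 0 (ctrl_index b) *: eval_Br f0 f1 (ssval b) x.
Proof.
rewrite /letter_field big_ord_recl; congr (_ + _).
have sE : size E = N by rewrite ctrl_bracketsE size_map size_iota.
have inE_ (i : 'I_N) : bracket i.+1 \in E.
  by rewrite ctrl_bracketsE; apply/mapP; exists i.+1 => //; rewrite mem_iota /= add1n ltnS.
pose h (i : 'I_N) : seq_sub E := SeqSub (inE_ i).
have idx (i : 'I_N) : index (bracket i.+1) E = i.
  have nthE : nth X0 E i = bracket i.+1.
    by rewrite ctrl_bracketsE (nth_map 0%N) ?size_iota// nth_iota// add1n.
  by rewrite -nthE index_uniq ?sE// ctrl_uniq.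
have hidx (i : 'I_N) : index (ssval (h i)) E = i := idx i.
have hinj : injective h.
  by move=> i j hij; apply: ord_inj; rewrite -(hidx i) -(hidx j) hij.
have hbij : bijective h.
  by apply: inj_card_bij => //; rewrite card_seq_sub ?ctrl_uniq// sE card_ord.
rewrite [RHS](reindex h) /=; last exact: onW_bij.
apply: eq_bigr => i _; congr (th 0 _ *: _); apply: val_inj.
by rewrite /ctrl_index hidx /= inordK// ltnS.
Qed.

End Controls.

Theorem theorem1p19 (R : realType) (N : nat) (hN : (1 <= N)%N)
    (d : nat) (hd : (1 <= d)%N)
    (U : set 'rV[R]_d) (hU : open U) (hU0 : U 0)
    (f0 f1 : 'rV[R]_d -> 'rV[R]_d)
    (hf0 : smooth_on U f0) (hf1 : smooth_on U f1)
    (hf00 : f0 0 = 0)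
    (hL : L_at0 (2 * N) f0 f1 = setT) :
  small_state_STLC U f0
    (fun b : seq_sub (ctrl_brackets N) => eval_Br f0 f1 (ssval b)).
Proof.
move=> T delta T0 delta0.
pose K := (2 * N)%N.
have sfield b : smooth_vf U (eval_Br f0 f1 b) := (smooth_fn_eval b hU hf0 hf1).1.
have [r1 [M1 [r10 M10 t1]]] := tame_fin
  (p := fun (ij : 'I_N.+1 * 'I_d) x => eval_Br f0 f1 (bracket ij.1) x 0 ij.2)
  hU hU0 (fun ij => sfield (bracket ij.1) ij.2).
have [r2 [M2 [r20 M20 t2]]] := tame_fin
  (p := fun iwj : 'I_N.+1 * 'I_(nwords K) * 'I_d =>
     lie (eval_Br f0 f1 (bracket iwj.1.1)) (iter_lie f0 f1 (word_of iwj.1.2) iwj.2))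
  hU hU0 (fun iwj => smooth_fn_lie hU (sfield (bracket iwj.1.1)) (smooth_fn_iter_lie hU hf0
    hf1 (word_of iwj.1.2) iwj.2)).
pose r := Num.min (Num.min r1 r2) (delta / 2); pose M := M1 + M2.
have r0 : 0 < r by rewrite !lt_min r10 r20 divr_gt0.
have rdelta : r <= delta / 2 by rewrite ge_min lexx orbT.
have M0 : 0 <= M by rewrite addr_ge0.
have tame_field (i : 'I_N.+1) (j : 'I_d) : tame U (fun x => eval_Br f0 f1 (bracket i) x 0 j) r M.
  by apply: tame_le (t1 (i, j)); rewrite ?lerDl// !ge_min lexx.
have tame_lie (i : 'I_N.+1) (w : 'I_(nwords K)) (j : 'I_d) :
    tame U (lie (eval_Br f0 f1 (bracket i)) (iter_lie f0 f1 (word_of w) j)) r M.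
  by apply: tame_le (t2 (i, w, j)); rewrite ?lerDr// !ge_min lexx orbT.
clearbody r M.
have [c c0 reach] := local_reach hN hU hU0 hf0 hf1 hf00 hL r0 M0 tame_field tame_lie T0.
exists c => // xs /ball0_norm/ltW/reach[w [wpos wT st]].
(* the trajectory first waits at 0, so that the whole of [0, T] is used *)
have wait : traj f0 f1 r (T - duration w) (fun=> delta_mx 0 0 : 'rV[R]_N.+1) (fun=> 0) 0.
  by apply: traj_wait => //; rewrite subr_ge0.
have [u [x]] := traj_steers M0 tame_field wait wpos st.
rewrite subrK => -[[_ xT] [uMB u1] [L xL] xr xI].
exists (fun b s => u s 0 (ctrl_index b)), x; split=> //.
- by move=> b; exact: bounded_meas_integrable.
- split.
  + apply: continuous_subspaceT; have [L0 hx] := xL; exact: (lip_continuous L0 hx).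
  + move=> t _; pose j : 'I_d := Ordinal hd.
    by have [] := tame_field 0 j (x t) (x t) (xr t) (xr t).
  + move=> t ht j; rewrite (xI t ht) -Rintegral_itv_bndo_bndc; last first.
      by apply: bounded_meas_integrable; exact: (bounded_meas_letter_field M0 tame_field j xL
        xr uMB).
    apply: eq_Rintegral => s _; rewrite (sum_controls hN) u1 scale1r.
    by [].
- move=> t _; apply/ball0_norm; rewrite (le_lt_trans (xr t))//.
  by rewrite (le_lt_trans rdelta)// ltr_pdivrMr// ltr_pMr// ltr1n.
Qed.
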